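(* Let $X$ be a compact Hausdorff space and let $\mathcal A\subseteq C(X)$ be a uniform logmodular subalgebra. Then every contractive representation of $\mathcal A$ is completely contractive if and only if for all $f_1,f_2\in\mathcal A$ with $|f_1|^2+|f_2|^2<1$ (pointwise on $X$) there exist an integer $m$, scalar matrices $C_0,\ldots,C_m$ (of appropriate sizes) all with norm less than one, and diagonal matrices $D_1,\ldots,D_m$ (of appropriate sizes) whose diagonal entries are elements of the open unit ball of $\mathcal A$, such that $$\begin{bmatrix} f_1\\ f_2\end{bmatrix}=C_0D_1C_1\cdots D_mC_m.$$
   Context: $C(X)$ is the C*-algebra of continuous complex-valued functions on $X$ with the supremum norm, and $C_{\mathbb R}(X)$ is the set of real-valued functions in $C(X)$. For a unital subalgebra $\mathcal A\subseteq C(X)$, $\mathcal A^{-1}$ denotes the set of elements of $\mathcal A$ that are invertible with inverse in $\mathcal A$. $\mathcal A$ is a (uniform) logmodular subalgebra of $C(X)$ if $\{\log|a| : a\in\mathcal A^{-1}\}$ is uniformly dense in $C_{\mathbb R}(X)$; equivalently, $\{|a|^2: a\in\mathcal A^{-1}\}$ is dense in the set of positive invertible functions in $C(X)$. A (contractive) representation of $\mathcal A$ on a Hilbert space $\mathcal H$ is a unital contractive homomorphism $\rho:\mathcal A\to B(\mathcal H)$. It is completely contractive if for every $n$ the map $(a_{i,j})\mapsto(\rho(a_{i,j}))$ from $M_n(\mathcal A)\subseteq M_n(C(X))$ to $M_n(B(\mathcal H))=B(\mathcal H^{(n)})$ is contractive. Scalar matrices are matrices with complex entries, with the operator norm. ''Appropriate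 sizes'' means simply that the sizes are such that the product is defined (and has the size of the left-hand side). *)

(* Defs.v *)
From HB Require Import structures.
From mathcomp Require Import all_boot all_order all_algebra.
From mathcomp Require Import all_classical all_reals all_analysis.
From mathcomp Require Import complex sesquilinear.

Set Implicit Arguments.
Unset Strict Implicit.
Unset Printing Implicit Defensive.

Import Order.TTheory GRing.Theory Num.Theory.
Import numFieldNormedType.Exports.

Local Open Scope classical_set_scope.
Local Open Scope ring_scope.
Local Open Scope complex_scope.

(* The usual topology and norm of the complex numbers. *)
HB.instance Definition _ (R : realType) := NormedModule.copy R[i] R[i]^o.

(* In a normed module over R[i] the norm `|v| is a (nonnegative) element of
   R[i]; rnorm v is the same number as an element of R. *)
Definition rnorm (R : realType) (V : normedModType R[i]) (v : V) : R :=
  complex.Re `|v|.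

(* sup denotes 0 on the empty set and on unbounded sets; the sets below are
   bounded wherever these norms are used, and an empty set occurs only for
   functions on the empty space. *)
Definition supnorm (R : realType) (X : Type) (f : X -> R[i]) : R :=
  sup [set rnorm (f x) | x in [set: X]].

Definition opnorm (R : realType) (V W : Type) (normV : V -> R) (normW : W -> R)
    (T : V -> W) : R :=
  sup [set normW (T v) | v in [set v | normV v <= 1]].

(* The norm of the n-fold Hilbert space direct sum V (+) ... (+) V. *)
Definition l2norm (R : realType) (V : normedModType R[i]) (n : nat)
    (v : 'I_n -> V) : R :=
  Num.sqrt (\sum_(i < n) rnorm (v i) ^+ 2).

(* Operator norm for the Euclidean norms; the library norm `|M| on matrices is
   instead the maximum of the absolute values of the entries. *)
Definition mxopnorm (R : realType) (p q : nat) (M : 'M[R[i]]_(p, q)) : R :=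
  opnorm (fun v : 'cV[R[i]]_q => l2norm (fun j => v j 0))
         (fun w : 'cV[R[i]]_p => l2norm (fun i => w i 0)) (mulmx M).

(* The C*-norm of M_n(C(X)). *)
Definition mxsupnorm (R : realType) (X : Type) (n : nat)
    (a : 'M[X -> R[i]]_n) : R :=
  sup [set mxopnorm (map_mx (fun f : X -> R[i] => f x) a) | x in [set: X]].

Record unital_subalgebra (R : realType) (X : topologicalType)
    (A : set (X -> R[i])) : Prop := UnitalSubalgebra {
  subalgebra_continuous : forall f, A f -> continuous f;
  subalgebra1 : A 1;
  subalgebraD : forall f g, A f -> A g -> A (f + g);
  subalgebraZ : forall (c : R[i]) f, A f -> A (c *: f);
  subalgebraM : forall f g, A f -> A g -> A (f * g) }.

Definition invertibles (R : realType) (X : topologicalType)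
    (A : set (X -> R[i])) : set (X -> R[i]) :=
  [set a | A a /\ exists2 b, A b & a * b = 1].

Definition logmodular (R : realType) (X : topologicalType)
    (A : set (X -> R[i])) : Prop :=
  unital_subalgebra A /\
  [set h : X -> R | continuous h] `<=`
    closure ([set (fun x => ln (rnorm (a x))) | a in invertibles A]
               : set {uniform X -> R}).

(* H is a Hilbert space: its (complete) norm comes from an inner product. *)
Definition is_hilbert (R : realType) (H : completeNormedModType R[i]) : Prop :=
  exists dot : {dot H for (@Num.conj R[i])}, forall v : H, `|v| ^+ 2 = dot v v.

(* Only the values of rho on A matter. *)
Record contractive_representation (R : realType) (X : topologicalType)
    (A : set (X -> R[i])) (H : completeNormedModType R[i])
    (rho : (X -> R[i]) -> (H -> H)) : Prop := ContractiveRepresentation {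
  rep_linear : forall a, A a -> linear (rho a);
  rep_bounded : forall a, A a -> continuous (rho a);
  rep1 : rho 1 = id;
  repD : forall a b, A a -> A b -> rho (a + b) = rho a + rho b;
  repZ : forall (c : R[i]) a, A a -> rho (c *: a) = c *: rho a;
  repM : forall a b, A a -> A b -> rho (a * b) = rho a \o rho b;
  rep_contractive : forall a, A a ->
    opnorm (@rnorm R H) (@rnorm R H) (rho a) <= supnorm a }.

(* The operator matrix (rho (a i j)) acting on the n-fold sum of H. *)
Definition ampliation (R : realType) (X : Type)
    (H : completeNormedModType R[i]) (rho : (X -> R[i]) -> (H -> H)) (n : nat)
    (a : 'M[X -> R[i]]_n) (v : 'I_n -> H) : 'I_n -> H :=
  fun i => \sum_(j < n) rho (a i j) (v j).

Definition completely_contractive (R : realType) (X : topologicalType)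
    (A : set (X -> R[i])) (H : completeNormedModType R[i])
    (rho : (X -> R[i]) -> (H -> H)) : Prop :=
  forall (n : nat) (a : 'M[X -> R[i]]_n), (forall i j, A (a i j)) ->
    opnorm (@l2norm R H n) (@l2norm R H n) (ampliation rho a) <= mxsupnorm a.

(* C_0 D_1 C_1 ... D_m C_m, where the scalar matrix C_i has size
   k i x k i.+1 and D_i is the diagonal matrix with diagonal D i; the
   entries C_(m+1), ... and D_0, D_(m+1), ... are not used. *)
Fixpoint alternating_product (R : realType) (X : Type) (k : nat -> nat)
    (C : forall i, 'M[R[i]]_(k i, k i.+1))
    (D : forall i, 'rV[X -> R[i]]_(k i)) (m : nat) :
    'M[X -> R[i]]_(k 0%N, k m.+1) :=
  match m with
  | 0%N => map_mx cst (C 0%N)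
  | m'.+1 => alternating_product C D m' *m diag_mx (D m'.+1)
             *m map_mx cst (C m'.+1)
  end.

(* Main.v *)
Require Import Defs.
From HB Require Import structures.
From mathcomp Require Import all_boot all_order all_algebra.
From mathcomp Require Import all_classical all_reals all_analysis.
From mathcomp Require Import complex sesquilinear.
From mathcomp Require Import ring lra.

Set Implicit Arguments.
Unset Strict Implicit.
Unset Printing Implicit Defensive.

Import Order.TTheory GRing.Theory Num.Theory.
Import numFieldNormedType.Exports.

Local Open Scope classical_set_scope.
Local Open Scope ring_scope.
Local Open Scope complex_scope.

(** The theorem compares two norms of a column (f1, f2) over A: the norm of C(X),
    and the gauge of the products of scalar and diagonal contractions. Below,
    f f^* stands for the kernel f(x) f(y)^* on X times X.

    Necessity of the factorization. The kernels b (1 - g g^* ) b^* with b, g in A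
    and |g| <= 1 generate a convex cone. A state L of this cone gives a positive
    quadratic functional q(b) = L(b b^* ) on A with q(g b) <= q(b), that is, a
    contractive representation of A. Its space is taken to be the dual of (A, q),
    which is complete from the outset and on which A acts by transposition,
    through its commutativity. Let |f1|^2 + |f2|^2 <= r^2 and r < t < 1. Complete
    contractivity gives q(f1) + q(f2) <= r^2 q(1) for all states
    ([completely_contractive_column]), so that by separation ([cone_state]) the
    kernel t^2 - f1 f1^* - f2 f2^* is in the cone ([column_certificate]). With
    F = (f1, f2) / t this membership is an identity between Gram kernels, and the
    [lurking_isometry] extracts from it a scalar contraction V with
    [F; b] = V [1; g b], where g is diagonal. This fixed point equation is that of
    a linear system with stationary state b and constant output F; letting it run
    for N steps writes F, up to a factor that tends to 1 with N, as an explicit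
    product of contractions ([realization_factorable]).

    Sufficiency. The factorization and its transpose give, for a contractive
    representation rho and |f1|^2 + |f2|^2 < 1, the inequalities
    |rho(f1) h|^2 + |rho(f2) h|^2 <= |h|^2 and
    |rho(f1) h1 + rho(f2) h2|^2 <= |h1|^2 + |h2|^2 ([pair_bicontractive]). By the
    first one, sup |rho(f) h|^2 over |f|^2 <= p is a superlinear function of
    p > 0, and by the second one so is sup |rho(f)^* h|^2. As A is logmodular, p is
    close to |a|^2 with a invertible in A, and
    |h|^2 = <rho(a) h, rho(a^-1)^* h> bounds the value of the first function at p
    against that of the second one at 1 / p ([tangent_duality]). At p = 1 the two
    superlinear derivatives therefore dominate each other with opposite signs,
    which forces them to be equal and linear ([tangent_odd]). The resulting
    positive functional D_h on C(X) depends quadratically on h and satisfies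
    D_h(Re f) = Re <rho(f) h, h>: it is a positive extension of rho to C(X).
    Positive maps on C(X) are completely positive, by partitions of unity, and
    this is what makes rho completely contractive ([rep_matrix_contractive]). *)

(** * Positive forms from quadratic functionals *)

Section ComplexSquare.
Variable R : realType.
Implicit Types (z w : R[i]) (t : R).

Definition csq z : R := complex.Re z ^+ 2 + complex.Im z ^+ 2.

Lemma csq_ge0 z : 0 <= csq z.
Proof. by rewrite addr_ge0 ?sqr_ge0. Qed.

Lemma csq0 : csq 0 = 0. Proof. by rewrite /csq /= expr0n addr0. Qed.
Lemma csq1 : csq 1 = 1. Proof. by rewrite /csq /= expr1n expr0n addr0. Qed.

Lemma csqM z w : csq (z * w) = csq z * csq w.
Proof. by case: z => a b; case: w => c d; rewrite /csq /=; ring. Qed.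

Lemma csqN z : csq (- z) = csq z.
Proof. by case: z => a b; rewrite /csq /= !sqrrN. Qed.

Lemma csqJ z : csq (conjc z) = csq z.
Proof. by case: z => a b; rewrite /csq /= sqrrN. Qed.

Lemma csq_real t : csq t%:C = t ^+ 2.
Proof. by rewrite /csq /= expr0n addr0. Qed.

Lemma csqE z : (csq z)%:C = z * conjc z.
Proof. by case: z => a b; rewrite /csq /=; simpc; congr Complex; ring. Qed.

Lemma csq_eq0 z : csq z = 0 -> z = 0.
Proof.
case: z => a b /eqP; rewrite /csq /= paddr_eq0 ?sqr_ge0 // !sqrf_eq0.
by case/andP => /eqP-> /eqP->.
Qed.

Lemma rnormE z : rnorm z = Num.sqrt (csq z).
Proof. by rewrite /rnorm normc_def. Qed.

Lemma rnorm_sqr z : rnorm z ^+ 2 = csq z.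
Proof. by rewrite rnormE sqr_sqrtr ?csq_ge0. Qed.

Lemma rnorm_ge0 (V : normedModType R[i]) (v : V) : 0 <= rnorm v.
Proof. by have := normr_ge0 v; rewrite lecE => /andP[_]. Qed.

Lemma rnormC (V : normedModType R[i]) (v : V) : (rnorm v)%:C = `|v|.
Proof. by rewrite RRe_real // ger0_real. Qed.

Lemma ReD z w : complex.Re (z + w) = complex.Re z + complex.Re w.
Proof. by case: z; case: w. Qed.

Lemma ReB z w : complex.Re (z - w) = complex.Re z - complex.Re w.
Proof. by case: z; case: w. Qed.

Lemma ReN z : complex.Re (- z) = - complex.Re z.
Proof. by case: z. Qed.

Lemma Re_sum I (r : seq I) (P : pred I) (F : I -> R[i]) :
  complex.Re (\sum_(i <- r | P i) F i) = \sum_(i <- r | P i) complex.Re (F i).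
Proof. by apply: (big_morph _ ReD). Qed.

Lemma ReImE z : z = (complex.Re z)%:C + (complex.Im z)%:C * Complex 0 1.
Proof. by case: z => a b; simpc. Qed.

Lemma ReJ z : complex.Re (conjc z) = complex.Re z.
Proof. by case: z. Qed.

Lemma ReZ t z : complex.Re (t%:C * z) = t * complex.Re z.
Proof. by case: z => a b /=; rewrite mul0r subr0. Qed.

Lemma conjcD z w : conjc (z + w) = conjc z + conjc w. Proof. exact: rmorphD. Qed.
Lemma conjcN z : conjc (- z) = - conjc z. Proof. exact: rmorphN. Qed.
Lemma conjcM z w : conjc (z * w) = conjc z * conjc w. Proof. exact: rmorphM. Qed.
Lemma real_complexN t : (- t)%:C = - t%:C. Proof. exact: rmorphN. Qed.
Lemma real_complexD t t' : (t + t')%:C = t%:C + t'%:C. Proof. exact: rmorphD. Qed.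
Lemma real_complexM t t' : (t * t')%:C = t%:C * t'%:C. Proof. exact: rmorphM. Qed.

Lemma csqD_le z w : csq (z + w) <= 2 * csq z + 2 * csq w.
Proof.
case: z w => x y [x' y']; rewrite /csq /=.
by have := sqr_ge0 (x - x'); have := sqr_ge0 (y - y'); nra.
Qed.

End ComplexSquare.

(** The discriminant of a nonnegative quadratic polynomial, in the form in which
    it turns an optimal scaling into a Cauchy-Schwarz inequality. *)
Lemma discriminant_le (R : realType) (a b c : R) : 0 <= a -> 0 <= b -> 0 <= c ->
  (forall t, 0 <= a + t ^+ 2 * c * b - 2 * t * c) -> c <= a * b.
Proof.
move=> a0 b0 c0 key.
have [b_eq0|b_neq0] := eqVneq b 0.
  have [->|c_neq0] := eqVneq c 0; first by rewrite mulr_ge0.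
  have cpos : 0 < c by rewrite lt0r c_neq0.
  have := key ((a + 1) / c); rewrite b_eq0 mulr0 addr0 -mulrA divfK //; lra.
have bpos : 0 < b by rewrite lt0r b_neq0.
have := key b^-1; rewrite expr2 -!mulrA.
have -> : b^-1 * (b^-1 * (c * b)) = b^-1 * c by field.
move=> h; have : 0 <= b * (a + b^-1 * c - 2 * (b^-1 * c)) by rewrite mulr_ge0.
have -> : b * (a + b^-1 * c - 2 * (b^-1 * c)) = a * b - c by field.
by rewrite subr_ge0.
Qed.

Lemma double_le_sqr (R : realType) (a b x : R) : 0 <= a -> 0 <= b -> x ^+ 2 <= a * b ->
  2 * x <= a + b.
Proof.
move=> a0 b0 xab; have [x0|x0] := ltP x 0; first by lra.
rewrite -(@ler_pXn2r _ 2) ?nnegrE ?mulr_ge0 ?addr_ge0 //.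
by have := sqr_ge0 (a - b); nra.
Qed.

Section PositiveForms.
Variables (R : realType) (V : lmodType R[i]).
Implicit Types (u v w : V) (B : V -> V -> R[i]) (q : V -> R).

Record psd B : Prop := Psd {
  psdP : forall a u v w, B (a *: u + v) w = a * B u w + B v w;
  psdC : forall u v, B v u = conjc (B u v);
  psd_ge0 : forall u, 0 <= complex.Re (B u u) }.

Section Theory.
Variable B : V -> V -> R[i].
Hypothesis Bpsd : psd B.

Lemma psdD u v w : B (u + v) w = B u w + B v w.
Proof. by have := psdP Bpsd 1 u v w; rewrite scale1r mul1r. Qed.

Lemma psd0l w : B 0 w = 0.
Proof. by apply: (addrI (B 0 w)); rewrite -psdD !addr0. Qed.

Lemma psdZ a u w : B (a *: u) w = a * B u w.
Proof. by rewrite -[a *: u]addr0 (psdP Bpsd) psd0l addr0. Qed.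

Lemma psdN u w : B (- u) w = - B u w.
Proof. by rewrite -scaleN1r psdZ mulN1r. Qed.

Lemma psdDr u v w : B w (u + v) = B w u + B w v.
Proof. by rewrite (psdC Bpsd) psdD conjcD -!(psdC Bpsd). Qed.

Lemma psdZr a u w : B w (a *: u) = conjc a * B w u.
Proof. by rewrite (psdC Bpsd) psdZ conjcM -(psdC Bpsd). Qed.

Lemma psdNr u w : B w (- u) = - B w u.
Proof. by rewrite (psdC Bpsd) psdN conjcN -(psdC Bpsd). Qed.

Lemma psd_suml I (r : seq I) (P : pred I) (F : I -> V) w :
  B (\sum_(i <- r | P i) F i) w = \sum_(i <- r | P i) B (F i) w.
Proof. by apply: (big_morph (B^~ w) (fun u v => psdD u v w) (psd0l w)). Qed.

Lemma psd_real u : B u u = (complex.Re (B u u))%:C.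
Proof.
have := psdC Bpsd u u; case: (B u u) => a b /= [] b0.
by congr Complex; lra.
Qed.

Lemma psd_sqD u v : complex.Re (B (u + v) (u + v)) =
  complex.Re (B u u) + complex.Re (B v v) + 2 * complex.Re (B u v).
Proof.
rewrite psdD !psdDr (psdC Bpsd u v) !ReD ReJ; ring.
Qed.

Lemma psd_sqB u v : complex.Re (B (u - v) (u - v)) =
  complex.Re (B u u) + complex.Re (B v v) - 2 * complex.Re (B u v).
Proof. by rewrite psd_sqD psdN !psdNr opprK ReN; ring. Qed.

Lemma psd_sqZ a u : complex.Re (B (a *: u) (a *: u)) = csq a * complex.Re (B u u).
Proof. by rewrite psdZ psdZr mulrA -csqE ReZ. Qed.

Lemma psd_AMGM u v :
  2 * complex.Re (B u v) <= complex.Re (B u u) + complex.Re (B v v).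
Proof. by have := psd_ge0 Bpsd (u - v); rewrite psd_sqB; lra. Qed.

Lemma psd_sqD_le u v : complex.Re (B (u + v) (u + v)) <=
  2 * complex.Re (B u u) + 2 * complex.Re (B v v).
Proof. by rewrite psd_sqD; have := psd_AMGM u v; lra. Qed.

Lemma psd_CauchySchwarz u v :
  csq (B u v) <= complex.Re (B u u) * complex.Re (B v v).
Proof.
set a := complex.Re (B u u); set b := complex.Re (B v v); set c := csq (B u v).
have a0 : 0 <= a := psd_ge0 Bpsd u; have b0 : 0 <= b := psd_ge0 Bpsd v.
have c0 : 0 <= c := csq_ge0 _.
have key t : 0 <= a + t ^+ 2 * c * b - 2 * t * c.
  have := psd_ge0 Bpsd (u - (t%:C * B u v) *: v).
  rewrite psd_sqB psd_sqZ csqM csq_real -/a -/b -/c psdZr conjcM conjc_real.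
  by rewrite -[_ * conjc _ * _]mulrA [conjc _ * _]mulrC -csqE -/c ReZ /= mulrA.
exact: discriminant_le.
Qed.

Lemma psd_sqrtD u v : Num.sqrt (complex.Re (B (u + v) (u + v))) <=
  Num.sqrt (complex.Re (B u u)) + Num.sqrt (complex.Re (B v v)).
Proof.
have := psd_CauchySchwarz u v; have := psd_sqD u v.
set a := complex.Re (B u u); set b := complex.Re (B v v); set c := B u v => -> h.
have a0 : 0 <= a := psd_ge0 Bpsd u; have b0 : 0 <= b := psd_ge0 Bpsd v.
rewrite -(@ler_pXn2r _ 2) ?nnegrE ?addr_ge0 ?sqrtr_ge0 // sqr_sqrtr; last first.
  by have := psd_ge0 Bpsd (u + v); rewrite psd_sqD.
suff cle : complex.Re c <= Num.sqrt a * Num.sqrt b.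
  by rewrite sqrrD !sqr_sqrtr //; lra.
rewrite (le_trans (ler_norm _)) // -sqrtr_sqr -sqrtrM // ler_wsqrtr //.
by have := sqr_ge0 (complex.Im c); rewrite /csq in h; lra.
Qed.

End Theory.

(** The parallelogram law for all unitary mixtures of two vectors, and not
    only for the rotation by an eighth of a turn: it contains homogeneity, so
    that no continuity has to be invoked to go from rational to complex
    scalars. *)
Definition unitary_parallelogram q := forall a b u v,
  q (a *: u + b *: v) + q (- conjc b *: u + conjc a *: v) = (csq a + csq b) * (q u + q v).

Lemma psd_parallelogram B : psd B -> unitary_parallelogram (fun u => complex.Re (B u u)).
Proof.
move=> Bpsd a b u v; rewrite !(psd_sqD Bpsd) !(psd_sqZ Bpsd) csqN !csqJ.
rewrite !(psdZ Bpsd) !(psdZr Bpsd) conjcK.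
have -> : - conjc b * (a * B u v) = - (a * (conjc b * B u v)) by ring.
by rewrite ReN; ring.
Qed.

Lemma parallelogram0 q : unitary_parallelogram q -> q 0 = 0.
Proof. by move=> qP; have := qP 0 0 0 0; rewrite !scaler0 addr0 csq0; lra. Qed.

Lemma parallelogramZ q a u : unitary_parallelogram q -> q (a *: u) = csq a * q u.
Proof.
move=> qP; have := qP a 0 u 0.
by rewrite conjc0 oppr0 !scaler0 scale0r !addr0 csq0 (parallelogram0 qP) !addr0.
Qed.

Section JordanVonNeumann.
Variable q : V -> R.
Hypothesis qP : unitary_parallelogram q.

Let q0 : q 0 = 0 := parallelogram0 qP.
Let qZ a u : q (a *: u) = csq a * q u := parallelogramZ a u qP.

Let qN u : q (- u) = q u.
Proof. by rewrite -scaleN1r qZ csqN csq1 mul1r. Qed.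

Let par u v : q (u + v) + q (u - v) = 2 * (q u + q v).
Proof.
have := qP 1 1 u v; rewrite conjc1 scaleN1r !scale1r csq1 => h.
by rewrite -[u - v]opprB qN [v - u]addrC h; ring.
Qed.

Let E u v := q (u + v) - q u - q v.

Let EC u v : E u v = E v u.
Proof. by rewrite /E [u + v]addrC; ring. Qed.

(* eliminating q (w - v) and q (u + (w - v)) between four parallelograms *)
Let ED u v w : E (u + v) w = E u w + E v w.
Proof.
have h1 := par (u + w) v; have h2 := par u (w - v).
have h3 := par (u + v) w; have h4 := par w v.
rewrite /E; move: h1 h2 h3 h4.
rewrite [u + w + v]addrAC [u + w - v]addrAC -[u - v + w]addrA [- v + w]addrC.
rewrite [u + v + w]addrAC opprB.
have -> : u + v - w = u + (v - w) by rewrite addrA.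
rewrite [w + v]addrC.
by rewrite [u + w + v]addrAC; lra.
Qed.

Let E0 w : E 0 w = 0. Proof. by rewrite /E add0r q0; ring. Qed.

Let EN u w : E (- u) w = - E u w.
Proof. by apply/eqP; rewrite -addr_eq0 -ED addrC subrr E0. Qed.

Let EZ a u w : E (a *: u) w = E u (conjc a *: w).
Proof.
have := qP a 1 u w; rewrite conjc1 scaleN1r scale1r csq1 => h.
have := EN u (conjc a *: w); rewrite /E !qZ qN csqJ; lra.
Qed.

Let ER (t : R) u w : E (t%:C *: u) w = t * E u w.
Proof.
wlog t0 : t / 0 <= t.
  move=> hw; have [|t0] := leP 0 t; first exact: hw.
  rewrite -[t]opprK real_complexN scaleNr EN hw; first by ring.
  by rewrite oppr_ge0 ltW.
rewrite -{1}(sqr_sqrtr t0) expr2 real_complexM -scalerA EZ conjc_real.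
by rewrite /E -scalerDr !qZ csq_real sqr_sqrtr //; ring.
Qed.

(** The real part of the form is the polarization of q, and its imaginary part is
    forced by linearity. *)
Lemma jordan_von_neumann : (forall u, 0 <= q u) ->
  exists2 B, psd B & forall u, B u u = (q u)%:C.
Proof.
move=> q_ge0.
pose ii : R[i] := Complex 0 1.
pose B u v := Complex (E u v / 2) (- E (ii *: u) v / 2).
have EE a u v : E (a *: u) v = complex.Re a * E u v + complex.Im a * E (ii *: u) v.
  by rewrite {1}[a]ReImE scalerDl ED ER -scalerA ER.
have Bq u : B u u = (q u)%:C.
  have c2 : csq (1 + 1 : R[i]) = 4 by rewrite /csq /=; ring.
  have ci : csq (ii + 1) = 2 by rewrite /csq /=; ring.
  have ci' : csq ii = 1 by rewrite /csq /=; ring.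
  have e1 : u + u = (1 + 1) *: u by rewrite scalerDl scale1r.
  have e2 : ii *: u + u = (ii + 1) *: u by rewrite scalerDl scale1r.
  rewrite /B /E e1 e2 !qZ c2 ci ci'.
  by congr Complex; lra.
exists B => //; split.
- move=> a u v w; rewrite /B scalerDr !ED scalerA EE.
  rewrite [E ((_ * a) *: _) _]EE.
  by case: a => x y /=; simpc; congr Complex; field.
- move=> u v; rewrite /B /= EC; congr Complex.
  rewrite EZ EC (_ : conjc ii = - ii) ?scaleNr ?EN ?mulNr ?opprK //.
  by apply/eqP; rewrite eq_complex /= oppr0 !eqxx.
- by move=> u; rewrite Bq /=.
Qed.

End JordanVonNeumann.
End PositiveForms.
(** * The dual of a quadratic seminorm as a Hilbert space *)

Section QuadraticDual.
Variables (R : realType) (V : lmodType R[i]) (q : V -> R).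
Implicit Types (u v : V) (f g : V -> R[i]).

Definition qbounded : {pred V -> R[i]} := [pred f | `[<
  (forall a u v, f (a *: u + v) = a * f u + f v) /\
  exists2 c, 0 <= c & forall u, csq (f u) <= c * q u >]].

Lemma qbounded_submod : submod_closed qbounded.
Proof.
split.
  apply/asboolP; split=> [a u v|]; first by rewrite /= mulr0 addr0.
  by exists 0 => // u; rewrite csq0 mul0r.
move=> a f g /asboolP[flin [c c0 fc]] /asboolP[glin [d d0 gd]].
apply/asboolP; split=> [b u v|].
  by rewrite !fctE flin glin !scalerDr !mulrDr /GRing.scale /=; ring.
exists (2 * csq a * c + 2 * d).
  by rewrite addr_ge0 // ?mulr_ge0 ?csq_ge0.
move=> u; rewrite !fctE.
have -> : (2 * csq a * c + 2 * d) * q u = 2 * (csq a * (c * q u)) + 2 * (d * q u) by ring.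
apply: le_trans (csqD_le _ _) _; apply: lerD; rewrite ler_pM2l //.
by rewrite /GRing.scale /= csqM ler_wpM2l ?csq_ge0.
Qed.

HB.instance Definition _ := GRing.isSubmodClosed.Build _ _ qbounded qbounded_submod.

(** The proofs that q is the square of a seminorm are parameters of the type:
    the norm that it carries is obtained from them. *)
Record qdual (qP : unitary_parallelogram q) (q_ge0 : forall u, 0 <= q u) :=
  QDual { qdual_fun :> V -> R[i]; qdual_bounded : qdual_fun \in qbounded }.

Variables (qP : unitary_parallelogram q) (q_ge0 : forall u, 0 <= q u).
Local Notation dual := (qdual qP q_ge0).
Implicit Types (phi psi : dual).

HB.instance Definition _ := [isSub for @qdual_fun qP q_ge0].
HB.instance Definition _ := [Choice of dual by <:].
HB.instance Definition _ := [SubChoice_isSubLmodule of dual by <:].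

Lemma qdualP phi a u v : phi (a *: u + v) = a * phi u + phi v.
Proof. by case/asboolP: (qdual_bounded phi). Qed.

Lemma qdual_bound phi : exists2 c, 0 <= c & forall u, csq (phi u) <= c * q u.
Proof. by case/asboolP: (qdual_bounded phi). Qed.

Lemma qdual0 phi : phi 0 = 0.
Proof.
have := qdualP phi 1 0 0; rewrite scaler0 addr0 mul1r => h.
by apply: (addrI (phi 0)); rewrite addr0 -h.
Qed.

Lemma qdualD phi u v : phi (u + v) = phi u + phi v.
Proof. by have := qdualP phi 1 u v; rewrite scale1r mul1r. Qed.

Lemma qdualZ phi a u : phi (a *: u) = a * phi u.
Proof. by have := qdualP phi a u 0; rewrite !addr0 qdual0 addr0. Qed.

Lemma qdual_addE phi psi u : (phi + psi) u = phi u + psi u.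
Proof. by []. Qed.

Lemma qdual_scaleE a phi u : (a *: phi) u = a * phi u.
Proof. by []. Qed.

(** The square of the dual norm, written as a Legendre transform: this form is
    invariant under changes of variables, which carries the parallelogram law
    over from q. *)
Definition dual_sq phi : R := sup [set 2 * complex.Re (phi u) - q u | u in [set: V]].

Lemma dual_sq_le phi c : (forall u, 2 * complex.Re (phi u) - q u <= c) -> dual_sq phi <= c.
Proof.
move=> h; apply: ge_sup; first by exists (2 * complex.Re (phi 0) - q 0), 0.
by move=> _ [u _ <-].
Qed.

Lemma le_dual_sq phi u : 2 * complex.Re (phi u) - q u <= dual_sq phi.
Proof.
apply: ub_le_sup; last by exists u.
have [c c0 hc] := qdual_bound phi; exists c => _ [w _ <-].
have := hc w; rewrite /csq; have := q_ge0 w.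
set x := complex.Re _; set y := complex.Im _; set b := q w => b0 h.
have x2 : x ^+ 2 <= c * b by have := sqr_ge0 y; lra.
by have := double_le_sqr c0 b0 x2; lra.
Qed.

Lemma dual_sq_ge0 phi : 0 <= dual_sq phi.
Proof.
by have := le_dual_sq phi 0; rewrite qdual0 (parallelogram0 qP) /= mulr0 subr0.
Qed.

Lemma dual_sqR_le (t : R) phi : t != 0 -> dual_sq (t%:C *: phi) <= t ^+ 2 * dual_sq phi.
Proof.
move=> t0; apply: dual_sq_le => u.
have := le_dual_sq phi (t^-1%:C *: u); rewrite qdualZ (parallelogramZ _ _ qP) csq_real !ReZ.
rewrite ?qdual_scaleE ?ReZ => h.
have -> : 2 * (t * complex.Re (phi u)) - q u =
   t ^+ 2 * (2 * (t^-1 * complex.Re (phi u)) - t^-1 ^+ 2 * q u) by field.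
by rewrite ler_wpM2l ?sqr_ge0.
Qed.

Lemma dual_sqR (t : R) phi : t != 0 -> dual_sq (t%:C *: phi) = t ^+ 2 * dual_sq phi.
Proof.
move=> t0; apply/eqP; rewrite eq_le dual_sqR_le //=.
have := @dual_sqR_le t^-1 (t%:C *: phi); rewrite scalerA -real_complexM mulVf // scale1r.
move=> /(_ (invr_neq0 t0)) h.
rewrite -(ler_pM2l (_ : 0 < t^-1 ^+ 2)) ?exprn_even_gt0 ?invr_eq0 //.
by rewrite mulrA -exprMn mulVf // expr1n mul1r.
Qed.

(** The mixture of phi and psi is evaluated, at u and v, as phi and psi are at the
    transposed mixture of u and v, whose lengths are known by the parallelogram
    law of q. *)
Lemma dual_sq_mix_le a b phi psi :
  dual_sq (a *: phi + b *: psi) + dual_sq (- conjc b *: phi + conjc a *: psi) <=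
  (csq a + csq b) * (dual_sq phi + dual_sq psi).
Proof.
set k := csq a + csq b; have k0 : 0 <= k by rewrite addr_ge0 ?csq_ge0.
rewrite -lerBrDr; apply: dual_sq_le => u; rewrite lerBrDr addrC -lerBrDr.
apply: dual_sq_le => v; rewrite lerBrDr.
have [k_eq0|k_neq0] := eqVneq k 0.
  have a0 : a = 0 by apply: csq_eq0; have := csq_ge0 a; have := csq_ge0 b; rewrite /k in k_eq0; lra.
  have b0 : b = 0 by apply: csq_eq0; have := csq_ge0 a; have := csq_ge0 b; rewrite /k in k_eq0; lra.
  rewrite k_eq0 mul0r a0 b0 !qdual_addE !qdual_scaleE conjc0 oppr0 !mul0r addr0 /=.
  by have := q_ge0 u; have := q_ge0 v; lra.
pose u' := k^-1%:C *: (a *: u - conjc b *: v); pose v' := k^-1%:C *: (b *: u + conjc a *: v).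
have hu := le_dual_sq phi u'; have hv := le_dual_sq psi v'.
have qE : q u' + q v' = k^-1 * (q u + q v).
  rewrite /u' /v' !(parallelogramZ _ _ qP) -mulrDr -scaleNr.
  have := qP a (- conjc b) u v; rewrite conjcN opprK conjcK => ->.
  by rewrite csqN csqJ -/k csq_real; field.
have -> : 2 * complex.Re ((- conjc b *: phi + conjc a *: psi) v) - q v +
  (2 * complex.Re ((a *: phi + b *: psi) u) - q u) =
  k * (2 * complex.Re (phi u') - q u' + (2 * complex.Re (psi v') - q v')).
  have -> : 2 * complex.Re (phi u') - q u' + (2 * complex.Re (psi v') - q v') =
    2 * complex.Re (phi u') + 2 * complex.Re (psi v') - (q u' + q v') by ring.
  rewrite qE /u' /v' !qdual_addE !qdual_scaleE !qdualZ !ReZ -scaleNr !qdualD !qdualZ !ReD.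
  by field.
by rewrite ler_wpM2l // lerD.
Qed.

(** The inverse mixture gives the opposite inequality. *)
Lemma dual_sq_parallelogram : unitary_parallelogram dual_sq.
Proof.
move=> a b phi psi; apply/eqP; rewrite eq_le dual_sq_mix_le /=.
set k := csq a + csq b; have k0 : 0 <= k by rewrite addr_ge0 ?csq_ge0.
have [k_eq0|k_neq0] := eqVneq k 0.
  by rewrite k_eq0 mul0r addr_ge0 ?dual_sq_ge0.
have := dual_sq_mix_le (conjc a) (- b) (a *: phi + b *: psi) (- conjc b *: phi + conjc a *: psi).
have -> : conjc a *: (a *: phi + b *: psi) + - b *: (- conjc b *: phi + conjc a *: psi) = k%:C *: phi.
  apply/val_inj/funext => u.
  change (conjc a * (a * phi u + b * psi u) + - b * (- conjc b * phi u + conjc a * psi u)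
    = k%:C * phi u).
  by rewrite /k real_complexD !csqE; ring.
have -> : - conjc (- b) *: (a *: phi + b *: psi) + conjc (conjc a) *: (- conjc b *: phi + conjc a *: psi) = k%:C *: psi.
  apply/val_inj/funext => u.
  change (- conjc (- b) * (a * phi u + b * psi u) +
    conjc (conjc a) * (- conjc b * phi u + conjc a * psi u) = k%:C * psi u).
  by rewrite /k real_complexD !csqE conjcN conjcK; ring.
rewrite !dual_sqR // csqN csqJ -/k -mulrDr => h.
by rewrite -(ler_pM2l (_ : 0 < k)) ?lt0r ?k_neq0 // mulrA -expr2.
Qed.



Lemma csq_qdual_le phi u : csq (phi u) <= dual_sq phi * q u.
Proof.
apply: discriminant_le; rewrite ?csq_ge0 ?dual_sq_ge0 // => t.
have := le_dual_sq phi ((t%:C * conjc (phi u)) *: u).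
rewrite qdualZ (parallelogramZ _ _ qP) csqM csqJ csq_real -[_ * conjc _ * _]mulrA [conjc _ * _]mulrC -csqE ReZ /=; lra.
Qed.

Lemma dual_sq_le_csq phi c : 0 <= c -> (forall u, csq (phi u) <= c * q u) -> dual_sq phi <= c.
Proof.
move=> c0 hc; apply: dual_sq_le => w.
have := hc w; rewrite /csq; have := q_ge0 w.
set x := complex.Re _; set y := complex.Im _; set b := q w => b0 h.
have x2 : x ^+ 2 <= c * b by have := sqr_ge0 y; lra.
by have := double_le_sqr c0 b0 x2; lra.
Qed.

Definition dual_norm phi : R[i] := (Num.sqrt (dual_sq phi))%:C.

Lemma dual_normD phi psi : dual_norm (phi + psi) <= dual_norm phi + dual_norm psi.
Proof.
have [B Bpsd BE] := jordan_von_neumann dual_sq_parallelogram dual_sq_ge0.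
rewrite /dual_norm -real_complexD lecR.
by have := psd_sqrtD Bpsd phi psi; rewrite !BE.
Qed.

Lemma dual_normZ a phi : dual_norm (a *: phi) = `|a| * dual_norm phi.
Proof.
have [B Bpsd BE] := jordan_von_neumann dual_sq_parallelogram dual_sq_ge0.
have := psd_sqZ Bpsd a phi; rewrite !BE /= /dual_norm => ->.
by rewrite sqrtrM ?csq_ge0 // real_complexM normc_def.
Qed.

Lemma dual_norm_eq0 phi : dual_norm phi = 0 -> phi = 0.
Proof.
move=> [] /eqP; rewrite sqrtr_eq0 => le0.
apply/val_inj/funext => u /=; apply: csq_eq0; apply/eqP; rewrite eq_le csq_ge0 andbT.
by apply: le_trans (csq_qdual_le phi u) _; rewrite mulr_le0_ge0.
Qed.

HB.instance Definition _ :=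
  Lmodule_isNormed.Build R[i] dual dual_normD dual_normZ dual_norm_eq0.

Lemma qdual_ball phi (e : R) psi : 0 < e -> ball phi e%:C psi <-> dual_sq (phi - psi) < e ^+ 2.
Proof.
move=> e0; rewrite -ball_normE /ball_ /= /Num.norm /= /dual_norm ltcR.
rewrite -(@ltr_pXn2r _ 2) ?nnegrE ?sqrtr_ge0 ?(ltW e0) // sqr_sqrtr ?dual_sq_ge0 //.
Qed.

Lemma dual_sqB_le phi psi chi :
  dual_sq (phi - psi) <= 2 * dual_sq (phi - chi) + 2 * dual_sq (chi - psi).
Proof.
have [B Bpsd BE] := jordan_von_neumann dual_sq_parallelogram dual_sq_ge0.
by have := psd_sqD_le Bpsd (phi - chi) (chi - psi); rewrite !BE /= addrA subrK.
Qed.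

(** A Cauchy filter converges pointwise, and its Cauchy estimates, being
    inequalities between values at points, pass to the pointwise limit. *)
Lemma qdual_complete (F : set_system dual) : ProperFilter F -> cauchy F -> cvg F.
Proof.
move=> FF /cauchyP Fc.
have Fball (e : R) : 0 < e -> exists phi, F [set psi | dual_sq (phi - psi) < e ^+ 2].
  move=> e0; have [|phi hphi] := Fc e%:C; first by rewrite ltcR.
  by exists phi; apply: filterS hphi => psi /qdual_ball; apply.
have cvgL (L : R[i] -> R) u : (forall z w, L z - L w = L (z - w)) ->
    (forall z, L z ^+ 2 <= csq z) -> cvg ((fun phi : dual => L (phi u)) @ F).
  move=> LB Lle; apply: cauchy_cvg; apply: cauchy_exP => _/posnumP[e].
  pose d := e%:num / Num.sqrt (q u + 1).
  have q1 : 0 < q u + 1 by rewrite ltr_wpDl.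
  have d0 : 0 < d by rewrite divr_gt0 // sqrtr_gt0.
  have [phi hphi] := Fball d d0; exists (L (phi u)).
  change (F ((fun psi : dual => L (psi u)) @^-1` ball (L (phi u)) e%:num)).
  apply: filterS hphi => psi /= h; rewrite -ball_normE /ball_ /= LB.
  rewrite -(@ltr_pXn2r _ 2) ?nnegrE // -normrX ger0_norm ?sqr_ge0 //.
  apply: le_lt_trans (Lle _) _; apply: le_lt_trans (csq_qdual_le (phi - psi) u) _.
  apply: (@le_lt_trans _ _ (dual_sq (phi - psi) * (q u + 1))).
    by rewrite ler_wpM2l ?dual_sq_ge0 // lerDl.
  by rewrite -ltr_pdivlMr // (lt_le_trans h) // /d expr_div_n sqr_sqrtr // ltW.
have cvgRe u := cvgL (@complex.Re R) u (fun z w => esym (ReB z w))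
  (fun z => ltac:(by rewrite /csq lerDl sqr_ge0)).
have ImB (z w : R[i]) : complex.Im z - complex.Im w = complex.Im (z - w).
  by case: z; case: w.
have cvgIm u := cvgL (@complex.Im R) u ImB (fun z => ltac:(by rewrite /csq lerDr sqr_ge0)).
pose psi u : R[i] := lim ((fun phi : dual => complex.Re (phi u)) @ F)
   +i* lim ((fun phi : dual => complex.Im (phi u)) @ F).
have near_psi u (e : R) : 0 < e -> F [set phi : dual | csq (phi u - psi u) < e].
  move=> e0; have e20 : 0 < Num.sqrt (e / 2) by rewrite sqrtr_gt0 divr_gt0.
  have /cvgrPdist_lt/(_ _ e20) h1 := cvgRe u; have /cvgrPdist_lt/(_ _ e20) h2 := cvgIm u.
  apply: filterS2 h1 h2 => phi h1 h2 /=.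
  have sq (x : R) : `|x| < Num.sqrt (e / 2) -> x ^+ 2 < e / 2.
    move=> h; rewrite -[ltRHS]sqr_sqrtr ?divr_ge0 ?(ltW e0) // -(ger0_norm (sqr_ge0 x)) normrX.
    by rewrite ltr_pXn2r ?nnegrE ?sqrtr_ge0.
  rewrite -csqN opprB /csq -ImB ReB [in complex.Re _]/psi [in complex.Im _]/psi /=.
  by have := sq _ h1; have := sq _ h2; lra.
have dist_psi (e : R) (phi : dual) : 0 < e -> F [set chi | dual_sq (phi - chi) < e ^+ 2] ->
    forall u, csq (phi u - psi u) <= 2 * e ^+ 2 * q u.
  move=> e0 hphi u; apply/ler_addgt0Pr => d d0.
  have d20 : 0 < d / 2 by rewrite divr_gt0.
  have [chi [h1 h2]] := filter_ex (filterI hphi (near_psi u _ d20)).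
  rewrite -[phi u](subrK (chi u)) -addrA; apply: le_trans (csqD_le _ _) _.
  have h3 := csq_qdual_le (phi - chi) u; have h4 := q_ge0 u.
  rewrite /= in h1 h2; rewrite (_ : (phi - chi) u = phi u - chi u) // in h3.
  have h5 : dual_sq (phi - chi) * q u <= e ^+ 2 * q u by rewrite ler_wpM2r // ltW.
  by lra.
have psi_lin a u v : psi (a *: u + v) = a * psi u + psi v.
  apply/eqP; rewrite -subr_eq0; apply/eqP/csq_eq0/eqP; rewrite eq_le csq_ge0 andbT.
  apply/ler_addgt0Pr => d d0; rewrite add0r.
  pose k := 4 * (csq a + 1).
  have k0 : 0 < k by rewrite mulr_gt0 // ltr_wpDl ?csq_ge0.
  pose e := d / (2 * k).
  have e0 : 0 < e by rewrite divr_gt0 // mulr_gt0.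
  have [phi [[h1 h2] h3]] := filter_ex (filterI (filterI (near_psi (a *: u + v) _ e0)
     (near_psi u _ e0)) (near_psi v _ e0)).
  rewrite /= in h1 h2 h3.
  have -> : psi (a *: u + v) - (a * psi u + psi v) =
     - (phi (a *: u + v) - psi (a *: u + v)) + (a * (phi u - psi u) + (phi v - psi v)).
    by rewrite qdualP; ring.
  apply: le_trans (csqD_le _ _) _; rewrite csqN.
  have h4 := csqD_le (a * (phi u - psi u)) (phi v - psi v); rewrite csqM in h4.
  have h5 : csq a * csq (phi u - psi u) <= csq a * e by rewrite ler_wpM2l ?csq_ge0 // ltW.
  have -> : d = 2 * k * e by rewrite /e mulrC divfK // mulf_neq0 // gt_eqF.
  have := csq_ge0 a; rewrite /k; nra.
have psi_bdd : psi \in qbounded.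
  apply/asboolP; split=> //.
  have [phi hphi] := Fball 1 ltr01; exists (2 * dual_sq phi + 4).
    by rewrite addr_ge0 // mulr_ge0 ?dual_sq_ge0.
  move=> u; rewrite -[psi u](subrK (phi u)); apply: le_trans (csqD_le _ _) _.
  have := dist_psi 1 phi ltr01 hphi u; rewrite -csqN opprB.
  by have := csq_qdual_le phi u; lra.
apply/cvg_ex; exists (QDual qP q_ge0 psi_bdd); apply/fcvg_ballP => e e0.
have eE : e = (complex.Re e)%:C by rewrite RRe_real // gtr0_real.
rewrite eE in e0 *; move: (complex.Re e) e0 => r; rewrite ltcR => r0.
have r30 : 0 < r / 3 by rewrite divr_gt0.
have [phi hphi] := Fball _ r30; apply: filterS (hphi) => chi /= h; apply/qdual_ball => //.
apply: le_lt_trans (dual_sqB_le _ _ phi) _.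
have h2 : dual_sq (QDual qP q_ge0 psi_bdd - phi) <= 2 * (r / 3) ^+ 2.
  apply: dual_sq_le_csq; first by rewrite mulr_ge0 ?sqr_ge0.
  move=> u; rewrite -csqN.
  change (csq (- (psi u - phi u)) <= 2 * (r / 3) ^+ 2 * q u); rewrite opprB.
  exact: dist_psi.
by have : 0 < r ^+ 2 by [rewrite exprn_gt0]; rewrite !expr_div_n in h h2 *; nra.
Qed.

HB.instance Definition _ := Uniform_isComplete.Build dual qdual_complete.

Lemma rnorm_qdual phi : rnorm phi ^+ 2 = dual_sq phi.
Proof. by rewrite /rnorm /Num.norm /= sqr_sqrtr // dual_sq_ge0. Qed.

End QuadraticDual.

Lemma is_hilbert_psd (R : realType) (H : completeNormedModType R[i]) :
  is_hilbert H <-> exists2 B, psd B & forall v : H, B v v = (rnorm v ^+ 2)%:C.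
Proof.
have sqE (v : H) : `|v| ^+ 2 = (rnorm v ^+ 2)%:C by rewrite -rnormC rmorphXn.
split=> [[dot dotE]|[B Bpsd BE]].
  exists (fun u v => dot u v); last by move=> v; rewrite -dotE sqE.
  split=> [a u v w|u v|u].
  - by rewrite linearPl.
  - by rewrite hermitian_subproof expr0 mul1r.
  - by rewrite -dotE sqE /= sqr_ge0.
have Bbil : bilinear_for *%R (@Num.conj R[i] \; *%R) B.
  split=> u a v w /=; first exact: psdP.
  by rewrite (psdDr Bpsd) (psdZr Bpsd).
have Bherm (u v : H) : B u v = (-1) ^+ false * Num.conj (B v u).
  by rewrite expr0 mul1r (psdC Bpsd).
have Bdot (u : H) : u != 0 -> 0 < B u u.
  move=> u0; rewrite BE ltcR exprn_gt0 //.
  have : 0 < `|u| by rewrite normr_gt0.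
  by rewrite -rnormC ltcR.
pose D : {dot H for (@Num.conj R[i])} := HB.pack B
  (@bilinear_isBilinear.Build _ _ _ _ *%R (@Num.conj R[i] \; *%R) B Bbil)
  (@isHermitianSesquilinear.Build _ _ false (@Num.conj R[i]) B Bherm)
  (@isDotProduct.Build _ _ B Bdot).
by exists D => v; rewrite sqE -BE.
Qed.

Lemma qdual_is_hilbert (R : realType) (V : lmodType R[i]) (q : V -> R)
  (qP : unitary_parallelogram q) (q_ge0 : forall u, 0 <= q u) :
  is_hilbert (qdual qP q_ge0).
Proof.
apply/is_hilbert_psd.
have [B Bpsd BE] := jordan_von_neumann (@dual_sq_parallelogram _ _ _ qP q_ge0)
  (@dual_sq_ge0 _ _ _ qP q_ge0).
by exists B => // v; rewrite BE rnorm_qdual.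
Qed.
(** * Operator norms and scalar contractions *)

Section OperatorNorms.
Variable R : realType.

Lemma opnorm_le (V W : Type) (nV : V -> R) (nW : W -> R) (T : V -> W) (M : R) :
  0 <= M -> (exists v, nV v <= 1) -> (forall v, nW (T v) <= M * nV v) -> opnorm nV nW T <= M.
Proof.
move=> M0 [v0 v0P] h; apply: ge_sup; first by exists (nW (T v0)), v0.
move=> _ [v /= v1 <-]; apply: le_trans (h v) _.
by rewrite -[leRHS]mulr1 ler_wpM2l.
Qed.

(** The a priori bound M is required because the supremum defining the
    operator norm collapses to 0 on unbounded sets. *)
Lemma le_opnorm (V W : lmodType R[i]) (nV : V -> R) (nW : W -> R) (T : V -> W) (M : R) :
  (forall t v, 0 <= t -> nV (t%:C *: v) = t * nV v) ->
  (forall t w, 0 <= t -> nW (t%:C *: w) = t * nW w) ->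
  (forall t v, 0 <= t -> T (t%:C *: v) = t%:C *: T v) ->
  (forall v, 0 <= nV v) -> (forall v, nW (T v) <= M * nV v) ->
  forall v, nW (T v) <= opnorm nV nW T * nV v.
Proof.
move=> hV hW hT nV0 hM v.
have [v_eq0|v_neq0] := eqVneq (nV v) 0.
  by have := hM v; rewrite v_eq0 !mulr0.
have vpos : 0 < nV v by rewrite lt0r v_neq0 nV0.
rewrite -ler_pdivrMr // mulrC -hW ?invr_ge0 // -hT ?invr_ge0 //.
apply: ub_le_sup; last first.
  by exists ((nV v)^-1%:C *: v) => //=; rewrite hV ?invr_ge0 // mulVf.
exists (Num.max M 0) => _ [w /= w1 <-]; apply: le_trans (hM w) _.
apply: (@le_trans _ _ (Num.max M 0 * nV w)).
  by rewrite ler_wpM2r // le_max lexx.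
by rewrite -[leRHS]mulr1 ler_wpM2l // le_max lexx orbT.
Qed.

End OperatorNorms.

Section Columns.
Variable R : realType.
Implicit Types n p r : nat.

Definition sqn n (v : 'cV[R[i]]_n) : R := \sum_(j < n) csq (v j 0).

Definition cdot n (u v : 'cV[R[i]]_n) : R[i] := \sum_(j < n) u j 0 * conjc (v j 0).

Lemma sqn_ge0 n (v : 'cV[R[i]]_n) : 0 <= sqn v.
Proof. by apply: sumr_ge0 => j _; exact: csq_ge0. Qed.

Lemma cdotE n (v : 'cV[R[i]]_n) : cdot v v = (sqn v)%:C.
Proof. by rewrite /cdot /sqn rmorph_sum /=; apply: eq_bigr => j _; rewrite csqE. Qed.

Lemma cdot_psd n : psd (@cdot n).
Proof.
split=> [a u v w|u v|u].
- rewrite /cdot mulr_sumr -big_split /=; apply: eq_bigr => j _.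
  by rewrite !mxE mulrDl mulrA.
- rewrite /cdot [RHS]rmorph_sum /=; apply: eq_bigr => j _.
  by rewrite [RHS]conjcM conjcK mulrC.
- by rewrite cdotE sqn_ge0.
Qed.

Lemma sqnZ n a (v : 'cV[R[i]]_n) : sqn (a *: v) = csq a * sqn v.
Proof. by rewrite /sqn mulr_sumr; apply: eq_bigr => j _; rewrite mxE csqM. Qed.

Lemma sqn0 n : sqn (0 : 'cV[R[i]]_n) = 0.
Proof. by rewrite /sqn big1 // => j _; rewrite mxE csq0. Qed.

Lemma sqn_eq0 n (v : 'cV[R[i]]_n) : sqn v = 0 -> v = 0.
Proof.
move=> /eqP; rewrite /sqn psumr_eq0 => [/allP h|j _]; last exact: csq_ge0.
by apply/colP => j; rewrite mxE; apply/csq_eq0/eqP/h; rewrite mem_index_enum.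
Qed.

Lemma sqn_col_mx n p (u : 'cV[R[i]]_n) (v : 'cV[R[i]]_p) : sqn (col_mx u v) = sqn u + sqn v.
Proof.
rewrite /sqn big_split_ord /=.
by congr (_ + _); apply: eq_bigr => j _; rewrite ?col_mxEu ?col_mxEd.
Qed.

Lemma sqn1 (v : 'cV[R[i]]_1) : sqn v = csq (v 0 0).
Proof. by rewrite /sqn big_ord1. Qed.

Definition contraction p n (M : 'M[R[i]]_(p, n)) := forall v, sqn (M *m v) <= sqn v.

Lemma sqn_mulmx_le p n (M : 'M[R[i]]_(p, n)) v :
  sqn (M *m v) <= (\sum_(i < p) \sum_(j < n) csq (M i j)) * sqn v.
Proof.
rewrite {1}/sqn mulr_suml; apply: ler_sum => i _.
have := psd_CauchySchwarz (cdot_psd n) v (\col_j conjc (M i j)).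
have -> : cdot v (\col_j conjc (M i j)) = (M *m v) i 0.
  by rewrite mxE; apply: eq_bigr => j _; rewrite mxE conjcK mulrC.
move/le_trans; apply; rewrite !cdotE /= mulrC ler_wpM2r ?sqn_ge0 //.
by apply: ler_sum => j _; rewrite mxE csqJ.
Qed.

Lemma l2norm_sqn n (v : 'cV[R[i]]_n) : l2norm (fun j => v j 0) = Num.sqrt (sqn v).
Proof. by congr Num.sqrt; apply: eq_bigr => j _; rewrite rnorm_sqr. Qed.

Lemma mxopnorm_le p n (M : 'M[R[i]]_(p, n)) (k : R) : 0 <= k ->
  (forall v, sqn (M *m v) <= k ^+ 2 * sqn v) -> mxopnorm M <= k.
Proof.
move=> k0 h; apply: opnorm_le => // [|v].
  by exists 0; rewrite l2norm_sqn sqn0 sqrtr0.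
rewrite !l2norm_sqn -[k in leRHS]ger0_norm // -sqrtr_sqr.
by rewrite -sqrtrM ?sqr_ge0 // ler_wsqrtr.
Qed.

Lemma sqn_mulmx_mxopnorm p n (M : 'M[R[i]]_(p, n)) v :
  sqn (M *m v) <= mxopnorm M ^+ 2 * sqn v.
Proof.
have sqrt_scale m t (w : 'cV[R[i]]_m) : 0 <= t ->
    l2norm (fun j => (t%:C *: w) j 0) = t * l2norm (fun j => w j 0).
  by move=> t0; rewrite !l2norm_sqn sqnZ csq_real sqrtrM ?sqr_ge0 // sqrtr_sqr ger0_norm.
have sum0 : 0 <= \sum_(i < p) \sum_(j < n) csq (M i j).
  by apply: sumr_ge0 => i _; apply: sumr_ge0 => j _; exact: csq_ge0.
have hT t (w : 'cV[R[i]]_n) : 0 <= t -> M *m (t%:C *: w) = t%:C *: (M *m w).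
  by rewrite -scalemxAr.
have hn (w : 'cV[R[i]]_n) : 0 <= l2norm (fun j => w j 0) by rewrite l2norm_sqn sqrtr_ge0.
have hb (w : 'cV[R[i]]_n) : l2norm (fun j => (M *m w) j 0) <=
    Num.sqrt (\sum_(i < p) \sum_(j < n) csq (M i j)) * l2norm (fun j => w j 0).
  by rewrite !l2norm_sqn -sqrtrM // ler_wsqrtr // sqn_mulmx_le.
have := le_opnorm (@sqrt_scale n) (@sqrt_scale p) hT hn hb v.
rewrite -/(mxopnorm M) !l2norm_sqn => h.
rewrite -[leLHS]sqr_sqrtr ?sqn_ge0 // -[sqn v in leRHS]sqr_sqrtr ?sqn_ge0 // -exprMn.
by rewrite ler_pXn2r ?nnegrE ?sqrtr_ge0 // (le_trans _ h) ?sqrtr_ge0.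
Qed.

Lemma mxopnorm_ge0 p n (M : 'M[R[i]]_(p, n)) : 0 <= mxopnorm M.
Proof.
rewrite /mxopnorm /opnorm; set E := [set _ | _ in _].
have [E_sup|/sup_out -> //] := pselect (has_sup E).
apply: (@le_trans _ _ (l2norm (fun i => (M *m (0 : 'cV[R[i]]_n)) i 0))); first by rewrite l2norm_sqn sqrtr_ge0.
apply: ub_le_sup; first by case: E_sup.
by exists 0 => //=; rewrite l2norm_sqn sqn0 sqrtr0.
Qed.

Lemma contraction_mxopnorm p n (M : 'M[R[i]]_(p, n)) : mxopnorm M <= 1 -> contraction M.
Proof.
move=> M1 v; apply: le_trans (sqn_mulmx_mxopnorm M v) _.
by rewrite ler_piMl ?sqn_ge0 // expr_le1 ?mxopnorm_ge0.
Qed.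

(** Duality for the bilinear pairing: |M^T u|^2 is the value of u at M w, where w
    is the entrywise conjugate of M^T u. *)
Lemma contraction_tr p n (M : 'M[R[i]]_(p, n)) : contraction M -> contraction M^T.
Proof.
move=> hM u; set S := sqn _.
pose w : 'cV[R[i]]_n := \col_j conjc ((M^T *m u) j 0).
have wS : sqn w = S by apply: eq_bigr => j _; rewrite mxE csqJ.
pose z : 'cV[R[i]]_p := \col_i conjc ((M *m w) i 0).
have zS : sqn z = sqn (M *m w) by apply: eq_bigr => j _; rewrite mxE csqJ.
have SE : cdot u z = S%:C.
  rewrite -cdotE /cdot.
  transitivity (\sum_i \sum_j u i 0 * (M i j * w j 0)).
    by apply: eq_bigr => i _; rewrite mxE conjcK mxE mulr_sumr.
  rewrite exchange_big /=; apply: eq_bigr => j _.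
  transitivity ((M^T *m u) j 0 * w j 0); last by rewrite [w j 0]mxE.
  rewrite [(M^T *m u) j 0]mxE mulr_suml; apply: eq_bigr => i _.
  by rewrite [M^T j i]mxE mulrA [u i 0 * _]mulrC.
have := psd_CauchySchwarz (cdot_psd p) u z; rewrite SE csq_real !cdotE /= zS => h.
have S0 : 0 <= S := sqn_ge0 _.
have [->|S_neq0] := eqVneq S 0; first exact: sqn_ge0.
have Spos : 0 < S by rewrite lt0r S_neq0.
have h2 := hM w; rewrite wS in h2.
rewrite -(ler_pM2r Spos) -expr2 (le_trans h) // ler_wpM2l ?sqn_ge0 //.
Qed.

End Columns.

Section ContractionOnForms.
Variables (R : realType) (V : lmodType R[i]).

(** Splitting off from the form the rank one part carried by one of the vectors
    leaves a positive form with fewer vectors of nonzero length; on the rank one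
    part the inequality is the one for scalars. *)
Lemma psd_contraction (B : V -> V -> R[i]) p n (M : 'M[R[i]]_(p, n)) (v : 'I_n -> V) :
  psd B -> contraction M ->
  \sum_(i < p) complex.Re (B (\sum_(j < n) M i j *: v j) (\sum_(j < n) M i j *: v j))
    <= \sum_(j < n) complex.Re (B (v j) (v j)).
Proof.
move=> Bpsd hM.
have [k] := ubnP #|[pred j | complex.Re (B (v j) (v j)) != 0]|.
elim: k B Bpsd => // k IHk B Bpsd; rewrite ltnS => card_k.
have [j0 hj0|all0] := pickP [pred j | complex.Re (B (v j) (v j)) != 0]; last first.
  have Bv0 j w : B (v j) w = 0.
    apply/csq_eq0/eqP; rewrite eq_le csq_ge0 andbT.
    apply: le_trans (psd_CauchySchwarz Bpsd _ _) _.
    by move/(_ j)/negbFE/eqP: all0 => /= ->; rewrite mul0r.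
  rewrite big1 ?sumr_ge0 // => [j _|i _]; first exact: psd_ge0.
  by rewrite psd_suml // big1 // => j _; rewrite psdZ // Bv0 mulr0.
set v0 := v j0; set s := complex.Re (B v0 v0).
have spos : 0 < s by rewrite lt0r psd_ge0 // andbT; exact: hj0.
(* the Schur complement of v0 *)
pose B' u w := B u w - s^-1%:C * (B u v0 * B v0 w).
have qB' u : complex.Re (B' u u) = complex.Re (B u u) - s^-1 * csq (B u v0).
  by rewrite /B' ReB ReZ [B v0 u](psdC Bpsd) -csqE.
have B'psd : psd B'.
  split=> [a u w z|u w|u].
  - by rewrite /B' !(psdP Bpsd); ring.
  - rewrite /B' conjcD conjcN !conjcM conjc_real -!(psdC Bpsd).
    by rewrite [B v0 u * _]mulrC.
  - rewrite qB' subr_ge0 mulrC ler_pdivrMr //.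
    exact: psd_CauchySchwarz.
have card_lt : (#|[pred j | complex.Re (B' (v j) (v j)) != 0%R]| < k)%N.
  apply: leq_trans card_k; apply: proper_card; apply/properP; split.
    apply/fintype.subsetP => j; rewrite !inE qB'; apply: contraNN => /eqP Bj0.
    have := psd_CauchySchwarz Bpsd (v j) v0; rewrite Bj0 mul0r => le0.
    have -> : csq (B (v j) v0) = 0 by apply/eqP; rewrite eq_le le0 csq_ge0.
    by rewrite mulr0 subr0.
  exists j0; first by rewrite inE.
  rewrite !inE qB' -/v0 (psd_real Bpsd) csq_real -/s negbK.
  by rewrite subr_eq0; apply/eqP; field; rewrite gt_eqF.
have := IHk _ B'psd card_lt.
set x := fun i => \sum_(j < n) M i j *: v j.
have e u : complex.Re (B u u) = complex.Re (B' u u) + s^-1 * csq (B u v0).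
  by rewrite qB' subrK.
have eS m (y : 'I_m -> V) : \sum_(i < m) complex.Re (B (y i) (y i)) =
    \sum_(i < m) complex.Re (B' (y i) (y i)) + s^-1 * \sum_(i < m) csq (B (y i) v0).
  by rewrite mulr_sumr -big_split; apply: eq_bigr => i _; exact: e.
move=> h; rewrite (eS _ x) (eS _ v); apply: lerD h _.
rewrite ler_wpM2l ?invr_ge0 ?(ltW spos) //.
have := hM (\col_j B (v j) v0).
congr (_ <= _); apply: eq_bigr => i _; rewrite mxE //.
congr csq; rewrite psd_suml //; apply: eq_bigr => j _.
by rewrite psdZ // mxE.
Qed.

End ContractionOnForms.
(** * The lurking isometry *)

Section LurkingIsometry.
Variable R : realType.

Definition adj p n (M : 'M[R[i]]_(p, n)) : 'M[R[i]]_(n, p) := \matrix_(i, j) conjc (M j i).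

Lemma adj_mul p n r (M : 'M[R[i]]_(p, n)) (N : 'M[R[i]]_(n, r)) : adj (M *m N) = adj N *m adj M.
Proof.
apply/matrixP => i j; rewrite !mxE [LHS]rmorph_sum; apply: eq_bigr => k _.
by rewrite !mxE [LHS]conjcM mulrC.
Qed.

Lemma adjK p n (M : 'M[R[i]]_(p, n)) : adj (adj M) = M.
Proof. by apply/matrixP => i j; rewrite !mxE conjcK. Qed.

Lemma adjB p n (M N : 'M[R[i]]_(p, n)) : adj (M - N) = adj M - adj N.
Proof. by apply/matrixP => i j; rewrite !mxE conjcD conjcN. Qed.

Lemma adjZ p n (t : R) (M : 'M[R[i]]_(p, n)) : adj (t%:C *: M) = t%:C *: adj M.
Proof. by apply/matrixP => i j; rewrite !mxE conjcM conjc_real. Qed.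

Lemma adj_row_mx p n r (M : 'M[R[i]]_(p, n)) (N : 'M[R[i]]_(p, r)) :
  adj (row_mx M N) = col_mx (adj M) (adj N).
Proof.
apply/matrixP => i j; rewrite !mxE.
by case: (fintype.split i) => k; rewrite mxE.
Qed.

Lemma sqn_adj n (v : 'cV[R[i]]_n) : adj v *m v = (sqn v)%:C%:M.
Proof.
apply/matrixP => i j; rewrite !ord1 !mxE eqxx mulr1n -cdotE.
by apply: eq_bigr => k _; rewrite mxE mulrC.
Qed.

Lemma sqn_adjP n p (v : 'cV[R[i]]_n) (w : 'cV[R[i]]_p) :
  adj v *m v = adj w *m w -> sqn v = sqn w.
Proof. by rewrite !sqn_adj => /matrixP/(_ 0 0); rewrite !mxE eqxx !mulr1n => /complexI. Qed.

Lemma residual_ortho p r (E : 'M[R[i]]_(p, r)) (u : 'cV[R[i]]_p) : adj E *m E = 1%:M ->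
  adj E *m (u - E *m (adj E *m u)) = 0.
Proof. by move=> EE; rewrite mulmxBr [adj E *m (E *m _)]mulmxA EE mul1mx subrr. Qed.

(** Pythagoras' theorem for the projection E E^*, polarized. *)
Lemma residual_gram p r (E : 'M[R[i]]_(p, r)) (u v : 'cV[R[i]]_p) : adj E *m E = 1%:M ->
  adj (v - E *m (adj E *m v)) *m (u - E *m (adj E *m u)) =
  adj v *m u - adj (adj E *m v) *m (adj E *m u).
Proof.
move=> EE; rewrite adjB [adj (E *m _)]adj_mul mulmxBl -[_ *m adj E *m _]mulmxA.
rewrite (residual_ortho u EE) mulmx0 subr0 mulmxBr [adj (adj E *m v)]adj_mul adjK.
by rewrite [adj v *m (E *m _)]mulmxA.
Qed.

Lemma isometry_sqn p r (E : 'M[R[i]]_(p, r)) u : adj E *m E = 1%:M -> sqn (E *m u) = sqn u.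
Proof. by move=> EE; apply: sqn_adjP; rewrite adj_mul -mulmxA [adj E *m _]mulmxA EE mul1mx. Qed.

Lemma coisometry_contraction p r (E : 'M[R[i]]_(p, r)) : adj E *m E = 1%:M -> contraction (adj E).
Proof.
move=> EE v; rewrite -subr_ge0.
have := residual_gram v v EE; rewrite !sqn_adj -raddfB => /matrixP/(_ 0 0).
by rewrite !mxE eqxx !mulr1n => /(congr1 (@complex.Re R)) /= <-; exact: sqn_ge0.
Qed.

(** Take orthonormal systems E and E' of the same maximal size r that see the two
    families in the same way. If some vector had a component outside the range of
    E, both systems could be enlarged; hence the families are E c and E' c for the
    same coordinates c, and V = E' E^* is a partial isometry between them. *)
Lemma lurking_isometry (X : Type) p q (xi : X -> 'cV[R[i]]_p) (eta : X -> 'cV[R[i]]_q) :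
  (forall x y, adj (xi y) *m xi x = adj (eta y) *m eta x) ->
  exists2 V : 'M[R[i]]_(q, p), contraction V & forall x, V *m xi x = eta x.
Proof.
move=> gram.
pose good r := exists (E : 'M[R[i]]_(p, r)) (E' : 'M[R[i]]_(q, r)),
  [/\ adj E *m E = 1%:M, adj E' *m E' = 1%:M & forall x, adj E *m xi x = adj E' *m eta x].
have good0 : exists r, `[< good r >].
  exists 0%N; apply/asboolP; exists 0, 0.
  by split=> [||x]; apply/matrixP => -[].
have good_le r : `[< good r >] -> (r <= p)%N.
  by case/asboolP => E [E' [EE _ _]]; exact: mulmx1_min EE.
case: (ex_maxnP good0 good_le) => r /asboolP[E [E' [EE EE' xe]]] rmax.
have gramE x y : adj (xi y - E *m (adj E *m xi y)) *m (xi x - E *m (adj E *m xi x)) =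
   adj (eta y - E' *m (adj E' *m eta y)) *m (eta x - E' *m (adj E' *m eta x)).
  by rewrite (residual_gram _ _ EE) (residual_gram _ _ EE') (gram x y) (xe x) (xe y).
have res0 x : xi x - E *m (adj E *m xi x) = 0.
  apply: sqn_eq0; apply/eqP/negP => /negP s_neq0.
  set s := sqn _ in s_neq0; have spos : 0 < s by rewrite lt0r s_neq0 sqn_ge0.
  suff /rmax : `[< good (r + 1)%N >] by rewrite addn1 ltnn.
  apply/asboolP; pose t := (Num.sqrt s)^-1.
  exists (row_mx E (t%:C *: (xi x - E *m (adj E *m xi x)))),
    (row_mx E' (t%:C *: (eta x - E' *m (adj E' *m eta x)))).
  have ext m (G : 'M[R[i]]_(m, r)) (u : 'cV[R[i]]_m) : adj G *m G = 1%:M ->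
      sqn (u - G *m (adj G *m u)) = s ->
      adj (row_mx G (t%:C *: (u - G *m (adj G *m u)))) *m
        row_mx G (t%:C *: (u - G *m (adj G *m u))) = 1%:M.
    move=> GG us; rewrite adj_row_mx mul_col_row GG [1%:M in RHS]scalar_mx_block.
    have h := residual_ortho u GG.
    rewrite -scalemxAr h scaler0; congr block_mx.
      by rewrite -[LHS]adjK adj_mul adjK -scalemxAr h scaler0; apply/matrixP => i j; rewrite !mxE conjc0.
    rewrite adjZ -scalemxAl -scalemxAr scalerA sqn_adj us scale_scalar_mx.
    congr (_%:M); rewrite -!real_complexM /t -expr2 exprVn sqr_sqrtr ?(ltW spos) //.
    by rewrite mulVf.
  split; [exact: ext| |].
    by apply: ext => //; apply: sqn_adjP; rewrite gramE.
  move=> y; rewrite !adj_row_mx !mul_col_mx xe; congr col_mx.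
  have resid m (G : 'M[R[i]]_(m, r)) (u v : 'cV[R[i]]_m) : adj G *m G = 1%:M ->
      adj (u - G *m (adj G *m u)) *m v = adj u *m v - adj (adj G *m u) *m (adj G *m v).
    by move=> GG; rewrite adjB mulmxBl [adj (G *m _)]adj_mul mulmxA.
  rewrite !adjZ -!scalemxAl; congr (_ *: _).
  by rewrite (resid _ _ _ _ EE) (resid _ _ _ _ EE') (gram y x) (xe x) (xe y).
exists (E' *m adj E).
  move=> v; rewrite -mulmxA isometry_sqn //.
  exact: coisometry_contraction.
move=> x; rewrite -mulmxA xe; apply/esym/eqP; rewrite -subr_eq0; apply/eqP.
apply: sqn_eq0; rewrite -[RHS](@sqn0 _ p) -(res0 x).
by apply/esym/sqn_adjP; rewrite gramE.
Qed.

End LurkingIsometry.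
(** * Products of scalar and diagonal contractions *)

Section FunctionMatrices.
Variables (R : realType) (X : Type).

Definition mxat (x : X) p n (M : 'M[X -> R[i]]_(p, n)) : 'M[R[i]]_(p, n) :=
  map_mx (fun f : X -> R[i] => f x) M.

Lemma mxat_inj p n (M N : 'M[X -> R[i]]_(p, n)) : (forall x, mxat x M = mxat x N) -> M = N.
Proof.
by move=> h; apply/matrixP => i j; apply/funext => x; have /matrixP/(_ i j) := h x; rewrite !mxE.
Qed.

Lemma mxat_mul x p n r (M : 'M[X -> R[i]]_(p, n)) (N : 'M[X -> R[i]]_(n, r)) :
  mxat x (M *m N) = mxat x M *m mxat x N.
Proof.
apply/matrixP => i j; rewrite !mxE fct_sumE; apply: eq_bigr => k _.
by rewrite !mxE.
Qed.

Lemma mxat_diag x n (d : 'rV[X -> R[i]]_n) : mxat x (diag_mx d) = diag_mx (mxat x d).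
Proof.
by apply/matrixP => i j; rewrite !mxE; case: eqVneq => // _; rewrite ?mulr1n ?mulr0n.
Qed.

Lemma mxat_cst x p n (M : 'M[R[i]]_(p, n)) : mxat x (map_mx cst M) = M.
Proof. by apply/matrixP => i j; rewrite !mxE. Qed.

End FunctionMatrices.

Section Subalgebras.
Variables (R : realType) (X : topologicalType) (A : set (X -> R[i])).
Hypothesis Aalg : unital_subalgebra A.

Lemma subalgebra0 : A 0.
Proof. by have := subalgebraZ Aalg 0 (subalgebra1 Aalg); rewrite scale0r. Qed.

Lemma subalgebraN f : A f -> A (- f).
Proof. by move=> Af; rewrite -scaleN1r; exact: (subalgebraZ Aalg). Qed.

Lemma subalgebra_cst c : A (cst c).
Proof.
have := subalgebraZ Aalg c (subalgebra1 Aalg).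
by congr A; apply/funext => x; exact: mulr1.
Qed.

End Subalgebras.

Section Factorization.
Variables (R : realType) (X : topologicalType) (A : set (X -> R[i])).
Hypothesis Aalg : unital_subalgebra A.

Definition contractive_entries n (d : 'rV[X -> R[i]]_n) :=
  forall j, A (d 0 j) /\ forall x, csq (d 0 j x) <= 1.

(** Nonstrict and in any order, so that the successive steps of a construction can
    simply be multiplied. *)
Inductive factorable : forall p n, 'M[X -> R[i]]_(p, n) -> Prop :=
| factorable_scalar p n (M : 'M[R[i]]_(p, n)) :
    contraction M -> factorable (map_mx cst M)
| factorable_diag n (d : 'rV[X -> R[i]]_n) :
    contractive_entries d -> factorable (diag_mx d)
| factorable_mul p n r (M : 'M[X -> R[i]]_(p, n)) (N : 'M[X -> R[i]]_(n, r)) :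
    factorable M -> factorable N -> factorable (M *m N).

Definition strict_entries n (d : 'rV[X -> R[i]]_n) :=
  forall j, A (d 0 j) /\ supnorm (d 0 j) < 1.

(** The products of the theorem, grown at their left end. *)
Inductive strictly_factorable : forall p n, 'M[X -> R[i]]_(p, n) -> Prop :=
| strict_scalar p n (M : 'M[R[i]]_(p, n)) :
    mxopnorm M < 1 -> strictly_factorable (map_mx cst M)
| strict_cons p n r (M : 'M[R[i]]_(p, n)) (d : 'rV[X -> R[i]]_n) (N : 'M[X -> R[i]]_(n, r)) :
    mxopnorm M < 1 -> strict_entries d -> strictly_factorable N ->
    strictly_factorable (map_mx cst M *m diag_mx d *m N).

Lemma map_cst_mul p n r (M : 'M[R[i]]_(p, n)) (N : 'M[R[i]]_(n, r)) :
  map_mx (cst : R[i] -> X -> R[i]) (M *m N) = map_mx cst M *m map_mx cst N.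
Proof. by apply: mxat_inj => x; rewrite mxat_mul !mxat_cst. Qed.

Lemma mxopnorm_mul_lt1 p n r (M : 'M[R[i]]_(p, n)) (N : 'M[R[i]]_(n, r)) :
  mxopnorm M < 1 -> mxopnorm N < 1 -> mxopnorm (M *m N) < 1.
Proof.
move=> M1 N1; apply: le_lt_trans M1; apply: mxopnorm_le => [|v]; first exact: mxopnorm_ge0.
rewrite -mulmxA; apply: le_trans (sqn_mulmx_mxopnorm _ _) _.
by rewrite ler_wpM2l ?sqr_ge0 //; apply: contraction_mxopnorm; exact: ltW.
Qed.

Lemma strictly_factorable_mul p n r (M : 'M[X -> R[i]]_(p, n)) (N : 'M[X -> R[i]]_(n, r)) :
  strictly_factorable M -> strictly_factorable N -> strictly_factorable (M *m N).
Proof.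
move=> hM; elim: hM r N => {p n M} [p n M M1|p n s M d M' M1 d1 _ IH] r N hN.
  case: hN M M1 => {n r N} [n r N N1|n s r N d N' N1 d1 hN'] M M1.
    by rewrite -map_cst_mul; apply/strict_scalar/mxopnorm_mul_lt1.
  by rewrite !mulmxA -map_cst_mul; apply: strict_cons => //; exact: mxopnorm_mul_lt1.
by rewrite -mulmxA; apply: strict_cons => //; exact: IH.
Qed.

Definition mxscale t p n (M : 'M[X -> R[i]]_(p, n)) := map_mx (fun f : X -> R[i] => t%:C *: f) M.

Lemma mxat_scale x t p n (M : 'M[X -> R[i]]_(p, n)) : mxat x (mxscale t M) = t%:C *: mxat x M.
Proof. by apply/matrixP => i j; rewrite !mxE. Qed.

Lemma mxopnorm_scale_lt1 (t : R) p n (M : 'M[R[i]]_(p, n)) :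
  0 <= t < 1 -> contraction M -> mxopnorm (t%:C *: M) < 1.
Proof.
move=> /andP[t0 t1] hM; apply: le_lt_trans t1; apply: mxopnorm_le => // v.
by rewrite -scalemxAl sqnZ csq_real ler_wpM2l ?sqr_ge0.
Qed.

Lemma contraction1 n : contraction (1%:M : 'M[R[i]]_n).
Proof. by move=> v; rewrite mul1mx. Qed.

Lemma supnorm_le (f : X -> R[i]) (k : R) : 0 <= k ->
  (forall x, csq (f x) <= k ^+ 2) -> supnorm f <= k.
Proof.
move=> k0 h; rewrite /supnorm; set E := [set _ | _ in _].
have [[E0 _]|/sup_out -> //] := pselect (has_sup E).
apply: ge_sup => // _ [x _ <-].
by rewrite -(@ler_pXn2r _ 2) ?nnegrE ?rnorm_ge0 // rnorm_sqr.
Qed.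

(** Shrinking by any t < 1 leaves room to make every factor strict: each
    multiplication gives away half of the gap between t and 1, and a diagonal
    factor passes part of its own to multiples of the identity on its two sides. *)
Lemma factorable_strict p n (M : 'M[X -> R[i]]_(p, n)) (t : R) :
  factorable M -> 0 < t < 1 -> strictly_factorable (mxscale t M).
Proof.
move=> hM; elim: hM t => {p n M} [p n M hM|n d hd|p n r M N _ IHM _ IHN] t /andP[t0 t1].
- have -> : mxscale t (map_mx cst M) = map_mx cst (t%:C *: M).
    by apply: mxat_inj => x; rewrite mxat_scale !mxat_cst.
  by apply: strict_scalar; apply: mxopnorm_scale_lt1; rewrite // (ltW t0).
- pose s := (1 + t) / 2.
  have s0 : 0 < s by rewrite /s; lra.
  have s1 : s < 1 by rewrite /s; lra.
  have ts : t < s ^+ 2.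
    by have : 0 < (1 - t) ^+ 2 by [rewrite exprn_gt0 // subr_gt0]; rewrite /s; nra.
  pose e := mxscale (t / s ^+ 2) d.
  have -> : mxscale t (diag_mx d) = map_mx cst (s%:C *: 1%:M) *m diag_mx e *m
     map_mx cst (s%:C *: 1%:M).
    apply: mxat_inj => x; rewrite mxat_scale !mxat_mul !mxat_cst !mxat_diag mxat_scale.
    rewrite -scalemxAr mulmx1 -scalemxAl mul1mx scalerA.
    apply/matrixP => i j; rewrite !mxE; case: eqVneq => _; last by rewrite !mulr0n !mulr0.
    rewrite !mulr1n mulrA -!real_complexM; congr (_%:C * _).
    by field; rewrite gt_eqF.
  have hs : mxopnorm (s%:C *: (1%:M : 'M[R[i]]_n)) < 1.
    by apply: mxopnorm_scale_lt1; rewrite ?(ltW s0) //; exact: contraction1.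
  apply: strict_cons => // [j|]; last exact: strict_scalar.
  rewrite !mxE; have [dA d1] := hd j; split; first exact: (subalgebraZ Aalg).
  have q1 : t / s ^+ 2 < 1 by rewrite ltr_pdivrMr ?exprn_gt0 // mul1r.
  apply: le_lt_trans q1; apply: supnorm_le => [|x]; first by rewrite divr_ge0 ?sqr_ge0 ?ltW.
  by rewrite /= csqM csq_real ler_piMr ?sqr_ge0.
- pose s := (1 + t) / 2.
  have s0 : 0 < s by rewrite /s; lra.
  have s1 : s < 1 by rewrite /s; lra.
  have ts : t < s by rewrite /s; lra.
  have -> : mxscale t (M *m N) = mxscale s M *m mxscale (t / s) N.
    apply: mxat_inj => x; rewrite mxat_scale !mxat_mul !mxat_scale.
    rewrite -scalemxAl -scalemxAr scalerA -real_complexM; congr (_%:C *: _).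
    by field; rewrite gt_eqF.
  apply: strictly_factorable_mul; first by apply: IHM; rewrite s0.
  by apply: IHN; rewrite divr_gt0 //= ltr_pdivrMr // mul1r.
Qed.


(** A new first factor shifts the indices of all others by one; as the shifted
    families are defined by cases on the index, their sizes agree by computation
    and no transport is needed. *)
Lemma strictly_factorable_alternating p n (M : 'M[X -> R[i]]_(p, n)) :
  strictly_factorable M ->
  exists (m : nat) (k : nat -> nat) (k0 : k 0%N = p) (km : k m.+1 = n)
      (C : forall i, 'M[R[i]]_(k i, k i.+1)) (D : forall i, 'rV[X -> R[i]]_(k i)),
    [/\ forall i, (i <= m)%N -> mxopnorm (C i) < 1,
        forall i, (1 <= i <= m)%N -> forall j, A (D i 0 j) /\ supnorm (D i 0 j) < 1
      & M = castmx (k0, km) (alternating_product C D m)].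
Proof.
elim=> {p n M} [p n M M1|p n r M d N M1 d1 _ [m [k [k0 [km [C [D [C1 D1 NE]]]]]]]].
  pose k i := if i is 0%N then p else n.
  exists 0%N, k, erefl, erefl.
  exists (fun i => match i return 'M[R[i]]_(k i, k i.+1) with 0%N => M | _ => 0 end).
  exists (fun=> 0); split=> [[]//|[]//|].
  by rewrite castmx_id.
case: _ / k0 M d N M1 d1 NE => M d N M1 d1 NE.
case: _ / km N NE => N NE; rewrite castmx_id in NE.
pose k' i := if i is i'.+1 then k i' else p.
pose C' i : 'M[R[i]]_(k' i, k' i.+1) :=
  match i return 'M[R[i]]_(k' i, k' i.+1) with 0%N => M | i'.+1 => C i' end.
pose D' i : 'rV[X -> R[i]]_(k' i) := match i return 'rV[X -> R[i]]_(k' i) with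
  | 0%N => 0
  | i'.+1 => match i' return 'rV[X -> R[i]]_(k i') with 0%N => d | j.+1 => D j.+1 end
  end.
exists m.+1, k', erefl, erefl, C', D'; split.
- by case=> [|i] //=; exact: C1.
- case=> [//|[_ j|i ile j]]; first exact: d1.
  exact: D1.
rewrite castmx_id NE.
elim: m {N NE C1 D1} => [//|m IH].
change (map_mx cst M *m diag_mx d *m
    (alternating_product C D m *m diag_mx (D m.+1) *m map_mx cst (C m.+1)) =
  alternating_product C' D' m.+1 *m diag_mx (D m.+1) *m map_mx cst (C m.+1)).
by rewrite -IH !mulmxA.
Qed.

End Factorization.
(** * Transfer function realizations are products *)

Section Realization.
Variable R : realType.

Lemma sqn_mix_le n (a b : R) (s y : 'cV[R[i]]_n) : a ^+ 2 + b ^+ 2 = 1 ->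
  sqn (a%:C *: s + b%:C *: y) <= sqn s + sqn y.
Proof.
move=> ab1; rewrite /sqn -big_split; apply: ler_sum => j _; rewrite !mxE /=.
case: (s j 0) (y j 0) => u v [u' v']; rewrite /csq /= !mul0r !subr0 !addr0.
have := sqr_ge0 (b * u - a * u'); have := sqr_ge0 (b * v - a * v').
have -> : u ^+ 2 + v ^+ 2 + (u' ^+ 2 + v' ^+ 2) =
  (a ^+ 2 + b ^+ 2) * (u ^+ 2 + v ^+ 2 + (u' ^+ 2 + v' ^+ 2)) by rewrite ab1 mul1r.
by lra.
Qed.

(** One step of the system with transfer matrix V. The input carries an
    accumulated output s, the components h of the state after multiplication by
    the diagonal of the realization, and a reservoir w; a fraction c of the
    reservoir is fed to V, whose output is accumulated into s. *)
Definition stepmx p n (V : 'M[R[i]]_(p + n, 1 + n)) (a b c d : R) : 'M[R[i]]_(p + n + 1) :=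
  block_mx
    (block_mx a%:C%:M (b%:C *: ursubmx V) 0 (drsubmx V))
    (col_mx ((b * c)%:C *: ulsubmx V) (c%:C *: dlsubmx V)) 0 d%:C%:M.

Lemma stepmxE p n (V : 'M[R[i]]_(p + n, 1 + n)) (a b c d : R) (s y : 'cV[R[i]]_p)
    (h v' : 'cV[R[i]]_n) (w : 'cV[R[i]]_1) :
  V *m col_mx (c%:C *: w) h = col_mx y v' ->
  stepmx V a b c d *m col_mx (col_mx s h) w =
  col_mx (col_mx (a%:C *: s + b%:C *: y) v') (d%:C *: w).
Proof.
rewrite -{1}[V]submxK mul_block_col => /eq_col_mx[<- <-].
rewrite /stepmx mul_block_col mul_block_col mul0mx add0r mul_scalar_mx mul_col_mx add_col_mx.
rewrite !mul_scalar_mx mul0mx add0r -!scalemxAl -!scalemxAr scalerDr scalerA -real_complexM.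
by rewrite -addrA [_ *: _ + (b * c)%:C *: _]addrC [drsubmx V *m h + _]addrC.
Qed.

Lemma stepmx_contraction p n (V : 'M[R[i]]_(p + n, 1 + n)) (a b c d : R) :
  a ^+ 2 + b ^+ 2 = 1 -> c ^+ 2 + d ^+ 2 = 1 -> contraction V ->
  contraction (stepmx V a b c d).
Proof.
move=> ab cd hV v; rewrite -[v]vsubmxK -[usubmx v]vsubmxK.
move: (usubmx _) (dsubmx (usubmx v)) (dsubmx v) => s h w.
have := hV (col_mx (c%:C *: w) h).
rewrite -[V *m _]vsubmxK; move: (usubmx _) (dsubmx _) (esym (vsubmxK (V *m col_mx (c%:C *: w) h))).
move=> y v' e; rewrite (stepmxE _ _ _ _ e) !sqn_col_mx !sqnZ !csq_real => hyv.
have := sqn_mix_le s y ab.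
have : c ^+ 2 * sqn w + d ^+ 2 * sqn w = sqn w by rewrite -mulrDl cd mul1r.
by lra.
Qed.

Variables (X : topologicalType) (A : set (X -> R[i])).
Hypothesis Aalg : unital_subalgebra A.

(** A transfer function realization [F; b] = V [1; g b] exhibits F as a product
    of contractions, up to an arbitrarily small loss: run the system N times
    from the stationary state b, feeding it each time 1/N of the square of an
    input of size sqrt N and accumulating the outputs. As the state is
    stationary, the accumulated output is exactly sqrt N F, while b contributes
    only n K^2 to the square of the size N + n K^2 of the initial data. *)
Lemma realization_factorable p n (V : 'M[R[i]]_(p + n, 1 + n))
    (F : 'cV[X -> R[i]]_p) (b : 'cV[X -> R[i]]_n) (g : 'rV[X -> R[i]]_n) (K t : R) :
  contraction V -> contractive_entries A g -> (forall j, A (b j 0)) ->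
  0 < K -> (forall j x, csq (b j 0 x) <= K ^+ 2) ->
  (forall x, V *m col_mx 1%:M (diag_mx (mxat x g) *m mxat x b) =
    col_mx (mxat x F) (mxat x b)) ->
  0 < t < 1 -> factorable A (mxscale t F).
Proof.
move=> hV hg bA K0 bK VE /andP[t0 t1].
pose Z (u w : R) : 'cV[X -> R[i]]_(p + n + 1) :=
  col_mx (col_mx (mxscale u F) b) (const_mx (cst w%:C)).
have ZE u w x : mxat x (Z u w) = col_mx (col_mx (u%:C *: mxat x F) (mxat x b)) (w%:C%:M).
  rewrite /Z /mxat !map_col_mx -/(mxat x _) mxat_scale; congr (col_mx _ _).
  by apply/matrixP => i j; rewrite !ord1 !mxE eqxx mulr1n.
pose G : 'rV[X -> R[i]]_(p + n + 1) := row_mx (row_mx (const_mx 1) g) (const_mx 1).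
have oneE (x : X) : csq ((1 : X -> R[i]) x) <= 1 by rewrite csq1.
have GA : contractive_entries A G.
  move=> j; rewrite /G; case: (split_ordP j) => i ->.
    rewrite row_mxEl; case: (split_ordP i) => k ->; first rewrite row_mxEl mxE.
      by split; [exact: (subalgebra1 Aalg)|].
    by rewrite row_mxEr; exact: hg.
  by rewrite row_mxEr mxE; split; [exact: (subalgebra1 Aalg)|].
have GE x s h w : diag_mx (mxat x G) *m col_mx (col_mx s h) w =
    col_mx (col_mx s (diag_mx (mxat x g) *m h)) w.
  have one m : map_mx (fun f : X -> R[i] => f x) (const_mx 1 : 'rV_m) = const_mx 1.
    by apply/matrixP => i j; rewrite !mxE.
  rewrite /G /mxat !map_row_mx !one !diag_mx_row !mul_block_col !mul0mx !addr0 !add0r.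
  by rewrite !diag_const_mx !mul1mx.
have t2 : 0 < t^-1 ^+ 2 - 1 by rewrite subr_gt0 expr_gt1 ?invr_ge0 ?(ltW t0) // invf_gt1.
(* chosen so that t^2 (N + n K^2) <= N *)
pose N := Num.bound (n%:R * K ^+ 2 / (t^-1 ^+ 2 - 1)).
have NE : n%:R * K ^+ 2 < N%:R * (t^-1 ^+ 2 - 1).
  rewrite -ltr_pdivrMr //; apply: archi_boundP.
  by rewrite divr_ge0 ?mulr_ge0 ?ler0n ?sqr_ge0 // ltW.
have N0 : 0 < N%:R :> R.
  rewrite -(pmulr_lgt0 _ t2); apply: le_lt_trans NE.
  by rewrite mulr_ge0 ?ler0n ?sqr_ge0.
have step j : (j <= N)%N -> exists2 M : 'M[X -> R[i]]_(p + n + 1), factorable A M &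
    M *m Z 0 (Num.sqrt N%:R) = Z (Num.sqrt j%:R) (Num.sqrt (N - j)%:R).
  elim: j => [_|j IH jN].
    exists (map_mx cst 1%:M); first exact/factorable_scalar/contraction1.
    rewrite subn0 (_ : Num.sqrt 0%:R = 0 :> R); last exact: sqrtr0.
    by apply: mxat_inj => x; rewrite mxat_mul mxat_cst mul1mx.
  have [M hM ME] := IH (ltnW jN).
  have Nj : (0 < N - j)%N by rewrite subn_gt0.
  set u : R := Num.sqrt j%:R; set u' : R := Num.sqrt j.+1%:R.
  set w : R := Num.sqrt (N - j)%:R; set w' : R := Num.sqrt (N - j.+1)%:R.
  have u0 : 0 < u' by rewrite sqrtr_gt0 ltr0n.
  have w0 : 0 < w by rewrite sqrtr_gt0 ltr0n.
  have uE : u ^+ 2 + 1 = u' ^+ 2 by rewrite !sqr_sqrtr ?ler0n // -natr1.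
  have wE : 1 + w' ^+ 2 = w ^+ 2.
    by rewrite !sqr_sqrtr ?ler0n // -{1}[1]/(1%:R) -natrD add1n -subSn // subSS.
  pose a := u / u'; pose c := u'^-1; pose e := w^-1; pose d := w' / w.
  have ac : a ^+ 2 + c ^+ 2 = 1.
    rewrite /a /c expr_div_n exprVn -{2}[u' ^- 2]mul1r -mulrDl uE divff //.
    by rewrite expf_neq0 // gt_eqF.
  have ed : e ^+ 2 + d ^+ 2 = 1.
    rewrite /e /d expr_div_n exprVn -{1}[w ^- 2]mul1r -mulrDl wE divff //.
    by rewrite expf_neq0 // gt_eqF.
  exists (map_mx cst (stepmx V a c e d) *m (diag_mx G *m M)).
    apply: factorable_mul; first exact/factorable_scalar/stepmx_contraction.
    exact: factorable_mul (factorable_diag GA) hM.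
  rewrite -!mulmxA ME; apply: mxat_inj => x.
  rewrite !mxat_mul mxat_cst mxat_diag !ZE GE (@stepmxE _ _ _ _ _ _ _ _ (mxat x F) _ (mxat x b)).
    congr (col_mx (col_mx _ _) _).
      rewrite scalerA -scalerDl -real_complexM -real_complexD; congr (_%:C *: _).
      have -> : a * u + c = (u ^+ 2 + 1) / u' by rewrite /a /c; field; rewrite gt_eqF.
      by rewrite uE expr2 mulfK // gt_eqF.
    rewrite scale_scalar_mx -real_complexM; congr (_%:C%:M).
    by rewrite /d divfK // gt_eqF.
  rewrite scale_scalar_mx -real_complexM /e mulVf ?gt_eqF //; exact: VE.
have [M hM ME] := step N (leqnn N); rewrite subnn sqrtr0 in ME.
(* reading off the accumulated output *)
pose P : 'M[R[i]]_(p, p + n + 1) := row_mx (row_mx 1%:M 0) 0.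
have PE s h w : P *m col_mx (col_mx s h) w = s.
  by rewrite !mul_row_col mul1mx !mul0mx !addr0.
have hP : contraction P.
  move=> v; rewrite -[v]vsubmxK -[usubmx v]vsubmxK PE !sqn_col_mx -addrA lerDl.
  by rewrite addr_ge0 ?sqn_ge0.
pose q : R := Num.sqrt N%:R.
have q0 : 0 < q by rewrite sqrtr_gt0.
(* a scalar column times diag (1, b / K, 1) is t / q times the initial data *)
pose c0 : 'cV[R[i]]_(p + n + 1) :=
  col_mx (col_mx 0 (const_mx (t * K / q)%:C)) (const_mx t%:C).
have sqn_const m (r : R) : sqn (const_mx r%:C : 'cV_m) = m%:R * r ^+ 2.
  rewrite /sqn (eq_bigr (fun=> r ^+ 2)) => [|j _]; last by rewrite mxE csq_real.
  by rewrite big_const_ord iter_addr addr0 mulr_natl.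
have hc0 : contraction c0.
  have c01 : sqn c0 <= 1.
    rewrite !sqn_col_mx sqn0 add0r !sqn_const mul1r !exprMn exprVn sqr_sqrtr ?ler0n //.
    have -> : n%:R * (t ^+ 2 * K ^+ 2 / N%:R) + t ^+ 2 =
        t ^+ 2 * (n%:R * K ^+ 2 + N%:R) / N%:R by field; rewrite gt_eqF.
    rewrite ler_pdivrMr // mul1r -ler_pdivlMl ?exprn_gt0 // -exprVn.
    by lra.
  move=> v; have -> : c0 *m v = v 0 0 *: c0.
    by apply/colP => j; rewrite [LHS]mxE big_ord1 [RHS]mxE mulrC.
  by rewrite sqnZ sqn1 ler_piMr ?csq_ge0.
pose E : 'rV[X -> R[i]]_(p + n + 1) :=
  row_mx (row_mx (const_mx 1) (\row_j (K^-1%:C *: b j 0))) (const_mx 1).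
have EA : contractive_entries A E.
  move=> j; rewrite /E; case: (split_ordP j) => i ->.
    rewrite row_mxEl; case: (split_ordP i) => k ->; first rewrite row_mxEl mxE.
      by split; [exact: (subalgebra1 Aalg)|].
    rewrite row_mxEr mxE; split; first exact: (subalgebraZ Aalg).
    move=> x /=; rewrite csqM csq_real exprVn mulrC ler_pdivrMr ?exprn_gt0 //.
    by rewrite mul1r.
  by rewrite row_mxEr mxE; split; [exact: (subalgebra1 Aalg)|].
have -> : mxscale t F = map_mx cst P *m (M *m (diag_mx E *m map_mx cst c0)).
  have -> : diag_mx E *m map_mx cst c0 = mxscale (t / q) (Z 0 q).
    apply: mxat_inj => x; rewrite mxat_scale ZE mxat_mul mxat_cst mxat_diag.
    have one m : map_mx (fun f : X -> R[i] => f x) (const_mx 1 : 'rV_m) = const_mx 1.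
      by apply/matrixP => i j; rewrite !mxE.
    rewrite /E /mxat !map_row_mx !one !diag_mx_row !mul_block_col !mul0mx !addr0 !add0r.
    rewrite !diag_const_mx !mul1mx !scale_col_mx !scale0r scaler0; congr (col_mx (col_mx _ _) _).
      apply/colP => j; rewrite mul_diag_mx !mxE /= mulrAC -real_complexM.
      by congr (_%:C * _); field; rewrite !gt_eqF.
    apply/colP => j; rewrite ord1 !mxE eqxx mulr1n -real_complexM.
    by congr (_%:C); rewrite divfK // gt_eqF.
  have -> : M *m mxscale (t / q) (Z 0 q) = mxscale (t / q) (M *m Z 0 q).
    apply: mxat_inj => x; rewrite (mxat_mul x M (mxscale _ _)) [RHS]mxat_scale.
    by rewrite (mxat_mul x M (Z 0 q)) mxat_scale -scalemxAr.
  rewrite ME; apply: mxat_inj => x.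
  rewrite mxat_mul mxat_cst !mxat_scale ZE -scalemxAr PE scalerA -real_complexM.
  by congr (_%:C *: _); rewrite divfK // gt_eqF.
apply: factorable_mul; first exact: factorable_scalar.
apply: factorable_mul => //.
apply: factorable_mul; first exact: factorable_diag.
exact: factorable_scalar.
Qed.
End Realization.
(** * States of convex cones *)

Section StatesOfCones.
Variables (R : realType) (V : lmodType R[i]).
Implicit Types (u v w : V) (K C : set V).

Record cone C : Prop := Cone {
  coneD : forall u v, C u -> C v -> C (u + v);
  coneZ : forall t u, 0 <= t -> C u -> C (t%:C *: u) }.

Definition order_bounded C e w := exists M : R, C (M%:C *: e - w) /\ C (M%:C *: e + w).

Lemma order_boundedD K e u v : cone K ->
  order_bounded K e u -> order_bounded K e v -> order_bounded K e (u + v).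
Proof.
move=> Kcone [M [h1 h2]] [N [h3 h4]]; exists (M + N).
rewrite real_complexD scalerDl opprD.
by rewrite addrACA [X in _ /\ K X]addrACA; split; apply: (coneD Kcone).
Qed.

Lemma order_boundedN K e u : order_bounded K e u -> order_bounded K e (- u).
Proof. by move=> [M [h1 h2]]; exists M; rewrite opprK. Qed.

Section State.
Variables (K : set V) (e : V).
Hypotheses (Kcone : cone K) (Ke : K e) (KNe : ~ K (- e)).

(* maximality is applied to the union with K, as the empty chain has to be
   admitted *)
Lemma maximal_cone : exists2 P : set V, K `<=` P &
  [/\ cone P, ~ P (- e) & forall w, P w \/ P (- w)].
Proof.
pose adm C := cone (C `|` K) /\ ~ (C `|` K) (- e).
have [F FP Ftot|A [[Acone ANe] Amax]] := @Zorn_bigcup V adm.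
  split; last by case=> // -[C FC CNe]; have [_] := FP _ FC; apply; left.
  split=> [u v|t u t0].
    case=> [[C FC Cu]|Ku] [[D FD Dv]|Kv]; last by right; exact: (coneD Kcone).
    - have [CD|DC] := Ftot _ _ FC FD.
        have [] := coneD (FP _ FD).1 (or_introl (CD _ Cu)) (or_introl Dv); last by right.
        by left; exists D.
      have [] := coneD (FP _ FC).1 (or_introl Cu) (or_introl (DC _ Dv)); last by right.
      by left; exists C.
    - have [] := coneD (FP _ FC).1 (or_introl Cu) (or_intror Kv); last by right.
      by left; exists C.
    - have [] := coneD (FP _ FD).1 (or_intror Ku) (or_introl Dv); last by right.
      by left; exists D.
  case=> [[C FC Cu]|Ku]; last by right; exact: (coneZ Kcone).
  have [] := coneZ (FP _ FC).1 t0 (or_introl Cu); last by right.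
  by left; exists C.
set P := A `|` K in Acone ANe.
have P0 : P 0 by rewrite -(scale0r e); apply: (coneZ Acone (lexx 0)); right.
exists P; first by move=> u Ku; right.
split=> // w; have [Pw|nPw] := pselect (P w); [by left|right].
pose C : set V := [set v | exists p, exists2 t, 0 <= t & P p /\ v = p + t%:C *: w].
have PC : P `<=` C by move=> p Pp; exists p, 0 => //; rewrite scale0r addr0.
have CK : C `|` K = C.
  by apply/seteqP; split=> [v [//|Kv]|v Cv]; [apply: PC; right|left].
have : ~ adm C.
  apply: Amax; split=> [v Av|CA]; first by apply: PC; left.
  by apply: nPw; left; apply: CA; exists 0, 1 => //; rewrite scale1r add0r.
rewrite /adm CK => nadm.
have CNe : C (- e).
  apply: contrapT => nCNe; apply: nadm; split=> //; split.
    move=> _ _ [p [t t0 [Pp ->]]] [p' [t' t'0 [Pp' ->]]].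
    exists (p + p'), (t + t'); first exact: addr_ge0.
    by split; [exact: (coneD Acone)|rewrite real_complexD scalerDl addrACA].
  move=> s _ s0 [p [t t0 [Pp ->]]]; exists (s%:C *: p), (s * t); first exact: mulr_ge0.
  by split; [exact: (coneZ Acone)|rewrite real_complexM scalerDr scalerA].
have [p [t t0 [Pp eE]]] := CNe.
have [t_eq0|t_neq0] := eqVneq t 0.
  by exfalso; apply: ANe; rewrite eE t_eq0 scale0r addr0.
have -> : - w = t^-1%:C *: (p + e).
  have -> : p + e = - (t%:C *: w) by rewrite -[e]opprK eE opprD addrA subrr add0r.
  by rewrite scalerN scalerA -real_complexM mulVf // scale1r.
by apply: (coneZ Acone); rewrite ?invr_ge0 //; apply: (coneD Acone) => //; right.
Qed.

(** A maximal cone without - e orders the space totally, and the state reads off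
    the position of a vector along e. It is superlinear and, by totality, odd. *)
Lemma cone_state : exists L : V -> R,
  [/\ forall u v, order_bounded K e u -> order_bounded K e v -> L (u + v) = L u + L v,
      forall t u, 0 <= t -> order_bounded K e u -> L (t%:C *: u) = t * L u,
      forall u, order_bounded K e u -> K u -> 0 <= L u
    & L e = 1].
Proof.
have [P KP [Pcone PNe Ptot]] := maximal_cone.
have Pe := KP _ Ke.
have PtN t : t < 0 -> ~ P (t%:C *: e).
  move=> t0 Pt; apply: PNe.
  have -> : - e = (- t)^-1%:C *: (t%:C *: e).
    by rewrite scalerA -real_complexM invrN mulNr mulVf ?lt_eqF // real_complexN scaleN1r.
  by apply: (coneZ Pcone) => //; rewrite invr_ge0 oppr_ge0 ltW.
pose E w := [set t : R | P (w - t%:C *: e)].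
pose L w := sup (E w).
have Esup w : order_bounded K e w -> has_sup (E w).
  move=> [M [h1 h2]]; split.
    by exists (- M); rewrite /E /= real_complexN scaleNr opprK addrC; exact: KP.
  exists M => t Pt; rewrite leNgt; apply/negP => Mt; apply: (@PtN (M - t)).
    by rewrite subr_lt0.
  have := coneD Pcone (KP _ h1) Pt.
  by rewrite addrA subrK real_complexD real_complexN scalerDl scaleNr.
have bD u v : order_bounded K e u -> order_bounded K e v -> order_bounded K e (u + v).
  exact: order_boundedD.
have bN u : order_bounded K e u -> order_bounded K e (- u) by exact: order_boundedN.
have Lub w t : order_bounded K e w -> P (w - t%:C *: e) -> t <= L w.
  by move=> bw Pt; apply: ub_le_sup => //; exact: (Esup _ bw).2.
have Lle w c : order_bounded K e w -> (forall t, P (w - t%:C *: e) -> t <= c) -> L w <= c.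
  by move=> bw h; apply: ge_sup => //; exact: (Esup _ bw).1.
have superadd u v : order_bounded K e u -> order_bounded K e v -> L u + L v <= L (u + v).
  move=> bu bv; rewrite -lerBrDr; apply: (Lle _ _ bu) => t Pt.
  rewrite lerBrDr -lerBrDl; apply: (Lle _ _ bv) => s Ps; rewrite lerBrDl.
  apply: Lub; first exact: bD.
  by rewrite real_complexD scalerDl opprD addrACA; exact: (coneD Pcone).
have odd u : order_bounded K e u -> - L u <= L (- u).
  move=> bu; rewrite lerNl; apply/ler_addgt0Pr => d d0.
  rewrite lerNl; apply: (Lub); first exact: bN.
  rewrite real_complexN scaleNr opprK addrC.
  have [|] := Ptot (u - (L u + d)%:C *: e); last by rewrite opprB.
  by move/(Lub _ _ bu); rewrite gerDl leNgt d0.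
have addL u v : order_bounded K e u -> order_bounded K e v -> L (u + v) = L u + L v.
  move=> bu bv; apply/eqP; rewrite eq_le superadd // andbT.
  have := superadd _ _ (bD _ _ bu bv) (bN _ bv); rewrite addrK.
  by have := odd _ bv; lra.
have scaleL_ge t u : 0 < t -> order_bounded K e u -> t * L u <= L (t%:C *: u).
  move=> t0 bu; rewrite -ler_pdivlMl //; apply: (Lle _ _ bu) => s Ps.
  rewrite ler_pdivlMl //; apply: Lub.
    have [M [h1 h2]] := bu; exists (t * M).
    rewrite real_complexM -scalerA -scalerBr -scalerDr.
    by split; apply: (coneZ Kcone) => //; exact: ltW.
  by rewrite real_complexM -scalerA -scalerBr; apply: (coneZ Pcone) => //; exact: ltW.
exists L; split=> //.
- move=> t u; rewrite le0r => /orP[/eqP->|t0] bu.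
    have b0 : order_bounded K e 0 by rewrite -(subrr u); exact: bD (bN _ bu).
    have := addL _ _ b0 b0; rewrite addr0 scale0r mul0r; lra.
  have btu : order_bounded K e (t%:C *: u).
    have [M [h1 h2]] := bu; exists (t * M).
    rewrite real_complexM -scalerA -scalerBr -scalerDr.
    by split; apply: (coneZ Kcone) => //; exact: ltW.
  apply/eqP; rewrite eq_le scaleL_ge // andbT.
  have := scaleL_ge t^-1 _ _ btu; rewrite invr_gt0 => /(_ t0).
  by rewrite scalerA -real_complexM mulVf ?gt_eqF // scale1r -ler_pdivlMl ?invr_gt0 // invrK.
- by move=> u bu Ku; apply: Lub => //; rewrite scale0r subr0; exact: KP.
- have be : order_bounded K e e.
    exists 1; rewrite scale1r subrr -(scale0r e); split; first exact: (coneZ Kcone).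
    exact: (coneD Kcone).
  apply/eqP; rewrite eq_le; apply/andP; split.
    apply: (Lle _ _ be) => t; rewrite -{1}[e]scale1r -scalerBl -(rmorphB (real_complex R)) => Pt.
    by rewrite leNgt; apply/negP => t1; apply: PtN Pt; rewrite subr_lt0.
  by apply: (Lub _ _ be); rewrite scale1r subrr -(scale0r e); exact: (coneZ Pcone).
Qed.

End State.
End StatesOfCones.
(** * Continuous functions and subalgebras on a compact space *)

Section ContinuousFunctions.
Variable R : realType.

Lemma complex_lipschitz_continuous (L : R[i] -> R) :
  (forall z w, (L z - L w) ^+ 2 <= csq (z - w)) -> continuous L.
Proof.
move=> hL z; have FF := nbhs_filter z; apply/(@cvgrPdist_lt _ _ _ _ FF) => e e0; apply/nbhs_ballP.
exists e%:C; first by rewrite /= ltcR.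
move=> w; rewrite -ball_normE /=.
rewrite normc_def ltcR -/(csq _) => h.
rewrite -(@ltr_pXn2r _ 2) ?nnegrE ?(ltW e0) // -normrX ger0_norm ?sqr_ge0 //.
apply: le_lt_trans (hL _ _) _.
by rewrite -[csq _]sqr_sqrtr ?csq_ge0 // ltr_pXn2r ?nnegrE ?sqrtr_ge0 ?(ltW e0).
Qed.

Lemma Re_continuous : continuous (@complex.Re R : R[i] -> R).
Proof.
by apply: complex_lipschitz_continuous => z w; rewrite -ReB /csq lerDl sqr_ge0.
Qed.

Lemma Im_continuous : continuous (@complex.Im R : R[i] -> R).
Proof.
apply: complex_lipschitz_continuous => -[a b] [c d].
by rewrite /csq /= lerDr sqr_ge0.
Qed.

Variable X : topologicalType.

Lemma continuous_Re (f : X -> R[i]) : continuous f -> continuous (fun x => complex.Re (f x)).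
Proof. by move=> cf x; apply: continuous_comp; [exact: cf|exact: Re_continuous]. Qed.

Lemma continuous_Im (f : X -> R[i]) : continuous f -> continuous (fun x => complex.Im (f x)).
Proof. by move=> cf x; apply: continuous_comp; [exact: cf|exact: Im_continuous]. Qed.

Lemma continuous_csq (f : X -> R[i]) : continuous f -> continuous (fun x => csq (f x)).
Proof.
by move=> cf x; apply: cvgD; apply: cvgM; first [exact: continuous_Re|exact: continuous_Im].
Qed.

Hypothesis compactX : compact [set: X].

Lemma compact_max (g : X -> R) (x0 : X) : continuous g -> exists c, forall x, g x <= g c.
Proof.
move=> cg; have [|c _ hc] := compact_EVT_max (f := g) (ex_intro _ x0 I) compactX.
  exact: continuous_subspaceT.
by exists c => x; apply: hc; rewrite inE.
Qed.

Lemma compact_ubound (g : X -> R) : continuous g -> exists2 M, 0 < M & forall x, g x <= M.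
Proof.
move=> cg; have [[x0]|noX] := pselect (inhabited X); last first.
  by exists 1 => // x; exfalso; apply: noX.
have [c hc] := compact_max x0 cg; exists (Num.max (g c) 1); first by rewrite lt_max ltr01 orbT.
by move=> x; rewrite le_max hc.
Qed.

Lemma compact_csq_bound (f : X -> R[i]) : continuous f ->
  exists2 M, 0 < M & forall x, csq (f x) <= M ^+ 2.
Proof.
move=> /continuous_csq/compact_ubound[M M0 hM]; exists (Num.sqrt M); first by rewrite sqrtr_gt0.
by move=> x; rewrite sqr_sqrtr // ltW.
Qed.

Lemma supnorm_ge0 (f : X -> R[i]) : 0 <= supnorm f.
Proof.
rewrite /supnorm; set E := [set _ | _ in _].
have [[[y Ey] ub]|/sup_out -> //] := pselect (has_sup E).
case: (Ey) => x _ yE; apply: le_trans (rnorm_ge0 (f x)) _.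
by rewrite yE; apply: ub_le_sup.
Qed.

Lemma csq_le_supnorm (f : X -> R[i]) x : continuous f -> csq (f x) <= supnorm f ^+ 2.
Proof.
move=> cf; rewrite -rnorm_sqr ler_pXn2r ?nnegrE ?rnorm_ge0 ?supnorm_ge0 //.
apply: ub_le_sup; last by exists x.
have [M M0 hM] := compact_csq_bound cf; exists M => _ [y _ <-].
by rewrite -(@ler_pXn2r _ 2) ?nnegrE ?rnorm_ge0 ?(ltW M0) // rnorm_sqr.
Qed.

End ContinuousFunctions.

Section SubalgebraType.
Variables (R : realType) (X : topologicalType) (A : set (X -> R[i])).
Hypothesis Aalg : unital_subalgebra A.

Definition in_algebra of unital_subalgebra A : {pred X -> R[i]} := [pred f | `[< A f >]].

Lemma in_algebra_submod : submod_closed (in_algebra Aalg).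
Proof.
split; first by apply/asboolP; exact: subalgebra0.
move=> c f g /asboolP Af /asboolP Ag; apply/asboolP.
by apply: (subalgebraD Aalg) => //; exact: (subalgebraZ Aalg).
Qed.

HB.instance Definition _ :=
  GRing.isSubmodClosed.Build _ _ (in_algebra Aalg) in_algebra_submod.

Record algebra_of := AlgebraElt { algebra_fun :> X -> R[i]; _ : algebra_fun \in in_algebra Aalg }.

HB.instance Definition _ := [isSub for algebra_fun].
HB.instance Definition _ := [Choice of algebra_of by <:].
HB.instance Definition _ := [SubChoice_isSubLmodule of algebra_of by <:].

Lemma algebra_ofP (a : algebra_of) : A a.
Proof. by case: a => f /= /asboolP. Qed.

Definition alg_mul f (Af : A f) (a : algebra_of) : algebra_of :=
  AlgebraElt (asboolT (subalgebraM Aalg Af (algebra_ofP a))).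

Definition alg_of f (Af : A f) : algebra_of := AlgebraElt (asboolT Af).

End SubalgebraType.
(** * Bounds for representations *)

Section VectorNorms.
Variables (R : realType) (V : normedModType R[i]).
Implicit Types (u v : V).

Lemma rnormZ (t : R) v : 0 <= t -> rnorm (t%:C *: v) = t * rnorm v.
Proof.
by move=> t0; rewrite /rnorm normrZ -rnormC ger0_norm ?ler0c // ReZ.
Qed.

Lemma rnormD u v : rnorm (u + v) <= rnorm u + rnorm v.
Proof. by have := ler_normD u v; rewrite -!rnormC -real_complexD lecR. Qed.

Lemma rnorm0 : rnorm (0 : V) = 0.
Proof. by rewrite /rnorm normr0. Qed.

Lemma rnorm_sum n (w : 'I_n -> V) : rnorm (\sum_(i < n) w i) <= \sum_(i < n) rnorm (w i).
Proof.
elim/big_ind2: _ => [|x x' y y' h h'|//]; first by rewrite rnorm0.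
exact: le_trans (rnormD _ _) (lerD h h').
Qed.

Lemma l2norm_ge0 n (w : 'I_n -> V) : 0 <= l2norm w.
Proof. exact: sqrtr_ge0. Qed.

Lemma l2norm_sqr n (w : 'I_n -> V) : l2norm w ^+ 2 = \sum_(i < n) rnorm (w i) ^+ 2.
Proof. by rewrite sqr_sqrtr // sumr_ge0 // => i _; exact: sqr_ge0. Qed.

Lemma l2normZ n (t : R) (w : 'I_n -> V) : 0 <= t -> l2norm (t%:C *: w) = t * l2norm w.
Proof.
move=> t0; rewrite /l2norm -[t in RHS]ger0_norm // -sqrtr_sqr -sqrtrM ?sqr_ge0 // mulr_sumr.
by congr Num.sqrt; apply: eq_bigr => i _; rewrite rnormZ // exprMn.
Qed.

Lemma rnorm_le_l2norm n (w : 'I_n -> V) i : rnorm (w i) <= l2norm w.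
Proof.
rewrite -(@ler_pXn2r _ 2) ?nnegrE ?rnorm_ge0 ?l2norm_ge0 // l2norm_sqr (bigD1 i) //= lerDl.
by apply: sumr_ge0 => j _; exact: sqr_ge0.
Qed.

Lemma l2norm_le_sum n (w : 'I_n -> V) : l2norm w <= \sum_(i < n) rnorm (w i).
Proof.
rewrite -(@ler_pXn2r _ 2) ?nnegrE ?l2norm_ge0 ?sumr_ge0 //; last by move=> *; exact: rnorm_ge0.
rewrite l2norm_sqr.
suff [] : 0 <= \sum_i rnorm (w i) /\ \sum_i rnorm (w i) ^+ 2 <= (\sum_i rnorm (w i)) ^+ 2 by [].
elim/big_ind2: _ => [|x x' y y' [x0 h] [y0 h']|i _]; last by rewrite rnorm_ge0.
  by rewrite expr0n.
by split; [exact: addr_ge0|nra].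
Qed.

End VectorNorms.

Section RepresentationBounds.
Variables (R : realType) (X : topologicalType) (A : set (X -> R[i])).
Variables (H : completeNormedModType R[i]) (rho : (X -> R[i]) -> (H -> H)).
Hypothesis rhoA : contractive_representation A rho.

Lemma repZl f (c : R[i]) v : A f -> rho f (c *: v) = c *: rho f v.
Proof.
move=> Af; have rl := rep_linear rhoA Af.
have rho0 : rho f 0 = 0.
  have := rl 1 0 0; rewrite !scale1r addr0 => h.
  by apply: (addrI (rho f 0)); rewrite addr0 -h.
by have := rl c v 0; rewrite rho0 !addr0.
Qed.

Lemma repDl f u v : A f -> rho f (u + v) = rho f u + rho f v.
Proof. by move=> Af; have := rep_linear rhoA Af 1 u v; rewrite !scale1r. Qed.

Lemma rep0l f : A f -> rho f 0 = 0.
Proof. by move=> Af; have := repZl 0 0 Af; rewrite !scale0r. Qed.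

Lemma rep_suml f I (r : seq I) (P : pred I) (F : I -> H) : A f ->
  rho f (\sum_(i <- r | P i) F i) = \sum_(i <- r | P i) rho f (F i).
Proof.
by move=> Af; apply: (big_morph (rho f) (fun u v => repDl u v Af) (rep0l Af)).
Qed.

Lemma rep_rnorm_le f v : A f -> rnorm (rho f v) <= supnorm f * rnorm v.
Proof.
move=> Af; apply: le_trans (ler_wpM2r (rnorm_ge0 v) (rep_contractive rhoA Af)).
have [d d0 hd] : exists2 d : R, 0 < d & forall u : H, rnorm u < d -> rnorm (rho f u) < 1.
  have /nbhs_ballP[e e0 he] : \forall u \near (0 : H), rnorm (rho f u) < 1.
    have FF := nbhs_filter (0 : H).
    have c0 : rho f @ nbhs (0 : H) --> rho f 0 by exact: (rep_bounded rhoA Af).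
    have /(@cvgrPdist_lt _ _ _ _ FF)/(_ 1 ltr01) := c0.
    by rewrite (rep0l Af); apply: filterS => u /=; rewrite sub0r normrN -rnormC ltcR.
  rewrite /= in e0; have eE : e = (complex.Re e)%:C by rewrite RRe_real // gtr0_real.
  exists (complex.Re e); first by rewrite eE ltcR in e0.
  by move=> u hu; apply: he; rewrite -ball_normE /= sub0r normrN -rnormC eE ltcR.
apply: (@le_opnorm _ _ _ _ _ _ (2 / d)) => //.
- by move=> t u t0; exact: rnormZ.
- by move=> t u t0; exact: rnormZ.
- by move=> t u t0; exact: repZl.
- by move=> u; exact: rnorm_ge0.
move=> u; have [u_eq0|u_neq0] := eqVneq (rnorm u) 0.
  have -> : u = 0 by apply/eqP; rewrite -normr_eq0 -rnormC u_eq0.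
  by rewrite (rep0l Af) !rnorm0 mulr0.
have upos : 0 < rnorm u by rewrite lt0r u_neq0 rnorm_ge0.
have c0 : 0 < d / (2 * rnorm u) by rewrite divr_gt0 // mulr_gt0.
have := hd ((d / (2 * rnorm u))%:C *: u); rewrite (repZl _ _ Af) !rnormZ ?(ltW c0) //.
have -> : d / (2 * rnorm u) * rnorm u = d / 2 by field; rewrite gt_eqF.
move=> /(_ _)/ltW; rewrite -ler_pdivlMl // mulr1.
have -> : (d / (2 * rnorm u))^-1 = 2 / d * rnorm u by field; rewrite !gt_eqF.
by apply; rewrite ltr_pdivrMr // ltr_pMr // ltr1n.
Qed.

Lemma ampliation_l2norm_le n (a : 'M[X -> R[i]]_n) (v : 'I_n -> H) : (forall i j, A (a i j)) ->
  l2norm (ampliation rho a v) <=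
  opnorm (@l2norm R H n) (@l2norm R H n) (ampliation rho a) * l2norm v.
Proof.
move=> aA.
apply: (@le_opnorm _ _ _ _ _ _ (\sum_i \sum_j supnorm (a i j))).
- by move=> t w t0; exact: l2normZ.
- by move=> t w t0; exact: l2normZ.
- move=> t w t0; apply/funext => i; rewrite /ampliation.
  change (\sum_j rho (a i j) (t%:C *: w j) = t%:C *: \sum_j rho (a i j) (w j)).
  by rewrite scaler_sumr; apply: eq_bigr => j _; exact: repZl.
- by move=> w; exact: l2norm_ge0.
move=> w; apply: le_trans (l2norm_le_sum _) _; rewrite mulr_suml; apply: ler_sum => i _.
apply: le_trans (rnorm_sum _) _; rewrite mulr_suml; apply: ler_sum => j _.
apply: le_trans (rep_rnorm_le _ (aA i j)) _.
by rewrite ler_wpM2l ?supnorm_ge0 // rnorm_le_l2norm.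
Qed.

End RepresentationBounds.
(** * Kernels and certificates *)

Section Kernels.
Variables (R : realType) (X : topologicalType) (A : set (X -> R[i])).
Hypothesis Aalg : unital_subalgebra A.
Local Notation kernel := (X -> X -> R[i]).

(** The Gram kernel of b minus that of g b: a state of the cone of these kernels,
    applied to Gram kernels, is a seminorm squared that every g contracts. *)
Definition defect_kernel (b g : X -> R[i]) : kernel :=
  fun x y => b x * conjc (b y) * (1 - g x * conjc (g y)).

Definition gram_kernel (b : X -> R[i]) : kernel := fun x y => b x * conjc (b y).

Inductive defect_cone : set kernel :=
| defect_cone0 : defect_cone 0
| defect_coneS b g k : A b -> A g -> (forall x, csq (g x) <= 1) ->
    defect_cone k -> defect_cone (defect_kernel b g + k).

Lemma defect_cone1 b g : A b -> A g -> (forall x, csq (g x) <= 1) ->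
  defect_cone (defect_kernel b g).
Proof. by move=> Ab Ag g1; rewrite -[defect_kernel b g]addr0; apply: defect_coneS => //; exact: defect_cone0. Qed.

Lemma defect_cone_cone : cone defect_cone.
Proof.
split=> [k l hk hl|t k t0].
  by elim: hk => [|b g k' Ab Ag g1 _ IH]; rewrite ?add0r // -addrA; exact: defect_coneS.
elim=> [|b g k' Ab Ag g1 _ IH]; first by rewrite scaler0; exact: defect_cone0.
rewrite scalerDr.
have -> : t%:C *: defect_kernel b g = defect_kernel ((Num.sqrt t)%:C *: b) g.
  apply/funext => x; apply/funext => y; rewrite /defect_kernel /=.
  change (t%:C * (b x * conjc (b y) * (1 - g x * conjc (g y))) =
    ((Num.sqrt t)%:C * b x) * conjc ((Num.sqrt t)%:C * b y) * (1 - g x * conjc (g y))).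
  rewrite conjcM conjc_real -{1}(sqr_sqrtr t0) expr2 real_complexM; ring.
by apply: defect_coneS => //; exact: (subalgebraZ Aalg).
Qed.

Lemma gram_defect b : gram_kernel b = defect_kernel b 0.
Proof.
by apply/funext => x; apply/funext => y; rewrite /defect_kernel /= mul0r subr0 mulr1.
Qed.

Lemma gram_cone b : A b -> defect_cone (gram_kernel b).
Proof.
move=> Ab; rewrite gram_defect; apply: defect_cone1 => // [|x].
  exact: subalgebra0.
by rewrite csq0 ler01.
Qed.

Lemma defect_gram b g : defect_kernel b g = gram_kernel b - gram_kernel (g * b).
Proof.
apply/funext => x; apply/funext => y; rewrite /defect_kernel /gram_kernel.
change (b x * conjc (b y) * (1 - g x * conjc (g y)) =
  b x * conjc (b y) - (g x * b x) * conjc (g y * b y)).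
rewrite conjcM; ring.
Qed.

Lemma gram_cst t : 0 <= t -> t%:C *: gram_kernel 1 = gram_kernel (cst (Num.sqrt t)%:C).
Proof.
move=> t0; apply/funext => x; apply/funext => y.
change (t%:C * (1 * conjc 1) = (Num.sqrt t)%:C * conjc (Num.sqrt t)%:C).
by rewrite conjc1 conjc_real !mulr1 -real_complexM -expr2 sqr_sqrtr.
Qed.

Lemma gram_order_bounded b : A b -> (exists2 M, 0 < M & forall x, csq (b x) <= M ^+ 2) ->
  order_bounded defect_cone (gram_kernel 1) (gram_kernel b).
Proof.
move=> Ab [M M0 bM]; exists (M ^+ 2); rewrite gram_cst ?sqr_ge0 // sqrtr_sqr gtr0_norm //.
split; last first.
  apply: (coneD defect_cone_cone); last exact: gram_cone.
  by apply: gram_cone; exact: subalgebra_cst.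
have -> : b = (M^-1%:C *: b) * cst M%:C.
  apply/funext => x; change (b x = M^-1%:C * b x * M%:C).
  by rewrite mulrAC -real_complexM mulVf ?gt_eqF // mul1r.
rewrite -defect_gram; apply: defect_cone1 => [||x].
- exact: subalgebra_cst.
- exact: (subalgebraZ Aalg).
- change (csq (M^-1%:C * b x) <= 1).
  by rewrite csqM csq_real exprVn mulrC ler_pdivrMr ?exprn_gt0 // mul1r.
Qed.

Lemma defect_coneP k : defect_cone k ->
  exists n (b : 'cV[X -> R[i]]_n) (g : 'rV[X -> R[i]]_n),
    [/\ forall j, A (b j 0), contractive_entries A g
      & forall x y, k x y = \sum_(j < n) defect_kernel (b j 0) (g 0 j) x y].
Proof.
elim=> {k} [|b g k Ab Ag g1 _ [n [bs [gs [bA gA kE]]]]].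
  by exists 0%N, 0, 0; split=> [[]//|[]//|x y]; rewrite big_ord0.
exists (1 + n)%N, (col_mx (const_mx b) bs), (row_mx (const_mx g) gs); split=> [j|j|x y].
- by case: (split_ordP j) => i ->; rewrite ?col_mxEu ?col_mxEd // mxE.
- by case: (split_ordP j) => i ->; rewrite ?row_mxEl ?row_mxEr // mxE.
- rewrite big_split_ord big_ord1 /= col_mxEu row_mxEl !mxE.
  change (defect_kernel b g x y + k x y = defect_kernel b g x y +
    \sum_(i < n) defect_kernel (col_mx (const_mx b) bs (rshift 1 i) 0)
      (row_mx (const_mx g) gs 0 (rshift 1 i)) x y).
  rewrite kE; congr (_ + _); apply: eq_bigr => i _.
  by rewrite col_mxEd row_mxEr.
Qed.

(** That 1 - f f^* is the sum of the defects of b and g says that [1; g b] and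
    [f; b] have the same Gram kernel, and the lurking isometry between them is a
    realization of f. *)
Lemma certificate_factorable p (f : 'cV[X -> R[i]]_p) (t : R) :
  compact [set: X] -> 
  defect_cone (fun x y => 1 - \sum_(i < p) gram_kernel (f i 0) x y) -> 0 < t < 1 ->
  factorable A (mxscale t f).
Proof.
move=> compactX /defect_coneP[n [b [g [bA gA kE]]]] t01.
pose xi x : 'cV[R[i]]_(1 + n) := col_mx 1%:M (diag_mx (mxat x g) *m mxat x b).
pose eta x : 'cV[R[i]]_(p + n) := col_mx (mxat x f) (mxat x b).
have adj_col m l (u : 'cV[R[i]]_m) (v : 'cV[R[i]]_l) : adj (col_mx u v) = row_mx (adj u) (adj v).
  by rewrite -[row_mx _ _]adjK adj_row_mx !adjK.
have gramE x y : adj (xi y) *m xi x = adj (eta y) *m eta x.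
  rewrite /xi /eta !adj_col !mul_row_col; apply/matrixP => i j; rewrite !ord1.
  have := kE x y; rewrite /defect_kernel /gram_kernel => /eqP; rewrite subr_eq => /eqP h.
  rewrite [LHS]mxE [RHS]mxE mulmx1 [adj _ 0 0]mxE mxE eqxx mulr1n conjc1.
  rewrite {1}h [X in X + _ = _]addrC -!addrA; congr (_ + _).
    by rewrite mxE; apply: eq_bigr => k _; rewrite !mxE mulrC.
  rewrite [X in _ + X = _]mxE [RHS]mxE -big_split /=; apply: eq_bigr => k _.
  rewrite [adj _ 0 k]mxE [in RHS]mxE !mul_diag_mx ![(\matrix_(_, _) _) _ _]mxE !mxE.
  by rewrite conjcM; ring.
have [V hV VE] := lurking_isometry gramE.
have [M M0 hM] : exists2 M, 0 < M & forall j x, csq (b j 0 x) <= M ^+ 2.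
  have hb j := compact_csq_bound compactX (subalgebra_continuous Aalg (bA j)).
  pose m j := sval (cid2 (hb j)).
  exists (1 + \sum_j m j) => [|j x].
    rewrite ltr_pwDl // sumr_ge0 // => j _; rewrite /m.
    by case: cid2 => /= r r0 _; exact: ltW.
  have m0 i : 0 <= m i by rewrite /m; case: cid2 => /= r r0 _; exact: ltW.
  apply: (@le_trans _ _ (m j ^+ 2)); first by rewrite /m; case: cid2.
  rewrite ler_pXn2r ?nnegrE ?addr_ge0 ?sumr_ge0 //.
  by rewrite (bigD1 j) //= addrCA lerDl addr_ge0 ?sumr_ge0.
exact: (realization_factorable Aalg hV gA bA M0 hM).
Qed.

End Kernels.
(** * The representation associated with a state *)

Section DualRepresentation.
Variables (R : realType) (X : topologicalType) (A : set (X -> R[i])).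
Hypothesis (compactX : compact [set: X]) (Aalg : unital_subalgebra A).
Local Notation T := (algebra_of Aalg).
Variable q : T -> R.
Hypotheses (qP : unitary_parallelogram q) (q_ge0 : forall u, 0 <= q u).
Hypothesis qM : forall f (Af : A f), (forall x, csq (f x) <= 1) -> forall a, q (alg_mul Af a) <= q a.
Local Notation H := (qdual qP q_ge0).

Lemma q_mul_le f (Af : A f) (M : R) (a : T) : 0 <= M -> (forall x, csq (f x) <= M ^+ 2) ->
  q (alg_mul Af a) <= M ^+ 2 * q a.
Proof.
rewrite le0r => /orP[/eqP->|M0] fM.
  have -> : alg_mul Af a = 0.
    apply/val_inj/funext => x; change (f x * a x = 0).
    rewrite [f x](_ : _ = 0) ?mul0r //; apply: csq_eq0; apply/eqP.
    by rewrite eq_le csq_ge0 andbT; have := fM x; rewrite expr0n.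
  by rewrite (parallelogram0 qP) expr0n mul0r.
have Ag : A (M^-1%:C *: f) := subalgebraZ Aalg _ Af.
have g1 x : csq ((M^-1%:C *: f) x) <= 1.
  change (csq (M^-1%:C * f x) <= 1).
  by rewrite csqM csq_real exprVn mulrC ler_pdivrMr ?exprn_gt0 // mul1r.
have := qM Ag g1 a.
have -> : alg_mul Ag a = M^-1%:C *: alg_mul Af a.
  apply/val_inj/funext => x; change (M^-1%:C * f x * a x = M^-1%:C * (f x * a x)).
  by rewrite mulrA.
by rewrite (parallelogramZ _ _ qP) csq_real exprVn mulrC ler_pdivrMr ?exprn_gt0 // mulrC.
Qed.

Lemma shift_bounded f (Af : A f) (phi : H) : (fun a => phi (alg_mul Af a)) \in qbounded q.
Proof.
apply/asboolP; split=> [a u v|].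
  rewrite -qdualP; congr (phi _); apply/val_inj/funext => x.
  change (f x * (a * u x + v x) = a * (f x * u x) + f x * v x); ring.
have [M M0 hM] := compact_csq_bound compactX (subalgebra_continuous Aalg Af).
exists (dual_sq phi * M ^+ 2); first by rewrite mulr_ge0 ?dual_sq_ge0 ?sqr_ge0.
move=> u; apply: le_trans (csq_qdual_le _ _) _; rewrite -mulrA.
by rewrite ler_wpM2l ?dual_sq_ge0 // q_mul_le // ltW.
Qed.

Definition shift f (Af : A f) (phi : H) : H := QDual qP q_ge0 (shift_bounded Af phi).

(** The transpose of the multiplication operators: as A is commutative it is
    again a representation. *)
Definition dual_rep (f : X -> R[i]) (phi : H) : H :=
  if pselect (A f) is left Af then shift Af phi else 0.

Lemma dual_repE f (Af : A f) phi a : dual_rep f phi a = phi (alg_mul Af a).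
Proof.
rewrite /dual_rep; case: pselect => // Af' /=.
by congr (phi _); apply/val_inj.
Qed.

Lemma qdual_ext (phi psi : H) : (forall a, phi a = psi a) -> phi = psi.
Proof. by move=> h; apply/val_inj/funext. Qed.

Lemma dual_sq_rep_le f (Af : A f) (M : R) phi : 0 <= M -> (forall x, csq (f x) <= M ^+ 2) ->
  dual_sq (dual_rep f phi) <= M ^+ 2 * dual_sq phi.
Proof.
move=> M0 fM; apply: dual_sq_le_csq; first by rewrite mulr_ge0 ?sqr_ge0 ?dual_sq_ge0.
move=> u; rewrite (dual_repE Af); apply: le_trans (csq_qdual_le _ _) _.
by rewrite [M ^+ 2 * _]mulrC -mulrA ler_wpM2l ?dual_sq_ge0 // q_mul_le.
Qed.

Lemma dual_rep_lin f (Af : A f) : linear (dual_rep f).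
Proof.
move=> c phi psi; apply: qdual_ext => u.
by rewrite qdual_addE qdual_scaleE !(dual_repE Af) qdual_addE qdual_scaleE.
Qed.

Lemma rnorm_qdual_sqrt (phi : H) : rnorm phi = Num.sqrt (dual_sq phi).
Proof. by rewrite -rnorm_qdual sqrtr_sqr ger0_norm ?rnorm_ge0. Qed.

Lemma rnorm_rep_le f (Af : A f) (M : R) phi : 0 <= M -> (forall x, csq (f x) <= M ^+ 2) ->
  rnorm (dual_rep f phi) <= M * rnorm phi.
Proof.
move=> M0 fM; rewrite !rnorm_qdual_sqrt -[M in leRHS]ger0_norm // -sqrtr_sqr -sqrtrM ?sqr_ge0 //.
by rewrite ler_wsqrtr // dual_sq_rep_le.
Qed.

Lemma dual_rep_representation : contractive_representation A dual_rep.
Proof.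
split.
- by move=> f Af; exact: dual_rep_lin.
- move=> f Af phi; have FF := nbhs_filter phi.
  apply/(@cvgrPdist_lt _ _ _ _ FF) => e e0.
  have eE : e = (complex.Re e)%:C by rewrite RRe_real // gtr0_real.
  rewrite eE in e0 *; move: (complex.Re e) e0 => r; rewrite ltcR => r0.
  have [M M0 hM] := compact_csq_bound compactX (subalgebra_continuous Aalg Af).
  apply/nbhs_ballP; exists (r / M)%:C; first by rewrite /= ltcR divr_gt0.
  move=> psi; rewrite -ball_normE /=.
  have -> : dual_rep f phi - dual_rep f psi = dual_rep f (phi - psi).
    by have := dual_rep_lin Af (-1) psi phi; rewrite !scaleN1r addrC [_ + phi]addrC => ->; rewrite addrC.
  rewrite -!rnormC !ltcR ltr_pdivlMr // => h.
  apply: le_lt_trans h; rewrite mulrC; apply: rnorm_rep_le => //; exact: ltW.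
- apply/funext => phi; apply: qdual_ext => a; rewrite (dual_repE (subalgebra1 Aalg)).
  by congr (phi _); apply/val_inj/funext => x; exact: mul1r.
- move=> f g Af Ag; apply/funext => phi; apply: qdual_ext => a.
  change (dual_rep (f + g) phi a = dual_rep f phi a + dual_rep g phi a).
  rewrite (dual_repE (subalgebraD Aalg Af Ag)) (dual_repE Af) (dual_repE Ag) -qdualD.
  by congr (phi _); apply/val_inj/funext => x; exact: mulrDl.
- move=> c f Af; apply/funext => phi; apply: qdual_ext => a.
  change (dual_rep (c *: f) phi a = c * dual_rep f phi a).
  rewrite (dual_repE (subalgebraZ Aalg c Af)) (dual_repE Af) -qdualZ.
  congr (phi _); apply/val_inj/funext => x.
  by change (c * f x * a x = c * (f x * a x)); rewrite mulrA.
- move=> f g Af Ag; apply/funext => phi; apply: qdual_ext => a /=.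
  rewrite (dual_repE (subalgebraM Aalg Af Ag)) (dual_repE Af) (dual_repE Ag).
  congr (phi _); apply/val_inj/funext => x.
  by change (f x * g x * a x = g x * (f x * a x)); ring.
- move=> f Af; apply: opnorm_le => [||phi]; first exact: supnorm_ge0.
    by exists 0; rewrite /rnorm normr0 /= ler01.
  apply: rnorm_rep_le => // [|x]; first exact: supnorm_ge0.
  by apply: csq_le_supnorm => //; exact: (subalgebra_continuous Aalg).
Qed.

(** If the representation on the dual contracts the row (f1, f2) by r, then q
    decreases accordingly on the column: test the row on the functionals that
    represent f1 and f2, and evaluate the result at 1. *)
Lemma completely_contractive_column f1 f2 (A1 : A f1) (A2 : A f2) (r : R) :
  completely_contractive A dual_rep -> 0 <= r ->
  (forall x, csq (f1 x) + csq (f2 x) <= r ^+ 2) ->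
  (q (alg_of Aalg A1) + q (alg_of Aalg A2)) ^+ 2 <=
  r ^+ 2 * (q (alg_of Aalg A1) + q (alg_of Aalg A2)) * q (alg_of Aalg (subalgebra1 Aalg)).
Proof.
move=> cc r0 fr.
pose a : 'M[X -> R[i]]_2 := \matrix_(i, j) if i == 0 then if j == 0 then f1 else f2 else 0.
have aA i j : A (a i j).
  by rewrite mxE; case: ifP => _; [case: ifP|exact: subalgebra0].
have a_r : mxsupnorm a <= r.
  rewrite /mxsupnorm; set E := [set _ | _ in _].
  have [[E0 _]|/sup_out -> //] := pselect (has_sup E).
  apply: ge_sup => // _ [x _ <-]; apply: mxopnorm_le => // v.
  rewrite /sqn !big_ord_recl !big_ord0 !addr0 !mxE !big_ord_recl !big_ord0 !mxE /= !addr0.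
  rewrite mul0r mul0r addr0 csq0 addr0.
  have := psd_CauchySchwarz (cdot_psd R 2) v (\col_j conjc (mxat x a 0 j)).
  rewrite !cdotE /= /cdot /sqn !big_ord_recl !big_ord0 !addr0 !mxE /= !conjcK !csqJ => h.
  rewrite ![_ * v _ _]mulrC; apply: le_trans h _.
  by rewrite mulrC; apply: ler_wpM2r; [apply: addr_ge0; exact: csq_ge0|exact: fr].
have [B Bpsd BE] := jordan_von_neumann qP q_ge0.
have Bq u : complex.Re (B u u) = q u by rewrite BE.
have phi_bounded g (Ag : A g) : (fun u => B u (alg_of Aalg Ag)) \in qbounded q.
  apply/asboolP; split=> [c u v|]; first exact: psdP.
  exists (q (alg_of Aalg Ag)) => // u.
  by rewrite mulrC -!Bq; exact: psd_CauchySchwarz.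
pose phi g (Ag : A g) : H := QDual qP q_ge0 (phi_bounded g Ag).
have phi_le g (Ag : A g) : dual_sq (phi g Ag) <= q (alg_of Aalg Ag).
  apply: dual_sq_le_csq => // u; rewrite mulrC -!Bq; exact: psd_CauchySchwarz.
pose v : 'I_2 -> H := fun j => if j == 0 then phi f1 A1 else phi f2 A2.
pose psi : H := dual_rep f1 (phi f1 A1) + dual_rep f2 (phi f2 A2).
have l2E (w : 'I_2 -> H) : l2norm w = Num.sqrt (dual_sq (w 0) + dual_sq (w 1)).
  rewrite /l2norm !big_ord_recl big_ord0 addr0 !rnorm_qdual.
  by congr (Num.sqrt (_ + dual_sq (w _))); apply/val_inj.
have repE0 (w : H) : dual_rep 0 w = 0.
  apply: qdual_ext => u; rewrite (dual_repE (subalgebra0 Aalg)).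
  transitivity (w 0); last by rewrite qdual0.
  by congr (w _); apply/val_inj/funext => x; exact: mul0r.
have ampE w : l2norm (ampliation dual_rep a w) =
    rnorm (dual_rep f1 (w 0) + dual_rep f2 (w 1)).
  rewrite l2E rnorm_qdual_sqrt /ampliation !big_ord_recl !big_ord0 !addr0 !mxE /= !repE0 addr0.
  have -> : dual_sq (0 : H) = 0.
    apply/eqP; rewrite eq_le dual_sq_ge0 andbT; apply: dual_sq_le_csq => // u.
    by rewrite mul0r csq0.
  by rewrite addr0; congr (Num.sqrt (dual_sq (_ + dual_rep f2 (w _)))); apply/val_inj.
have hv := le_trans (ampliation_l2norm_le dual_rep_representation v aA)
  (ler_wpM2r (l2norm_ge0 v) (le_trans (cc _ a aA) a_r)).
have psi_le : dual_sq psi <= r ^+ 2 * (dual_sq (phi f1 A1) + dual_sq (phi f2 A2)).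
  rewrite ampE rnorm_qdual_sqrt l2E /v /= in hv.
  rewrite -[dual_sq psi]sqr_sqrtr ?dual_sq_ge0 // -[_ + _ in leRHS]sqr_sqrtr ?addr_ge0 ?dual_sq_ge0 //.
  by rewrite -exprMn ler_pXn2r ?nnegrE ?mulr_ge0 ?sqrtr_ge0.
set s := q (alg_of Aalg A1) + q (alg_of Aalg A2).
have psi1 : psi (alg_of Aalg (subalgebra1 Aalg)) = s%:C.
  rewrite qdual_addE (dual_repE A1) (dual_repE A2) /phi /= /s real_complexD -!BE.
  by congr (B _ _ + B _ _); apply/val_inj/funext => x; exact: mulr1.
have := csq_qdual_le psi (alg_of Aalg (subalgebra1 Aalg)); rewrite psi1 csq_real.
move/le_trans; apply; rewrite ler_wpM2r //; apply: le_trans psi_le _.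
by rewrite ler_wpM2l ?sqr_ge0 // lerD.
Qed.

End DualRepresentation.
(** * From complete contractivity to factorizations *)

Section Necessity.
Variables (R : realType) (X : topologicalType) (A : set (X -> R[i])).
Hypothesis (compactX : compact [set: X]) (Aalg : unital_subalgebra A).
Hypothesis all_cc : forall (H : completeNormedModType R[i]) (rho : (X -> R[i]) -> (H -> H)),
  is_hilbert H -> contractive_representation A rho -> completely_contractive A rho.

(** Were the certificate missing, a state of the cone obtained by adjoining
    f f^* - 1 would make (f1, f2) expand the vector 1 of the associated
    representation. *)
Lemma column_certificate (x0 : X) (f1 f2 : X -> R[i]) (r : R) : A f1 -> A f2 ->
  0 <= r < 1 -> (forall x, csq (f1 x) + csq (f2 x) <= r ^+ 2) ->
  defect_cone A (gram_kernel 1 - (gram_kernel f1 + gram_kernel f2)).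
Proof.
move=> A1 A2 /andP[r0 r1] fr; apply: contrapT => ncert.
set e : X -> X -> R[i] := gram_kernel 1; set ff := gram_kernel f1 + gram_kernel f2.
pose K k := exists2 k0, defect_cone A k0 & exists2 s : R, 0 <= s & k = k0 + s%:C *: (ff - e).
have DK k : defect_cone A k -> K k.
  by move=> Dk; exists k => //; exists 0 => //; rewrite scale0r addr0.
have Dcone := defect_cone_cone Aalg.
have De : defect_cone A e by apply: gram_cone => //; exact: (subalgebra1 Aalg).
have Kcone : cone K.
  split=> [_ _ [k Dk [s s0 ->]] [l Dl [t t0 ->]]|t _ t0 [k Dk [s s0 ->]]].
    exists (k + l); first exact: (coneD Dcone).
    by exists (s + t); [exact: addr_ge0|rewrite real_complexD scalerDl addrACA].
  exists (t%:C *: k); first exact: (coneZ Dcone).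
  by exists (t * s); [exact: mulr_ge0|rewrite real_complexM scalerDr scalerA].
have DP k x : defect_cone A k -> 0 <= complex.Re (k x x).
  elim=> [|b g k' _ _ g1 _ IH]; first by [].
  change (0 <= complex.Re (defect_kernel b g x x + k' x x)).
  rewrite ReD addr_ge0 // /defect_kernel -!csqE -(rmorphB (real_complex R) 1) -real_complexM /=.
  by rewrite mulr_ge0 ?csq_ge0 // subr_ge0.
have KNe : ~ K (- e).
  move=> [k Dk [s s0 eE]].
  have [s_eq0|s_neq0] := eqVneq s 0.
    have := DP _ x0 Dk; have -> : k = - e by rewrite eE s_eq0 scale0r addr0.
    change (0 <= complex.Re (- ((1 : R[i]) * conjc 1)) -> False).
    by rewrite conjc1 mulr1 ReN /= lerNr oppr0 ler10.
  apply: ncert; have -> : e - ff = s^-1%:C *: (k + e).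
    have -> : k + e = s%:C *: (e - ff).
      by rewrite -[e in LHS]opprK eE opprD addrA subrr add0r -scalerN opprB.
    by rewrite scalerA -real_complexM mulVf // scale1r.
  by apply: (coneZ Dcone); rewrite ?invr_ge0 //; apply: (coneD Dcone).
have [L [LD LZ L_ge0 Le]] := cone_state Kcone (DK _ De) KNe.
have bgram b : A b -> order_bounded K e (gram_kernel b).
  move=> Ab; have bM := compact_csq_bound compactX (subalgebra_continuous Aalg Ab).
  have [M [h1 h2]] := gram_order_bounded Aalg Ab bM.
  by exists M; split; exact: DK.
have be := bgram _ (subalgebra1 Aalg).
pose q (u : algebra_of Aalg) := L (gram_kernel u).
have q_ge0 u : 0 <= q u.
  have Au := algebra_ofP u; apply: L_ge0; [exact: bgram|apply: DK; exact: gram_cone].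
have qP : unitary_parallelogram q.
  move=> a b u v; rewrite /q -!LD; do ?[apply: bgram; exact: algebra_ofP].
  rewrite -LZ; last 2 first.
  - by rewrite addr_ge0 ?csq_ge0.
  - by apply: order_boundedD => //; apply: bgram; exact: algebra_ofP.
  congr L; apply/funext => x; apply/funext => y.
  change ((a * u x + b * v x) * conjc (a * u y + b * v y) +
    (- conjc b * u x + conjc a * v x) * conjc (- conjc b * u y + conjc a * v y) =
    (csq a + csq b)%:C * (u x * conjc (u y) + v x * conjc (v y))).
  by rewrite real_complexD !csqE !conjcD !conjcM conjcN !conjcK; ring.
have qM f (Af : A f) : (forall x, csq (f x) <= 1) -> forall a, q (alg_mul Af a) <= q a.
  move=> f1_le a; rewrite -subr_ge0.
  have Aa := algebra_ofP a; have Afa := subalgebraM Aalg Af Aa.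
  have bd : order_bounded K e (defect_kernel a f).
    rewrite defect_gram; apply: order_boundedD => //; first exact: bgram.
    exact/order_boundedN/bgram.
  have := L_ge0 _ bd (DK _ (defect_cone1 Aa Af f1_le)).
  have := LD _ _ bd (bgram _ Afa).
  rewrite {1}defect_gram subrK -/(q a) => ->.
  by rewrite addrK.
have := @completely_contractive_column _ _ _ compactX Aalg q qP q_ge0 qM f1 f2 A1 A2 r.
move=> /(_ _ r0 fr).
have -> : q (alg_of Aalg (subalgebra1 Aalg)) = 1 by exact: Le.
set s := _ + _; have s1 : 1 <= s.
  have bff : order_bounded K e ff by apply: order_boundedD => //; exact: bgram.
  have bx : order_bounded K e (ff - e) by apply: order_boundedD => //; exact: order_boundedN.
  have ffE : L ff = L (gram_kernel f1) + L (gram_kernel f2).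
    by apply: LD; exact: bgram.
  have := LD _ _ bx be; rewrite subrK Le ffE.
  have : 0 <= L (ff - e).
    apply: L_ge0 => //; exists 0; first exact: defect_cone0.
    by exists 1 => //; rewrite add0r scale1r.
  rewrite -[gram_kernel f1]/(gram_kernel (alg_of Aalg A1)) -[gram_kernel f2]/(gram_kernel (alg_of Aalg A2)).
  by rewrite -/(q _) -/(q _) -/s; lra.
have rr : r ^+ 2 < 1 by rewrite expr_lt1.
move=> h; have : s ^+ 2 <= r ^+ 2 * s * 1.
  apply: h; apply: all_cc; first exact: qdual_is_hilbert.
  exact: dual_rep_representation.
by rewrite mulr1 expr2 ler_pM2r; lra.
Qed.

(** The numbers r < t < s < 1 share out the gap between the norm of the column and
    1: the certificate is for the column divided by t, the product of contractions
    loses the factor s, and its strict version the factor t / s. *)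
Lemma column_strictly_factorable (f1 f2 : X -> R[i]) : A f1 -> A f2 ->
  (forall x, rnorm (f1 x) ^+ 2 + rnorm (f2 x) ^+ 2 < 1) ->
  strictly_factorable A (\col_(i < 2) [:: f1; f2]`_i).
Proof.
move=> A1 A2 f_lt1; set F := \col_(i < 2) _.
have [[x0]|noX] := pselect (inhabited X); last first.
  have -> : F = map_mx cst 0 by apply: mxat_inj => x; exfalso; apply: noX.
  apply: strict_scalar; apply: (@le_lt_trans _ _ 0) => //; apply: mxopnorm_le => // v.
  by rewrite mul0mx sqn0 mulr_ge0 ?sqr_ge0 ?sqn_ge0.
pose g x := csq (f1 x) + csq (f2 x).
have cg : continuous g.
  by move=> x; apply: cvgD; apply: continuous_csq; exact: (subalgebra_continuous Aalg).
have [c hc] := compact_max compactX x0 cg.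
have g_ge0 x : 0 <= g x by rewrite addr_ge0 ?csq_ge0.
pose r := Num.sqrt (g c).
have r0 : 0 <= r by exact: sqrtr_ge0.
have r1 : r < 1.
  rewrite -[ltRHS]sqrtr1 ltr_sqrt //; have := f_lt1 c; rewrite !rnorm_sqr //.
have gr x : g x <= r ^+ 2 by rewrite sqr_sqrtr.
pose t := (1 + r) / 2.
have t0 : 0 < t by rewrite /t; lra.
have rt : r < t by rewrite /t; lra.
have t1 : t < 1 by rewrite /t; lra.
pose F' := mxscale t^-1 F.
have AF' f : A f -> A (t^-1%:C *: f) by move=> Af; exact: (subalgebraZ Aalg).
have rt1 : 0 <= r / t < 1.
  by rewrite divr_ge0 ?(ltW t0) //= ltr_pdivrMr // mul1r.
have := @column_certificate x0 _ _ (r / t) (AF' _ A1) (AF' _ A2) rt1.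
have F'r x : csq ((t^-1%:C *: f1) x) + csq ((t^-1%:C *: f2) x) <= (r / t) ^+ 2.
  change (csq (t^-1%:C * f1 x) + csq (t^-1%:C * f2 x) <= (r / t) ^+ 2).
  rewrite !csqM -mulrDr csq_real exprMn mulrC.
  by rewrite ler_wpM2r ?sqr_ge0 //; exact: gr.
move=> /(_ F'r) cert.
pose s := (1 + t) / 2.
have s0 : 0 < s by rewrite /s; lra.
have s1 : s < 1 by rewrite /s; lra.
have ts : t < s by rewrite /s; lra.
have hF' : factorable A (mxscale s F').
  apply: certificate_factorable => //; last by rewrite s0.
  move: cert; congr (defect_cone A); apply/funext => x; apply/funext => y.
  rewrite !big_ord_recl big_ord0 addr0 !mxE /=.
  change (1 * conjc 1 - (gram_kernel (t^-1%:C *: f1) x y + gram_kernel (t^-1%:C *: f2) x y) =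
    1 - (gram_kernel (t^-1%:C *: f1) x y + gram_kernel (t^-1%:C *: f2) x y)).
  by rewrite conjc1 mulr1.
have -> : F = mxscale (t / s) (mxscale s F').
  apply: mxat_inj => x; rewrite !mxat_scale !scalerA -!real_complexM.
  have -> : t / s * s / t = 1 by field; rewrite !gt_eqF.
  by rewrite scale1r.
apply: factorable_strict => //.
by rewrite divr_gt0 //= ltr_pdivrMr // mul1r.
Qed.

End Necessity.
(** * From factorizations to contractive pairs *)

Section FactorizationContraction.
Variables (R : realType) (X : topologicalType) (A : set (X -> R[i])).
Hypothesis Aalg : unital_subalgebra A.
Variables (H : completeNormedModType R[i]) (rho : (X -> R[i]) -> (H -> H)).
Hypotheses (rhoA : contractive_representation A rho) (H_hilbert : is_hilbert H).

Definition column_contractive p n (M : 'M[X -> R[i]]_(p, n)) :=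
  forall v : 'I_n -> H, \sum_i rnorm (\sum_j rho (M i j) (v j)) ^+ 2 <= \sum_j rnorm (v j) ^+ 2.

(** Columns and rows are treated together: commutativity of A makes
    transposition compatible with products. *)
Definition bicontractive p n (M : 'M[X -> R[i]]_(p, n)) :=
  [/\ forall i j, A (M i j), column_contractive M & column_contractive M^T].

Lemma rep_cst c v : rho (cst c) v = c *: v.
Proof.
have -> : cst c = c *: (1 : X -> R[i]) by apply/funext => x; exact: esym (mulr1 c).
by rewrite (repZ rhoA c (subalgebra1 Aalg)) (rep1 rhoA).
Qed.

Lemma bicontractive_cst p n (M : 'M[R[i]]_(p, n)) :
  contraction M -> bicontractive (map_mx cst M).
Proof.
have [B Bpsd BE] := (is_hilbert_psd H).1 H_hilbert.
have colM r s (N : 'M[R[i]]_(r, s)) : contraction N -> column_contractive (map_mx cst N).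
  move=> hN v; have := psd_contraction v Bpsd hN.
  congr (_ <= _); apply: eq_bigr => i _; rewrite BE //=.
  by congr (rnorm _ ^+ 2); apply: eq_bigr => j _; rewrite mxE rep_cst.
move=> hM; split=> [i j||]; first by rewrite mxE; exact: subalgebra_cst.
  exact: colM.
by rewrite map_trmx; apply/colM/contraction_tr.
Qed.

Lemma bicontractive_diag n (d : 'rV[X -> R[i]]_n) :
  (forall j, A (d 0 j) /\ supnorm (d 0 j) <= 1) -> bicontractive (diag_mx d).
Proof.
move=> hd.
have rep0 v : rho 0 v = 0.
  have -> : (0 : X -> R[i]) = cst 0 by [].
  by rewrite rep_cst scale0r.
have colD : column_contractive (diag_mx d).
  move=> v; apply: ler_sum => i _.
  rewrite (bigD1 i) //= big1 ?addr0 => [|j ji]; last first.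
    by rewrite mxE eq_sym (negbTE ji) mulr0n rep0.
  rewrite mxE eqxx mulr1n ler_pXn2r ?nnegrE ?rnorm_ge0 //.
  have [dA d1] := hd i; apply: le_trans (rep_rnorm_le rhoA _ dA) _.
  by rewrite ler_piMl ?rnorm_ge0.
split=> //; last by rewrite tr_diag_mx.
move=> i j; rewrite mxE; case: eqVneq => _; rewrite ?mulr1n ?mulr0n.
  by case: (hd i).
exact: subalgebra0.
Qed.

Lemma rep_sum_mul I (r : seq I) (F G : I -> X -> R[i]) v :
  (forall i, A (F i)) -> (forall i, A (G i)) ->
  rho (\sum_(i <- r) F i * G i) v = \sum_(i <- r) rho (F i) (rho (G i) v).
Proof.
move=> AF AG.
suff [] : A (\sum_(i <- r) F i * G i) /\
    rho (\sum_(i <- r) F i * G i) v = \sum_(i <- r) rho (F i) (rho (G i) v) by [].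
elim/big_ind2: _ => [|f u g w [Af <-] [Ag <-]|i _].
- split; first exact: subalgebra0.
  have -> : (0 : X -> R[i]) = cst 0 by [].
  by rewrite rep_cst scale0r.
- by split; [exact: (subalgebraD Aalg)|rewrite (repD rhoA)].
- by split; [exact: (subalgebraM Aalg)|rewrite (repM rhoA)].
Qed.

Lemma bicontractive_mul p n r (M : 'M[X -> R[i]]_(p, n)) (N : 'M[X -> R[i]]_(n, r)) :
  bicontractive M -> bicontractive N -> bicontractive (M *m N).
Proof.
move=> [MA Mcol Mrow] [NA Ncol Nrow].
have colMN a b c (S : 'M[X -> R[i]]_(a, b)) (T : 'M[X -> R[i]]_(b, c)) :
    (forall i j, A (S i j)) -> (forall i j, A (T i j)) ->
    column_contractive S -> column_contractive T -> column_contractive (S *m T).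
  move=> SA TA hS hT v; apply: le_trans (hT v).
  apply: le_trans (hS (fun k => \sum_j rho (T k j) (v j))).
  rewrite le_eqVlt; apply/orP; left; apply/eqP; apply: eq_bigr => i _.
  congr (rnorm _ ^+ 2).
  transitivity (\sum_j \sum_k rho (S i k) (rho (T k j) (v j))).
    by apply: eq_bigr => j _; rewrite mxE rep_sum_mul.
  by rewrite exchange_big /=; apply: eq_bigr => k _; rewrite (rep_suml rhoA).
split; [|exact: colMN|].
  move=> i j; rewrite mxE; elim/big_ind: _ => [|f g Af Ag|k _].
  - exact: subalgebra0.
  - exact: (subalgebraD Aalg).
  - exact: (subalgebraM Aalg).
have -> : (M *m N)^T = N^T *m M^T.
  by apply/matrixP => i j; rewrite !mxE; apply: eq_bigr => k _; rewrite !mxE mulrC.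
by apply: colMN => // i j; rewrite mxE.
Qed.

Lemma bicontractive_castmx p n p' n' (e : (p = p') * (n = n')) (M : 'M[X -> R[i]]_(p, n)) :
  bicontractive M -> bicontractive (castmx e M).
Proof. by case: e => e1 e2; case: _ / e1; case: _ / e2; rewrite castmx_id. Qed.

Lemma alternating_bicontractive (k : nat -> nat) (C : forall i, 'M[R[i]]_(k i, k i.+1))
    (D : forall i, 'rV[X -> R[i]]_(k i)) m :
  (forall i, (i <= m)%N -> mxopnorm (C i) < 1) ->
  (forall i, (1 <= i <= m)%N -> forall j, A (D i 0 j) /\ supnorm (D i 0 j) < 1) ->
  bicontractive (alternating_product C D m).
Proof.
elim: m => [|m IH] hC hD /=.
  by apply/bicontractive_cst/contraction_mxopnorm/ltW/hC.
apply: bicontractive_mul; last by apply/bicontractive_cst/contraction_mxopnorm/ltW/hC.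
apply: bicontractive_mul.
  by apply: IH => [i im|i /andP[i0 im]]; [apply: hC; exact: leqW|apply: hD; rewrite i0 leqW].
apply: bicontractive_diag => j; have [|dA d1] := hD m.+1 _ j; first by rewrite leqnn.
by split=> //; exact: ltW.
Qed.

Hypothesis factorization : forall f1 f2 : X -> R[i], A f1 -> A f2 ->
     (forall x, rnorm (f1 x) ^+ 2 + rnorm (f2 x) ^+ 2 < 1) ->
     exists (m : nat) (k : nat -> nat) (k0 : k 0%N = 2%N) (km : k m.+1 = 1%N)
            (C : forall i, 'M[R[i]]_(k i, k i.+1))
            (D : forall i, 'rV[X -> R[i]]_(k i)),
       [/\ forall i, (i <= m)%N -> mxopnorm (C i) < 1,
           forall i, (1 <= i <= m)%N ->
             forall j, A (D i 0 j) /\ supnorm (D i 0 j) < 1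
         & \col_(i < 2) [:: f1; f2]`_i
             = castmx (k0, km) (alternating_product C D m)].

Lemma pair_bicontractive f1 f2 : A f1 -> A f2 ->
  (forall x, csq (f1 x) + csq (f2 x) < 1) ->
  (forall h, rnorm (rho f1 h) ^+ 2 + rnorm (rho f2 h) ^+ 2 <= rnorm h ^+ 2) /\
  (forall h1 h2, rnorm (rho f1 h1 + rho f2 h2) ^+ 2 <= rnorm h1 ^+ 2 + rnorm h2 ^+ 2).
Proof.
move=> A1 A2 f_lt1.
have f_lt1' x : rnorm (f1 x) ^+ 2 + rnorm (f2 x) ^+ 2 < 1 by rewrite !rnorm_sqr.
have [m [k [k0 [km [C [D [hC hD FE]]]]]]] := factorization A1 A2 f_lt1'.
have : bicontractive (\col_(i < 2) [:: f1; f2]`_i).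
  by rewrite FE; apply: bicontractive_castmx; exact: alternating_bicontractive.
move=> [_ hcol hrow]; split=> [h|h1 h2].
  have := hcol (fun=> h).
  by rewrite !big_ord_recl !big_ord0 !addr0 !mxE /=.
have := hrow (fun i => if i == 0 then h1 else h2).
by rewrite !big_ord_recl !big_ord0 !addr0 !mxE /=.
Qed.

End FactorizationContraction.
(** * Approximation of positive functions and partitions of unity *)

Section PositiveApproximation.
Variables (R : realType) (X : topologicalType) (A : set (X -> R[i])).
Hypotheses (compactX : compact [set: X]) (logA : logmodular A).

Lemma logmodular_uniform (h : X -> R) (d : R) : continuous h -> 0 < d ->
  exists a b, [/\ A a, A b, a * b = 1 & forall x, `|h x - ln (rnorm (a x))| < d].
Proof.
move=> ch d0; have hcl := logA.2 h ch.
pose B : set {uniform X -> R} := [set g | forall x, `|h x - g x| < d].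
have nB : nbhs (h : {uniform X -> R}) B.
  apply/uniform_nbhs; exists [set p | ball p.1 d p.2].
  split; first exact: (entourage_ball _ (PosNum d0)).
  by move=> g /= hg x; have := hg x I; rewrite -ball_normE.
have [_ [[a [Aa [b Ab ab]] <-] hB]] := hcl _ nB.
by exists a, b.
Qed.

(** Uniform closeness of the logarithms is closeness of the squared moduli up to
    a factor; on a compact space it is closeness up to a constant. *)
Lemma logmodular_approx (r : X -> R) (e : R) : continuous r -> (forall x, 0 < r x) -> 0 < e ->
  exists a b, [/\ A a, A b, a * b = 1 & forall x, r x < csq (a x) < r x + e].
Proof.
move=> cr r0 e0; have [M0 M00 rM] := compact_ubound compactX cr.
pose M := M0 + e.
have Mpos : 0 < M by rewrite addr_gt0.
pose s x := r x + e / 2.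
have s0 x : 0 < s x by rewrite addr_gt0 // divr_gt0.
have sM x : s x <= M by rewrite /s /M lerD // ler_pdivrMr // ler_pMr // ler1n.
(* the admissible ratio between |a|^2 and r + e / 2 *)
pose k := 1 + e / (4 * M).
have kpos : 0 < e / (4 * M) by rewrite divr_gt0 // mulr_gt0.
have k1 : 1 < k by rewrite ltrDl.
have k0 : 0 < k by apply: lt_trans k1.
pose d := ln k / 2.
have d0 : 0 < d by rewrite divr_gt0 // ln_gt0.
have ch : continuous (fun x => ln (s x) / 2).
  move=> x; apply: cvgM; last exact: cvg_cst.
  apply: (@continuous_comp _ _ _ s (@ln R)); last exact: continuous_ln.
  by apply: cvgD; [exact: cr|exact: cvg_cst].
have [a [b [Aa Ab ab1 had]]] := logmodular_uniform ch d0.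
exists a, b; split=> // x.
have a0 : 0 < rnorm (a x).
  rewrite lt0r rnorm_ge0 andbT; apply/eqP => a0.
  have := congr1 (fun f => f x) ab1; change (a x * b x = 1 -> False).
  have -> : a x = 0 by apply: csq_eq0; rewrite -rnorm_sqr a0 expr0n.
  by rewrite mul0r => /esym/eqP; rewrite oner_eq0.
have := had x; rewrite ltr_norml => /andP[h1 h2].
have sqE : ln (csq (a x)) = 2 * ln (rnorm (a x)).
  by rewrite -rnorm_sqr expr2 lnM ?posrE //; ring.
have c0 : 0 < csq (a x) by rewrite -rnorm_sqr exprn_gt0.
have up : csq (a x) < s x * k.
  rewrite -ltr_ln ?posrE ?mulr_gt0 // lnM ?posrE // sqE; rewrite /d in h1; lra.
have lo : s x < csq (a x) * k.
  rewrite -ltr_ln ?posrE ?mulr_gt0 // lnM ?posrE // sqE; rewrite /d in h2; lra.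
have sk : s x * (k - 1) <= e / 4.
  apply: (@le_trans _ _ (M * (k - 1))).
    by rewrite ler_wpM2r // subr_ge0 ltW.
  rewrite /k addrAC subrr add0r.
  have -> : M * (e / (4 * M)) = e / 4 by field; rewrite gt_eqF.
  by [].
have ss : csq (a x) * (k - 1) < e / 2.
  apply: (@lt_le_trans _ _ (s x * k * (k - 1))); first by rewrite ltr_pM2r // subr_gt0.
  have k2 : k <= 2.
    rewrite /k -lerBrDl (_ : 2 - 1 = 1) ?ler_pdivrMr ?mulr_gt0 //; last by ring.
    by rewrite mul1r /M; lra.
  rewrite mulrAC (le_trans (ler_wpM2r (ltW k0) sk)) //.
  by have : 0 < e / 4 by [rewrite divr_gt0]; nra.
rewrite /s in up lo sk s0 *; apply/andP; split; nra.
Qed.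

End PositiveApproximation.
(** Normalized tents max (0, e - d(x, y)) centred at finitely many points y. *)
Lemma partition_of_unity (R : realType) (X : topologicalType) (x0 : X)
  (d : X -> X -> R) (e : R) : compact [set: X] -> (forall y, continuous (d ^~ y)) -> (forall y, d y y = 0) -> 0 < e ->
  exists (ys : seq X) (p : X -> X -> R),
    [/\ forall y, continuous (p y), forall y x, 0 <= p y x,
        forall x, \sum_(y <- ys) p y x = 1 & forall y x, p y x != 0 -> d x y <= e].
Proof.
move=> compactX cd dd e0.
have [D _ cov] : finite_subset_cover [set: X] (fun y => [set x | d x y < e]) [set: X].
  (* the cover form of compactness concerns pointed spaces *)
  pose PX : ptopologicalType := HB.pack X (isPointed.Build X x0).
  have : compact ([set: PX] : set PX) := compactX; rewrite compact_cover; apply.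
    by move=> y _; apply: (@open_comp _ _ (d ^~ y) [set t | t < e]) => // x _; exact: cd.
  by move=> x _; exists x => //=; rewrite dd.
pose t y x := Num.max 0 (e - d x y).
have t0 y x : 0 <= t y x by rewrite le_max lexx.
have ct y : continuous (t y).
  move=> x; apply: (@continuous_max R X (fun=> 0) (fun z => e - d z y) x); first exact: cvg_cst.
  by apply: cvgB; [exact: cvg_cst|exact: cd].
pose S x := \sum_(y <- finmap.enum_fset D) t y x.
have S0 x : 0 < S x.
  have [y /= Dy dxy] := cov x I; rewrite /S (big_rem y) //=.
  rewrite ltr_pwDl ?sumr_ge0 // /t lt_max subr_gt0 dxy orbT //.
have cS : continuous S.
  by apply: continuous_big => // z; exact: add_continuous.
exists (finmap.enum_fset D), (fun y x => t y x / S x); split.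
- by move=> y x; apply: cvgM; [exact: ct|apply: cvgV; [rewrite gt_eqF|exact: cS]].
- by move=> y x; rewrite divr_ge0 // ltW.
- by move=> x; rewrite -mulr_suml -/(S x) divff // gt_eqF.
- move=> y x; apply: contraNT; rewrite -ltNge => de.
  have -> : t y x = 0 by apply: max_l; rewrite subr_le0 ltW.
  by rewrite mul0r.
Qed.
(** * The positive extension of a representation *)

Section TangentFunctional.
Variables (R : realType) (X : topologicalType) (A : set (X -> R[i])).
Hypotheses (compactX : compact [set: X]) (logA : logmodular A).
Variables (x0 : X) (H : completeNormedModType R[i]) (rho : (X -> R[i]) -> (H -> H)).
Hypothesis rhoA : contractive_representation A rho.
Variable B : H -> H -> R[i].
Hypotheses (Bpsd : psd B) (BE : forall v, B v v = (rnorm v ^+ 2)%:C).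
Hypothesis column_rep : forall f1 f2, A f1 -> A f2 -> (forall x, csq (f1 x) + csq (f2 x) < 1) ->
  forall h, rnorm (rho f1 h) ^+ 2 + rnorm (rho f2 h) ^+ 2 <= rnorm h ^+ 2.
Hypothesis row_rep : forall f1 f2, A f1 -> A f2 -> (forall x, csq (f1 x) + csq (f2 x) < 1) ->
  forall h1 h2, rnorm (rho f1 h1 + rho f2 h2) ^+ 2 <= rnorm h1 ^+ 2 + rnorm h2 ^+ 2.

Let Aalg : unital_subalgebra A := logA.1.
Local Notation sq v := (rnorm v ^+ 2).
Implicit Types (u v h k : H) (us : seq H) (f : X -> R[i]) (g : X -> R) (s : R).

Lemma csq_inverse (a b : X -> R[i]) x : a * b = 1 -> csq (a x) * csq (b x) = 1.
Proof.
move=> ab; rewrite -csqM; have abx : a x * b x = 1 by exact: (congr1 (fun f => f x) ab).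
by rewrite abx csq1.
Qed.

Lemma ReBE v : complex.Re (B v v) = sq v.
Proof. by rewrite BE. Qed.

Lemma sq_ge0 v : 0 <= sq v.
Proof. exact: sqr_ge0. Qed.

Definition dominated f s g := A f /\ forall x, csq (f x) <= s + g x.

(** The functional sup |rho(f) u|^2 over |f|^2 <= p is superlinear in p > 0, and
    [tangent] is its derivative at p = 1 in the direction g: by homogeneity the
    difference quotients become the differences of the values at s + g and at s,
    which increase with s.
    The version for several vectors uses the same f for all of them. *)
Definition tangent us g := sup [set y | exists f s,
  dominated f s g /\ y = \sum_(u <- us) (sq (rho f u) - s * sq u)].

(** The same derivative for the adjoints: 2 Re <rho(f) k, h> - |k|^2 has the
    supremum |rho(f)^* h|^2 over k. *)
Definition tangent_adj h g := sup [set y | exists f s k,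
  dominated f s g /\ y = 2 * complex.Re (B (rho f k) h) - sq k - s * sq h].

Lemma rep_sq_le f (c : R) u : A f -> 0 <= c -> (forall x, csq (f x) <= c) ->
  sq (rho f u) <= c * sq u.
Proof.
move=> Af c0 fc; rewrite -[c in leRHS]sqr_sqrtr // -exprMn.
rewrite ler_pXn2r ?nnegrE ?rnorm_ge0 ?mulr_ge0 ?sqrtr_ge0 ?rnorm_ge0 //.
apply: le_trans (rep_rnorm_le rhoA _ Af) _; rewrite ler_wpM2r ?rnorm_ge0 //.
by apply: supnorm_le => [|x]; rewrite ?sqrtr_ge0 // sqr_sqrtr.
Qed.

Lemma dominated_value_le us g f s (M : R) : dominated f s g -> (forall x, g x <= M) ->
  \sum_(u <- us) (sq (rho f u) - s * sq u) <= M * \sum_(u <- us) sq u.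
Proof.
move=> [Af fg] gM; rewrite mulr_sumr; apply: ler_sum => u _.
have fsM x : csq (f x) <= s + M by apply: le_trans (fg x) _; rewrite lerD2l.
have sM : 0 <= s + M by apply: le_trans (fsM x0); exact: csq_ge0.
by have := rep_sq_le u Af sM fsM; rewrite mulrDl; lra.
Qed.

Lemma dominated_adj_value_le h g f s k (M : R) : dominated f s g -> (forall x, g x <= M) ->
  2 * complex.Re (B (rho f k) h) - sq k - s * sq h <= M * sq h.
Proof.
move=> [Af fg] gM.
have fsM x : csq (f x) <= s + M by apply: le_trans (fg x) _; rewrite lerD2l.
have sM : 0 <= s + M by apply: le_trans (fsM x0); exact: csq_ge0.
have CS := psd_CauchySchwarz Bpsd (rho f k) h; rewrite !ReBE in CS.
have h1 := rep_sq_le k Af sM fsM.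
have h2 : complex.Re (B (rho f k) h) ^+ 2 <= sq k * ((s + M) * sq h).
  apply: (@le_trans _ _ (csq (B (rho f k) h))); first by rewrite /csq lerDl sqr_ge0.
  by apply: le_trans CS _; rewrite mulrA ler_wpM2r ?sq_ge0 // [sq k * _]mulrC.
by have := double_le_sqr (sq_ge0 k) (mulr_ge0 sM (sq_ge0 h)) h2; lra.
Qed.

Lemma dominated0 g (M : R) : (forall x, - M <= g x) -> dominated 0 M g.
Proof.
move=> gM; split=> [|x]; first exact: subalgebra0.
by rewrite csq0 -lerBlDl sub0r.
Qed.

Lemma bounded_below g : continuous g -> exists M : R, forall x, - M <= g x.
Proof.
move=> cg; have cNg : continuous (fun x => - g x) by move=> x; apply: cvgN; exact: cg.
have [M _ hM] := compact_ubound compactX cNg.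
by exists M => x; rewrite lerNl.
Qed.

Lemma tangent_le us g (c : R) : continuous g ->
  (forall f s, dominated f s g -> \sum_(u <- us) (sq (rho f u) - s * sq u) <= c) ->
  tangent us g <= c.
Proof.
move=> cg h; apply: ge_sup => [|_ [f [s [fg ->]]]]; last exact: h.
have [M gM] := bounded_below cg.
by eexists; exists 0, M; split=> //; exact: dominated0.
Qed.

Lemma le_tangent us g f s : continuous g -> dominated f s g ->
  \sum_(u <- us) (sq (rho f u) - s * sq u) <= tangent us g.
Proof.
move=> cg fg; have [M _ gM] := compact_ubound compactX cg.
apply: ub_le_sup; last by exists f, s.
by exists (M * \sum_(u <- us) sq u) => _ [f' [s' [fg' ->]]]; exact: dominated_value_le fg' gM.
Qed.

Lemma tangent_adj_le h g (c : R) : continuous g ->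
  (forall f s k, dominated f s g -> 2 * complex.Re (B (rho f k) h) - sq k - s * sq h <= c) ->
  tangent_adj h g <= c.
Proof.
move=> cg hc; apply: ge_sup => [|_ [f [s [k [fg ->]]]]]; last exact: hc.
have [M gM] := bounded_below cg.
by eexists; exists 0, M, 0; split=> //; exact: dominated0.
Qed.

Lemma le_tangent_adj h g f s k : continuous g -> dominated f s g ->
  2 * complex.Re (B (rho f k) h) - sq k - s * sq h <= tangent_adj h g.
Proof.
move=> cg fg; have [M _ gM] := compact_ubound compactX cg.
apply: ub_le_sup; last by exists f, s, k.
by exists (M * sq h) => _ [f' [s' [k' [fg' ->]]]]; exact: dominated_adj_value_le fg' gM.
Qed.

Lemma tangent_bound us g (M : R) : continuous g -> (forall x, g x <= M) ->
  tangent us g <= M * \sum_(u <- us) sq u.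
Proof. by move=> cg gM; apply: tangent_le => // f s fg; exact: dominated_value_le fg gM. Qed.

Lemma tangent_adj_bound h g (M : R) : continuous g -> (forall x, g x <= M) ->
  tangent_adj h g <= M * sq h.
Proof. by move=> cg gM; apply: tangent_adj_le => // f s k fg; exact: dominated_adj_value_le fg gM. Qed.

Lemma continuousD g g' : continuous g -> continuous g' -> continuous (fun x => g x + g' x).
Proof. by move=> cg cg' x; apply: cvgD; [exact: cg|exact: cg']. Qed.

Lemma continuousN g : continuous g -> continuous (fun x => - g x).
Proof. by move=> cg x; apply: cvgN; exact: cg. Qed.

(** Superadditivity rests on this: |f|^2 + |f'|^2 is less than the squared modulus
    of an invertible c, so that f and f' form a contraction times c. *)
Lemma dominated_pair f f' s s' g g' (e : R) : continuous g -> continuous g' -> 0 < e ->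
  dominated f s g -> dominated f' s' g' ->
  exists c d, [/\ A d, c * d = 1, dominated c (s + s' + e) (fun x => g x + g' x)
    & forall x, csq ((f * d) x) + csq ((f' * d) x) < 1].
Proof.
move=> cg cg' e0 [Af fg] [Af' fg'].
pose r x := s + s' + e / 2 + (g x + g' x).
have e20 : 0 < e / 2 by rewrite divr_gt0.
have cr : continuous r.
  apply: continuousD; last exact: continuousD.
  by move=> x; exact: cvg_cst.
have r0 x : 0 < r x.
  have := fg x; have := fg' x; have := csq_ge0 (f x); have := csq_ge0 (f' x).
  by rewrite /r; lra.
have [c [d [Ac Ad cd crr]]] := logmodular_approx compactX logA cr r0 e20.
exists c, d; split=> // [|x].
  split=> // x; have /andP[_] := crr x; rewrite /r; lra.
have /andP[h1 _] := crr x.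
have cd1 := csq_inverse x cd.
have c0 : 0 < csq (c x) by apply: lt_trans h1.
have d0 : 0 < csq (d x) by rewrite -(pmulr_rgt0 _ c0) cd1.
change (csq (f x * d x) + csq (f' x * d x) < 1).
rewrite !csqM -mulrDl -cd1 ltr_pM2r //.
by have := fg x; have := fg' x; rewrite /r in h1; lra.
Qed.

Lemma rep_cancel f c d h : A f -> A c -> A d -> c * d = 1 -> rho (f * d) (rho c h) = rho f h.
Proof.
move=> Af Ac Ad cd; have Afd := subalgebraM Aalg Af Ad.
have := repM rhoA Afd Ac; rewrite -mulrA [d * c]mulrC cd mulr1 => ->.
by [].
Qed.

Lemma tangent_superadd u g g' : continuous g -> continuous g' ->
  tangent [:: u] g + tangent [:: u] g' <= tangent [:: u] (fun x => g x + g' x).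
Proof.
move=> cg cg'; have cgg' := continuousD cg cg'.
rewrite -lerBrDr; apply: tangent_le => // f s fg; rewrite lerBrDr -lerBrDl.
apply: tangent_le => // f' s' fg'; rewrite lerBrDl !big_seq1.
apply/ler_addgt0Pr => e e0.
have e'0 : 0 < e / (sq u + 1) by rewrite divr_gt0 // ltr_wpDl ?sq_ge0.
have [c [d [Ad cd dc fd1]]] := dominated_pair cg cg' e'0 fg fg'.
have Af := fg.1; have Af' := fg'.1.
have := le_tangent [:: u] cgg' dc; rewrite big_seq1.
have := column_rep (subalgebraM Aalg Af Ad) (subalgebraM Aalg Af' Ad) fd1 (rho c u).
rewrite !(rep_cancel _ _ dc.1 Ad cd) //.
have : e / (sq u + 1) * sq u <= e.
  rewrite mulrAC ler_pdivrMr ?ltr_wpDl ?sq_ge0 // mulrDr mulr1 lerDl; exact: ltW.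
by move: (e / _) => e'; lra.
Qed.

Lemma tangent_adj_superadd h g g' : continuous g -> continuous g' ->
  tangent_adj h g + tangent_adj h g' <= tangent_adj h (fun x => g x + g' x).
Proof.
move=> cg cg'; have cgg' := continuousD cg cg'.
rewrite -lerBrDr; apply: tangent_adj_le => // f s k fg; rewrite lerBrDr -lerBrDl.
apply: tangent_adj_le => // f' s' k' fg'; rewrite lerBrDl.
apply/ler_addgt0Pr => e e0.
have e'0 : 0 < e / (sq h + 1) by rewrite divr_gt0 // ltr_wpDl ?sq_ge0.
have [c [d [Ad cd dc fd1]]] := dominated_pair cg cg' e'0 fg fg'.
have Af := fg.1; have Af' := fg'.1; have Ac := dc.1.
have Afd := subalgebraM Aalg Af Ad; have Af'd := subalgebraM Aalg Af' Ad.
pose k2 := rho (f * d) k + rho (f' * d) k'.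
have rk2 : rho c k2 = rho f k + rho f' k'.
  rewrite /k2 (repDl rhoA) //.
  have := repM rhoA Ac Afd; have := repM rhoA Ac Af'd.
  rewrite ![c * _]mulrC -!mulrA ![d * c]mulrC cd !mulr1 => /(congr1 (fun F => F k')) /= ->.
  by move=> /(congr1 (fun F => F k)) /= ->.
have := le_tangent_adj h k2 cgg' dc; rewrite rk2 (psdD Bpsd) ReD.
have := row_rep Afd Af'd fd1 k k'; rewrite -/k2.
have : e / (sq h + 1) * sq h <= e.
  rewrite mulrAC ler_pdivrMr ?ltr_wpDl ?sq_ge0 // mulrDr mulr1 lerDl; exact: ltW.
by move: (e / _) => e'; lra.
Qed.

(** The two derivatives dominate each other with opposite signs. An invertible a
    with |a|^2 close to s + g and the function s / a, whose squared modulus is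
    s^2 / (s + g) = s - g + O(1 / s), have values of opposite signs, up to a small
    error, at the vectors u and k = rho(a) u. *)
Lemma tangent_duality us g : continuous g ->
  0 <= tangent us g + \sum_(u <- us) tangent_adj u (fun x => - g x).
Proof.
move=> cg; have cNg := continuousN cg.
rewrite -[leRHS]opprK oppr_ge0; apply/ler_addgt0Pr => e0 e0_gt0; rewrite add0r.
pose T := \sum_(u <- us) sq u.
have T0 : 0 <= T by apply: sumr_ge0 => u _; exact: sq_ge0.
pose e := e0 / (T + 1).
have e_gt0 : 0 < e by rewrite divr_gt0 // ltr_wpDl.
have eT : e * T <= e0.
  rewrite /e mulrAC ler_pdivrMr ?ltr_wpDl // mulrDr mulr1 lerDl; exact: ltW.
have [M1 M10 gM1] := compact_ubound compactX cg.
have [M2 M20 gM2] := compact_ubound compactX cNg.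
pose M := M1 + M2.
have M0 : 0 < M by rewrite addr_gt0.
have gM x : - M <= g x <= M.
  by have := gM1 x; have := gM2 x; rewrite /M => h1 h2; apply/andP; split; lra.
(* large enough for s^2 / (s + g - 1 / s) <= s + e - g *)
pose s := M + 1 + (1 + M + M ^+ 2) / e.
have qe : 0 < (1 + M + M ^+ 2) / e by rewrite divr_gt0 // ?addr_gt0 ?exprn_gt0.
have s1 : 1 < s by rewrite /s; lra.
have s0 : 0 < s by apply: lt_trans s1.
have sV : 0 < s^-1 by rewrite invr_gt0.
have sV1 : s^-1 < 1 by rewrite invf_lt1.
pose r x := s - s^-1 + g x.
have cr : continuous r by apply: continuousD => //; move=> x; exact: cvg_cst.
have r0 x : 0 < r x by have /andP[h1 _] := gM x; rewrite /r /s; lra.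
have [a [b [Aa Ab ab har]]] := logmodular_approx compactX logA cr r0 sV.
have da : dominated a s g.
  by split=> // x; have /andP[_] := har x; rewrite /r; lra.
pose f' := s%:C *: b.
have Af' : A f' by exact: (subalgebraZ Aalg).
have df' : dominated f' (s + e) (fun x => - g x).
  split=> // x; have /andP[h1 _] := har x.
  have ab1 := csq_inverse x ab.
  have a0 : 0 < csq (a x) by apply: lt_trans h1.
  have -> : csq (f' x) = s ^+ 2 * csq (b x) by rewrite -csq_real -csqM.
  rewrite -(ler_pM2l a0) mulrCA ab1 mulr1.
  have /andP[g1 g2] := gM x.
  have seg : 0 <= s + e - g x by rewrite /s; lra.
  apply: (@le_trans _ _ (r x * (s + e - g x))); last by rewrite ler_wpM2r // ltW.
  have -> : r x * (s + e - g x) = s ^+ 2 + e * r x - (s^-1 * s) - g x ^+ 2 + s^-1 * g x.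
    by rewrite /r; ring.
  rewrite mulVf ?gt_eqF // -!addrA lerDl.
  have er : 1 + M + M ^+ 2 <= e * r x.
    rewrite mulrC -ler_pdivrMr // /r /s; lra.
  have g2M : g x ^+ 2 <= M ^+ 2.
    have : 0 <= (M - g x) * (M + g x) by apply: mulr_ge0; lra.
    by rewrite -subr_sqr subr_ge0.
  have sg : - M <= s^-1 * g x.
    have : s^-1 * - M <= s^-1 * g x by rewrite ler_pM2l.
    by nra.
  lra.
have k1 := le_tangent us cg da.
have k2 : \sum_(u <- us) (2 * complex.Re (B (rho f' (rho a u)) u) - sq (rho a u) - (s + e) * sq u) <=
    \sum_(u <- us) tangent_adj u (fun x => - g x).
  by apply: ler_sum => u _; exact: le_tangent_adj.
have k3 : \sum_(u <- us) (sq (rho a u) - s * sq u) +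
    \sum_(u <- us) (2 * complex.Re (B (rho f' (rho a u)) u) - sq (rho a u) - (s + e) * sq u) =
    - (e * T).
  rewrite -big_split /T mulr_sumr -sumrN; apply: eq_bigr => u _ /=.
  have -> : rho f' (rho a u) = s%:C *: u.
    rewrite (repZ rhoA _ Ab) /=.
    change (s%:C *: rho b (rho a u) = s%:C *: u); congr (_ *: _).
    have := repM rhoA Ab Aa; rewrite mulrC ab (rep1 rhoA) => /(congr1 (fun F => F u)) /= <-.
    by [].
  by rewrite (psdZ Bpsd) ReZ ReBE; ring.
lra.
Qed.


Lemma tangent_cancel u g : continuous g ->
  tangent [:: u] g + tangent [:: u] (fun x => - g x) <= 0 /\
  tangent_adj u g + tangent_adj u (fun x => - g x) <= 0.
Proof.
move=> cg; have cNg := continuousN cg; have c0 := continuousD cg cNg.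
have g0 x : g x - g x <= 0 by rewrite subrr.
split.
  apply: le_trans (tangent_superadd u cg cNg) _.
  by apply: le_trans (tangent_bound [:: u] c0 g0) _; rewrite mul0r.
apply: le_trans (tangent_adj_superadd u cg cNg) _.
by apply: le_trans (tangent_adj_bound u c0 g0) _; rewrite mul0r.
Qed.

(** Superlinear and, by duality, odd: hence linear. *)
Lemma tangent_odd u g : continuous g ->
  tangent [:: u] (fun x => - g x) = - tangent [:: u] g /\
  tangent_adj u (fun x => - g x) = - tangent [:: u] g.
Proof.
move=> cg; have cNg := continuousN cg.
have [h1 h2] := tangent_cancel u cg.
have := tangent_duality [:: u] cg; have := tangent_duality [:: u] cNg; rewrite !big_seq1.
have -> : (fun x => - - g x) = g by apply/funext => x; rewrite opprK.
by move=> h3 h4; split; lra.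
Qed.

Lemma tangent_sum us g : continuous g -> tangent us g = \sum_(u <- us) tangent [:: u] g.
Proof.
move=> cg; apply/eqP; rewrite eq_le; apply/andP; split.
  apply: tangent_le => // f s fg; apply: ler_sum => u _.
  by have := le_tangent [:: u] cg fg; rewrite big_seq1.
have := tangent_duality us cg.
rewrite (eq_bigr (fun u => - tangent [:: u] g)) => [|u _]; last exact: (tangent_odd u cg).2.
by rewrite sumrN subr_ge0.
Qed.

Lemma tangentN us g : continuous g -> tangent us (fun x => - g x) = - tangent us g.
Proof.
move=> cg; rewrite !tangent_sum //; last exact: continuousN.
by rewrite -sumrN; apply: eq_bigr => u _; exact: (tangent_odd u cg).1.
Qed.

Lemma tangentD u g g' : continuous g -> continuous g' ->
  tangent [:: u] (fun x => g x + g' x) = tangent [:: u] g + tangent [:: u] g'.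
Proof.
move=> cg cg'; apply/eqP; rewrite eq_le tangent_superadd // andbT.
have := tangent_superadd u (continuousD cg cg') (continuousN cg').
have -> : (fun x => g x + g' x + - g' x) = g by apply/funext => x; rewrite addrK.
by rewrite tangentN //; lra.
Qed.

Lemma continuousZ (t : R) g : continuous g -> continuous (fun x => t * g x).
Proof. by move=> cg x; apply: cvgM; [exact: cvg_cst|exact: cg]. Qed.

Lemma tangentZ u (t : R) g : continuous g -> tangent [:: u] (fun x => t * g x) = t * tangent [:: u] g.
Proof.
move=> cg.
wlog t0 : t / 0 <= t => [hw|].
  have [|t0] := leP 0 t; first exact: hw.
  have -> : (fun x => t * g x) = (fun x => - (- t * g x)) by apply/funext => x; ring.
  rewrite tangentN; last exact: continuousZ.
  by rewrite hw ?oppr_ge0 ?(ltW t0) //; ring.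
have le_scale (c : R) g' : 0 < c -> continuous g' ->
    c * tangent [:: u] g' <= tangent [:: u] (fun x => c * g' x).
  move=> c0 cg'; rewrite -ler_pdivlMl //; apply: tangent_le => // f s [Af fg].
  rewrite ler_pdivlMl // !big_seq1.
  have dom : dominated ((Num.sqrt c)%:C *: f) (c * s) (fun x => c * g' x).
    split=> [|x]; first exact: (subalgebraZ Aalg).
    change (csq ((Num.sqrt c)%:C * f x) <= c * s + c * g' x).
    by rewrite csqM csq_real sqr_sqrtr ?(ltW c0) // -mulrDr ler_pM2l.
  have := le_tangent [:: u] (@continuousZ c _ cg') dom; rewrite big_seq1.
  rewrite (repZ rhoA _ Af).
  change (sq ((Num.sqrt c)%:C *: rho f u) - c * s * sq u <= tangent [:: u] (fun x => c * g' x) ->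
    c * (sq (rho f u) - s * sq u) <= tangent [:: u] (fun x => c * g' x)).
  by rewrite rnormZ ?sqrtr_ge0 // exprMn sqr_sqrtr ?(ltW c0) // mulrBr [c * (s * _)]mulrA.
move: t0; rewrite le0r => /orP[/eqP->|t0].
  rewrite mul0r; have c0 : continuous (fun x => 0 * g x) by exact: continuousZ.
  have := tangentN [:: u] c0.
  have -> : (fun x => - (0 * g x)) = (fun x => 0 * g x) by apply/funext => x; ring.
  by lra.
apply/eqP; rewrite eq_le le_scale // andbT -ler_pdivrMl //.
have tV0 : 0 < t^-1 by rewrite invr_gt0.
apply: le_trans (le_scale _ _ tV0 (@continuousZ t _ cg)) _.
have -> : (fun x => t^-1 * (t * g x)) = g by apply/funext => x; field; rewrite gt_eqF.
by [].
Qed.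

Lemma tangent_ge0 u g : continuous g -> (forall x, 0 <= g x) -> 0 <= tangent [:: u] g.
Proof.
move=> cg g0; have dom : dominated 0 0 g.
  by split=> [|x]; [exact: subalgebra0|rewrite csq0 add0r].
apply: le_trans (le_tangent [:: u] cg dom).
by rewrite big_seq1 mul0r subr0 sq_ge0.
Qed.

Lemma tangent_cst u (c : R) : tangent [:: u] (fun=> c) = c * sq u.
Proof.
have cc : continuous (fun _ : X => c) by move=> x; exact: cvg_cst.
have le d : tangent [:: u] (fun=> d) <= d * sq u.
  have cd : continuous (fun _ : X => d) by move=> x; exact: cvg_cst.
  by have := @tangent_bound [:: u] (fun=> d) d cd (fun=> lexx _); rewrite big_seq1.
apply/eqP; rewrite eq_le le /= -lerN2 -tangentN // -mulNr; exact: le.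
Qed.

Lemma tangent_norm_le u g (e : R) : continuous g -> (forall x, `|g x| <= e) ->
  `|tangent [:: u] g| <= e * sq u.
Proof.
move=> cg ge; rewrite ler_norml -lerN2 opprK -tangentN //.
have h1 x : - g x <= e by have := ge x; rewrite ler_norml => /andP[]; lra.
have h2 x : g x <= e by have := ge x; rewrite ler_norml => /andP[].
have := tangent_bound [:: u] (continuousN cg) h1; have := tangent_bound [:: u] cg h2.
by rewrite !big_seq1 => -> ->.
Qed.

(** The unitary mixtures of rho(f) u and rho(f) v have, together, |a|^2 + |b|^2
    times their squared length, whatever f is: this factor passes to the tangent
    functionals of the pairs. *)
Lemma tangent_parallelogram g : continuous g -> unitary_parallelogram (fun u => tangent [:: u] g).
Proof.
move=> cg a b u v.
set u' := a *: u + b *: v; set v' := - conjc b *: u + conjc a *: v.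
set k := csq a + csq b.
have two w z : tangent [:: w; z] g = tangent [:: w] g + tangent [:: z] g.
  by rewrite tangent_sum // big_cons big_seq1.
have k0 : 0 <= k by rewrite addr_ge0 ?csq_ge0.
have sqP : sq u' + sq v' = k * (sq u + sq v).
  by have := psd_parallelogram Bpsd a b u v; rewrite !ReBE.
have le g' : continuous g' -> tangent [:: u'; v'] g' <= k * tangent [:: u; v] g'.
  move=> cg'; apply: tangent_le => // f s fg.
  have Af := fg.1.
  have rP : sq (rho f u') + sq (rho f v') = k * (sq (rho f u) + sq (rho f v)).
    rewrite /u' /v' !(repDl rhoA) // !(repZl rhoA) //.
    by have := psd_parallelogram Bpsd a b (rho f u) (rho f v); rewrite !ReBE.
  have := le_tangent [:: u; v] cg' fg; rewrite !big_cons !big_nil !addr0 => /(ler_wpM2l k0).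
  apply: le_trans; rewrite le_eqVlt; apply/orP; left; apply/eqP.
  transitivity (sq (rho f u') + sq (rho f v') - s * (sq u' + sq v')); first by ring.
  by rewrite rP sqP; ring.
rewrite -!two; apply/eqP; rewrite eq_le le //=.
by have := le _ (continuousN cg); rewrite !tangentN // mulrN lerN2.
Qed.

(** The derivative of |rho(1 + t f) h|^2 at t = 0 is a lower bound; applied to - f
    it is an upper bound. *)
Lemma tangent_ReE f h : A f -> tangent [:: h] (fun x => complex.Re (f x)) = complex.Re (B (rho f h) h).
Proof.
have ge f' : A f' -> complex.Re (B (rho f' h) h) <= tangent [:: h] (fun x => complex.Re (f' x)).
  move=> Af; have cf := subalgebra_continuous Aalg Af.
  have cRe := continuous_Re cf; have ccsq := continuous_csq cf.
  set D := tangent [:: h] (fun x => complex.Re (f' x)).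
  pose D2 := tangent [:: h] (fun x => csq (f' x)).
  have key (t : R) : 0 < t -> 2 * complex.Re (B (rho f' h) h) <= 2 * D + t * D2.
    move=> t0; pose g x := 2 * t * complex.Re (f' x) + t ^+ 2 * csq (f' x).
    have cg : continuous g by apply: continuousD; exact: continuousZ.
    have Atf := subalgebraZ Aalg t%:C Af; have A1 := subalgebra1 Aalg.
    have dom : dominated (1 + t%:C *: f') 1 g.
      split=> [|x]; first exact: (subalgebraD Aalg).
      change (csq (1 + t%:C * f' x) <= 1 + g x); rewrite /g.
      by case: (f' x) => y z; rewrite /csq /= !mul0r subr0 addr0 add0r; lra.
    have := le_tangent [:: h] cg dom.
    rewrite big_seq1 (repD rhoA) // (rep1 rhoA) (repZ rhoA) //.
    change (sq (h + t%:C *: rho f' h) - 1 * sq h <= tangent [:: h] g ->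
      2 * complex.Re (B (rho f' h) h) <= 2 * D + t * D2).
    rewrite -!ReBE (psd_sqD Bpsd) (psd_sqZ Bpsd) (psdZr Bpsd) conjc_real ReZ csq_real.
    rewrite (psdC Bpsd (rho f' h) h) ReJ /g tangentD ?tangentZ //; try exact: continuousZ.
    rewrite -/D -/D2.
    have := mulr_ge0 (sqr_ge0 t) (psd_ge0 Bpsd (rho f' h)).
    move=> p1 p2; rewrite -(ler_pM2l t0); lra.
  have D2_0 : 0 <= D2 by apply: tangent_ge0 => // x; exact: csq_ge0.
  apply/ler_addgt0Pr => e e0.
  have t0 : 0 < e / (D2 + 1) by rewrite divr_gt0 // ltr_wpDl.
  have := key _ t0.
  have : e / (D2 + 1) * D2 <= e.
    by rewrite mulrAC ler_pdivrMr ?ltr_wpDl // mulrDr mulr1 lerDl ltW.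
  by lra.
move=> Af; apply/eqP; rewrite eq_le ge // andbT.
have := ge _ (subalgebraN Aalg Af).
have -> : (fun x => complex.Re ((- f) x)) = (fun x => - complex.Re (f x)).
  by apply/funext => x; exact: ReN.
rewrite tangentN; last exact/continuous_Re/(subalgebra_continuous Aalg).
have -> : rho (- f) h = - rho f h.
  have -> : - f = (- 1) *: f by rewrite scaleN1r.
  rewrite (repZ rhoA) //.
  by change (- 1 *: rho f h = - rho f h); rewrite scaleN1r.
by rewrite (psdN Bpsd) ReN lerN2.
Qed.

Lemma tangent_ImE f h : A f -> tangent [:: h] (fun x => complex.Im (f x)) = complex.Im (B (rho f h) h).
Proof.
move=> Af; pose c : R[i] := Complex 0 (- 1).
have Rec (z : R[i]) : complex.Re (c * z) = complex.Im z.
  by case: z => y z; rewrite /c /=; ring.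
have := tangent_ReE h (subalgebraZ Aalg c Af).
have -> : (fun x => complex.Re ((c *: f) x)) = (fun x => complex.Im (f x)).
  by apply/funext => x; exact: Rec.
move=> ->; rewrite (repZ rhoA) //.
by change (complex.Re (B (c *: rho f h) h) = complex.Im (B (rho f h) h)); rewrite (psdZ Bpsd) Rec.
Qed.


Lemma tangentDZ_sum h (ys : seq X) (c : X -> R) (p : X -> X -> R) : (forall y, continuous (p y)) ->
  continuous (fun x => \sum_(y <- ys) c y * p y x) /\
  tangent [:: h] (fun x => \sum_(y <- ys) c y * p y x) = \sum_(y <- ys) c y * tangent [:: h] (p y).
Proof.
move=> cp; elim: ys => [|y ys [IHc IH]].
  have -> : (fun x => \sum_(y <- [::]) c y * p y x) = (fun=> 0).
    by apply/funext => x; rewrite big_nil.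
  by split; [move=> x; exact: cvg_cst|rewrite tangent_cst big_nil mul0r].
have -> : (fun x => \sum_(z <- y :: ys) c z * p z x) =
    (fun x => c y * p y x + \sum_(z <- ys) c z * p z x).
  by apply/funext => x; rewrite big_cons.
have cy : continuous (fun x => c y * p y x) by exact: continuousZ.
by split; [exact: continuousD|rewrite tangentD // tangentZ // IH big_cons].
Qed.

Lemma tangent_approx h (ys : seq X) (p : X -> X -> R) g (e : R) : continuous g ->
  (forall y, continuous (p y)) -> (forall y x, 0 <= p y x) ->
  (forall x, \sum_(y <- ys) p y x = 1) ->
  (forall y x, p y x != 0 -> `|g x - g y| <= e) ->
  `|tangent [:: h] g - \sum_(y <- ys) g y * tangent [:: h] (p y)| <= e * sq h.
Proof.
move=> cg cp p0 p1 gp.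
have [cs <-] := tangentDZ_sum h ys g cp.
rewrite -tangentN // -tangentD //; last exact: continuousN.
apply: tangent_norm_le => [|x]; first by apply: continuousD => //; exact: continuousN.
have -> : g x - \sum_(y <- ys) g y * p y x = \sum_(y <- ys) (g x - g y) * p y x.
  by rewrite -[g x in LHS]mulr1 -(p1 x) mulr_sumr -sumrB; apply: eq_bigr => y _; ring.
apply: le_trans (ler_norm_sum _ _ _) _.
rewrite -[e]mulr1 -(p1 x) mulr_sumr; apply: ler_sum => y _.
rewrite normrM (ger0_norm (p0 y x)).
have [->|pyx] := eqVneq (p y x) 0; first by rewrite !mulr0.
by rewrite ler_wpM2r // gp.
Qed.

Let ii : R[i] := Complex 0 1.

(** The real part of <rho(f) u, w> by polarization of <rho(f) h, h>, whose real
    and imaginary parts are the functionals of Re f and Im f. *)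
Lemma rep_polarization f u w : A f ->
  4 * complex.Re (B (rho f u) w) =
    tangent [:: u + w] (fun x => complex.Re (f x)) - tangent [:: u - w] (fun x => complex.Re (f x))
  - tangent [:: u + ii *: w] (fun x => complex.Im (f x))
  + tangent [:: u - ii *: w] (fun x => complex.Im (f x)).
Proof.
move=> Af; rewrite !tangent_ReE // !tangent_ImE // -!scaleNr -[w in u - w]scale1r -scaleNr.
rewrite !(repDl rhoA) // !(repZl rhoA) //.
rewrite !(psdD Bpsd) !(psdDr Bpsd) !(psdZ Bpsd) !(psdZr Bpsd).
case: (B (rho f u) u) (B (rho f u) w) (B (rho f w) u) (B (rho f w) w) => a a' [b b'] [c c'] [d d'].
rewrite /ii /=; ring.
Qed.

Lemma form_polarization (C : H -> H -> R[i]) (c : R[i]) u w : psd C ->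
  4 * complex.Re (C (c *: u) w) =
    complex.Re c * (complex.Re (C (u + w) (u + w)) - complex.Re (C (u - w) (u - w)))
  - complex.Im c * (complex.Re (C (u + ii *: w) (u + ii *: w))
                    - complex.Re (C (u - ii *: w) (u - ii *: w))).
Proof.
move=> Cpsd; rewrite !(psd_sqB Cpsd) !(psd_sqD Cpsd) (psdZ Cpsd) !(psdZr Cpsd).
case: c (C u w) => a b [x y]; rewrite /ii /=; ring.
Qed.

Lemma sq_polarization u w :
  sq (u + w) + sq (u - w) + sq (u + ii *: w) + sq (u - ii *: w) = 4 * (sq u + sq w).
Proof.
rewrite -!ReBE !(psd_sqB Bpsd) !(psd_sqD Bpsd) (psd_sqZ Bpsd).
by rewrite (_ : csq ii = 1) /csq /=; ring.
Qed.

(** Over the pieces of a fine partition of unity the matrix a is nearly constant,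
    so that rho(a) is nearly a sum of scalar contractions, each acting on tuples
    of vectors of its own positive form; these forms add up to that of H. *)
Lemma rep_matrix_contractive n (a : 'M[X -> R[i]]_n) (v : 'I_n -> H) :
  (forall i j, A (a i j)) -> (forall x, contraction (mxat x a)) ->
  \sum_i sq (\sum_j rho (a i j) (v j)) <= \sum_j sq (v j).
Proof.
move=> aA a1; pose w i := \sum_j rho (a i j) (v j).
set W := \sum_i sq (w i); set V := \sum_j sq (v j).
pose T := \sum_(i < n) \sum_(j < n) (sq (v j) + sq (w i)).
have T0 : 0 <= T.
  by apply: sumr_ge0 => i _; apply: sumr_ge0 => j _; rewrite addr_ge0 ?sq_ge0.
have ca i j := subalgebra_continuous Aalg (aA i j).
suff key (e : R) : 0 < e -> 2 * W <= V + W + 2 * e * T.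
  suff : 2 * W <= V + W by rewrite /W /w; lra.
  apply/ler_addgt0Pr => e e0.
  have t0 : 0 < e / (2 * T + 1) by rewrite divr_gt0 // ltr_wpDl // mulr_ge0.
  have := key _ t0.
  have : 2 * (e / (2 * T + 1)) * T <= e.
    have -> : 2 * (e / (2 * T + 1)) * T = e * (2 * T) / (2 * T + 1) by ring.
    rewrite ler_pdivrMr ?ltr_wpDl ?mulr_ge0 // mulrDr mulr1 lerDl; exact: ltW.
  by lra.
move=> e0.
pose d (x y : X) := \sum_i \sum_j csq (a i j x - a i j y).
have cd y : continuous (d ^~ y).
  apply: continuous_big => [|i _]; first exact: add_continuous.
  apply: continuous_big => [|j _]; first exact: add_continuous.
  by apply: continuous_csq => x; apply: cvgB; [exact: ca|exact: cvg_cst].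
have dd y : d y y = 0.
  by rewrite /d big1 // => i _; rewrite big1 // => j _; rewrite subrr csq0.
have [ys [p [cp p0 p1 pd]]] := partition_of_unity x0 compactX cd dd (exprn_gt0 2 e0).
have small i j x y : p y x != 0 -> csq (a i j x - a i j y) <= e ^+ 2.
  move/pd; apply: le_trans; rewrite /d (bigD1 i) //= (bigD1 j) //= -addrA lerDl.
  rewrite addr_ge0 //; first by apply: sumr_ge0 => *; exact: csq_ge0.
  by apply: sumr_ge0 => *; apply: sumr_ge0 => *; exact: csq_ge0.
have sq_abs (t : R) : t ^+ 2 <= e ^+ 2 -> `|t| <= e.
  by move=> h; rewrite -(@ler_pXn2r _ 2) ?nnegrE ?(ltW e0) // -normrX ger0_norm ?sqr_ge0.
have smallRe i j y x : p y x != 0 -> `|complex.Re (a i j x) - complex.Re (a i j y)| <= e.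
  move/small => /(_ i j) h; apply: sq_abs; apply: le_trans h.
  by rewrite -ReB /csq lerDl sqr_ge0.
have smallIm i j y x : p y x != 0 -> `|complex.Im (a i j x) - complex.Im (a i j y)| <= e.
  move/small => /(_ i j); case: (a i j x) (a i j y) => r r' [s s'] h; apply: sq_abs.
  by apply: le_trans h; rewrite /csq /= lerDr sqr_ge0.
have hform y := jordan_von_neumann (tangent_parallelogram (cp y)) (fun u => tangent_ge0 u (cp y) (p0 y)).
pose C y := sval (cid2 (hform y)).
have Cpsd y : psd (C y) by rewrite /C; case: cid2.
have CE y u : complex.Re (C y u u) = tangent [:: u] (p y).
  by rewrite /C; case: cid2 => /= C' _ ->.
have Csum u : \sum_(y <- ys) complex.Re (C y u u) = sq u.
  rewrite -[RHS]mul1r -tangent_cst.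
  have [_ hs] := tangentDZ_sum u ys (fun=> 1) cp.
  have -> : (fun=> 1) = (fun x => \sum_(y <- ys) 1 * p y x).
    apply/funext => x; rewrite -[LHS](p1 x).
    by apply: eq_bigr => y _; rewrite mul1r.
  by rewrite hs; apply: eq_bigr => y _; rewrite mul1r CE.
have entry i j : complex.Re (B (rho (a i j) (v j)) (w i)) <=
    \sum_(y <- ys) complex.Re (C y (a i j y *: v j) (w i)) + e * (sq (v j) + sq (w i)).
  rewrite -(ler_pM2l (_ : 0 < 4)) // rep_polarization // mulrDr mulr_sumr.
  have cRe := continuous_Re (ca i j); have cIm := continuous_Im (ca i j).
  have := tangent_approx (v j + w i) cRe cp p0 p1 (smallRe i j).
  have := tangent_approx (v j - w i) cRe cp p0 p1 (smallRe i j).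
  have := tangent_approx (v j + ii *: w i) cIm cp p0 p1 (smallIm i j).
  have := tangent_approx (v j - ii *: w i) cIm cp p0 p1 (smallIm i j).
  rewrite !ler_norml => /andP[_ h4] /andP[h3 _] /andP[h2 _] /andP[_ h1].
  have -> : \sum_(y <- ys) 4 * complex.Re (C y (a i j y *: v j) (w i)) =
      \sum_(y <- ys) complex.Re (a i j y) * tangent [:: v j + w i] (p y)
    - \sum_(y <- ys) complex.Re (a i j y) * tangent [:: v j - w i] (p y)
    - \sum_(y <- ys) complex.Im (a i j y) * tangent [:: v j + ii *: w i] (p y)
    + \sum_(y <- ys) complex.Im (a i j y) * tangent [:: v j - ii *: w i] (p y).
    rewrite -!sumrB -big_split; apply: eq_bigr => y _.
    by rewrite form_polarization // !CE /=; ring.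
  have := sq_polarization (v j) (w i).
  move: h1 h2 h3 h4; rewrite !lerBlDr !lerBrDr; nra.
have -> : 2 * W = \sum_i \sum_j 2 * complex.Re (B (rho (a i j) (v j)) (w i)).
  rewrite /W mulr_sumr; apply: eq_bigr => i _.
  by rewrite -ReBE {1}/w (psd_suml Bpsd) Re_sum mulr_sumr.
apply: (@le_trans _ _ (\sum_i \sum_j (2 * (\sum_(y <- ys) complex.Re (C y (a i j y *: v j) (w i)))
    + 2 * e * (sq (v j) + sq (w i))))).
  apply: ler_sum => i _; apply: ler_sum => j _.
  by rewrite -mulrA -mulrDr ler_pM2l // entry.
have -> : \sum_i \sum_j (2 * (\sum_(y <- ys) complex.Re (C y (a i j y *: v j) (w i)))
    + 2 * e * (sq (v j) + sq (w i))) =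
  \sum_(y <- ys) \sum_i 2 * complex.Re (C y (\sum_j a i j y *: v j) (w i)) + 2 * e * T.
  rewrite /T mulr_sumr [in RHS]exchange_big /= -big_split; apply: eq_bigr => i _ /=.
  rewrite mulr_sumr big_split; congr (_ + _).
  under [RHS]eq_bigr => y _ do rewrite (psd_suml (Cpsd y)) Re_sum mulr_sumr.
  by rewrite [RHS]exchange_big; apply: eq_bigr => j _; rewrite mulr_sumr.
rewrite lerD2r.
apply: (@le_trans _ _ (\sum_(y <- ys) (\sum_j complex.Re (C y (v j) (v j)) +
    \sum_i complex.Re (C y (w i) (w i))))); last first.
  have CsumI (z : 'I_n -> H) :
      \sum_(y <- ys) \sum_j complex.Re (C y (z j) (z j)) = \sum_j sq (z j).
    by rewrite exchange_big; apply: eq_bigr => j _; exact: Csum.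
  by rewrite big_split !CsumI.
apply: ler_sum => y _.
apply: (@le_trans _ _ (\sum_i (complex.Re (C y (\sum_j a i j y *: v j) (\sum_j a i j y *: v j)) +
    complex.Re (C y (w i) (w i))))).
  by apply: ler_sum => i _; exact: psd_AMGM.
rewrite big_split lerD2r.
have aE i : \sum_j mxat y a i j *: v j = \sum_j a i j y *: v j.
  by apply: eq_bigr => j _; rewrite mxE.
have := psd_contraction v (Cpsd y) (a1 y); apply: le_trans.
by apply: ler_sum => i _; rewrite -aE.
Qed.

End TangentFunctional.
(** * Complete contractivity *)

Section Sufficiency.
Variables (R : realType) (X : topologicalType) (A : set (X -> R[i])).
Variables (H : completeNormedModType R[i]) (rho : (X -> R[i]) -> (H -> H)).

Lemma mxsupnorm_ge0 n (a : 'M[X -> R[i]]_n) : 0 <= mxsupnorm a.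
Proof.
rewrite /mxsupnorm; set E := [set _ | _ in _].
have [[[y Ey] ub]|/sup_out -> //] := pselect (has_sup E).
case: (Ey) => x _ yE; apply: le_trans (mxopnorm_ge0 (mxat x a)) _.
by apply: ub_le_sup => //; exists x.
Qed.

Lemma mxopnorm_le_mxsupnorm n (a : 'M[X -> R[i]]_n) x : compact [set: X] ->
  (forall i j, continuous (a i j)) -> mxopnorm (mxat x a) <= mxsupnorm a.
Proof.
move=> compactX ca; apply: ub_le_sup; last by exists x.
have cs : continuous (fun x => \sum_i \sum_j csq (a i j x)).
  apply: continuous_big => [|i _]; first exact: add_continuous.
  apply: continuous_big => [|j _]; first exact: add_continuous.
  exact: continuous_csq.
have [M M0 hM] := compact_ubound compactX cs.
exists (Num.sqrt M) => _ [y _ <-]; apply: mxopnorm_le; first exact: sqrtr_ge0.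
move=> v; apply: le_trans (sqn_mulmx_le _ _) _; rewrite ler_wpM2r ?sqn_ge0 //.
rewrite sqr_sqrtr ?(ltW M0) //; apply: le_trans (hM y).
by apply: ler_sum => i _; apply: ler_sum => j _; rewrite mxE.
Qed.

Lemma rep_empty : contractive_representation A rho -> unital_subalgebra A ->
  ~ inhabited X -> forall v : H, v = 0.
Proof.
move=> rhoA Aalg noX v.
have e : (1 : X -> R[i]) = (0 : R[i]) *: (1 : X -> R[i]) by apply/funext => x; exfalso; apply: noX.
have := congr1 (fun F => F v) (repZ rhoA 0 (subalgebra1 Aalg)).
rewrite -e (rep1 rhoA) => ->; exact: scale0r.
Qed.

Lemma completely_contractive_of_matrix : compact [set: X] -> unital_subalgebra A ->
  contractive_representation A rho ->
  (forall n (a : 'M[X -> R[i]]_n) (v : 'I_n -> H),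
    (forall i j, A (a i j)) -> (forall x, contraction (mxat x a)) ->
    \sum_i rnorm (\sum_j rho (a i j) (v j)) ^+ 2 <= \sum_j rnorm (v j) ^+ 2) ->
  completely_contractive A rho.
Proof.
move=> compactX Aalg rhoA contr n a aA.
(* dividing by k > |a| makes a contractive at every point *)
apply/ler_addgt0Pr => e e0; set k := mxsupnorm a + e.
have k0 : 0 < k by rewrite ltr_wpDl ?mxsupnorm_ge0.
have l2norm0 : l2norm (fun _ : 'I_n => 0 : H) <= 1.
  by rewrite /l2norm big1 ?sqrtr0 // => j _; rewrite rnorm0 expr0n.
apply: opnorm_le => [||v]; [exact: ltW|by exists (fun=> 0)|].
pose a' := mxscale k^-1 a.
have a'A i j : A (a' i j) by rewrite mxE; exact: (subalgebraZ Aalg).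
have a'1 x : contraction (mxat x a').
  move=> z; rewrite mxat_scale -scalemxAl sqnZ csq_real exprVn mulrC ler_pdivrMr ?exprn_gt0 //.
  apply: le_trans (sqn_mulmx_mxopnorm _ _) _; rewrite mulrC ler_wpM2l ?sqn_ge0 //.
  rewrite ler_pXn2r ?nnegrE ?mxopnorm_ge0 ?(ltW k0) //.
  apply: le_trans (mxopnorm_le_mxsupnorm x compactX _) _; last by rewrite lerDl ltW.
  by move=> i j; exact: (subalgebra_continuous Aalg).
have := contr _ a' v a'A a'1; rewrite -!l2norm_sqr.
rewrite ler_pXn2r ?nnegrE ?l2norm_ge0 //.
have -> : (fun i => \sum_j rho (a' i j) (v j)) = k^-1%:C *: ampliation rho a v.
  apply/funext => i; change (\sum_j rho (a' i j) (v j) = k^-1%:C *: \sum_j rho (a i j) (v j)).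
  rewrite scaler_sumr; apply: eq_bigr => j _.
  by rewrite mxE (repZ rhoA _ (aA i j)).
by rewrite l2normZ ?invr_ge0 ?(ltW k0) // ler_pdivrMl.
Qed.

End Sufficiency.

Theorem theorem5p1 (R : realType) (X : topologicalType)
    (compactX : compact [set: X]) (hausdorffX : hausdorff_space X)
    (A : set (X -> R[i])) (logmodularA : logmodular A) :
  (forall (H : completeNormedModType R[i]) (rho : (X -> R[i]) -> (H -> H)),
     is_hilbert H -> contractive_representation A rho ->
     completely_contractive A rho)
  <->
  (forall f1 f2 : X -> R[i], A f1 -> A f2 ->
     (forall x, rnorm (f1 x) ^+ 2 + rnorm (f2 x) ^+ 2 < 1) ->
     exists (m : nat) (k : nat -> nat) (k0 : k 0%N = 2%N) (km : k m.+1 = 1%N)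
            (C : forall i, 'M[R[i]]_(k i, k i.+1))
            (D : forall i, 'rV[X -> R[i]]_(k i)),
       [/\ forall i, (i <= m)%N -> mxopnorm (C i) < 1,
           forall i, (1 <= i <= m)%N ->
             forall j, A (D i 0 j) /\ supnorm (D i 0 j) < 1
         & \col_(i < 2) [:: f1; f2]`_i
             = castmx (k0, km) (alternating_product C D m)]).
Proof.
have Aalg : unital_subalgebra A := logmodularA.1.
split=> [all_cc f1 f2 A1 A2 f_lt1|factorization H rho H_hilbert rhoA].
  exact/strictly_factorable_alternating/(column_strictly_factorable compactX Aalg all_cc).
apply: (completely_contractive_of_matrix compactX Aalg rhoA) => n a v aA a1.
have [[x0]|noX] := pselect (inhabited X); last first.
  have H0 := rep_empty rhoA Aalg noX.
  rewrite big1 => [|i _]; first by apply: sumr_ge0 => j _; exact: sqr_ge0.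
  by rewrite [\sum_j _]H0 rnorm0 expr0n.
have [B Bpsd BE] := (is_hilbert_psd H).1 H_hilbert.
have pair := pair_bicontractive Aalg rhoA H_hilbert factorization.
apply: (rep_matrix_contractive compactX logmodularA x0 rhoA Bpsd BE _ _ v aA a1).
  by move=> f1 f2 A1 A2 f_lt1; exact: (pair f1 f2 A1 A2 f_lt1).1.
by move=> f1 f2 A1 A2 f_lt1; exact: (pair f1 f2 A1 A2 f_lt1).2.
Qed.
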